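(* Let $X$ be a separable Banach space that has a subsymmetric sequence space $\mathbb{S}$ as a complemented subspace. Suppose also that $X$ has some nontrivial type (resp., some nontrivial cotype). Then $X$ has a bidemocratic (resp., squeeze-symmetric) total basis $\mathcal{B}$ with $$\tilde{k}_m[\mathcal{B},X]\approx\log(1+m),\qquad m\in\mathbb{N}.$$ Moreover, we can choose $\mathcal{B}$ so that it is not quasi-greedy.
   Context: Spaces are over $\mathbb{F}\in\{\mathbb{R},\mathbb{C}\}$ and infinite-dimensional; $\mathbb{E}=\{\lambda\in\mathbb{F}:|\lambda|=1\}$. For positive quantities, $\alpha_m\approx\beta_m$ means that each is bounded by a constant (independent of $m$) times the other. A basis of a (quasi-)Banach space $X$ is a sequence $\mathcal{X}=(x_n)_{n=1}^\infty$ with closed linear span $X$ for which there is a (unique) sequence $\mathcal{X}^*=(x_n^* )_{n=1}^\infty$ in $X^*$ with $x_n^*(x_k)=\delta_{k,n}$; it need not be a Schauder basis. The basis is total if $f\mapsto(x_n^*(f))_n$ is one-to-one on $X$. For finite $A\subseteq\mathbb{N}$, $S_A(f)=\sum_{n\in A}x_n^*(f)\,x_n$. Put $$\tilde{k}_m[\mathcal{X},X]=\sup\{\|S_A(f)\|: \|f\|\le 1,\ f\in[x_j:1\le j\le m],\ A\subseteq\mathbb{N}\},$$ where $[\,\cdot\,]$ denotes closed linear span, and $\varphi_u[\mathcal{X},X](m)=\sup\{\|\sum_{n\in A}x_n\|:|A|\le m\}$. A sequence space is a quasi-Banach space $Y$ with $c_{00}\subseteq Y\subseteq\mathbb{F}^{\mathbb{N}}$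 in which $c_{00}$ is dense and whose unit vector system $(e_n)$ is a basis with the usual coordinate functionals. It is symmetric (resp., subsymmetric) if $\|\sum_n\varepsilon_n a_n e_{\pi(n)}\|=\|\sum_n a_ne_n\|$ for all $(a_n)\in c_{00}$, all $(\varepsilon_n)\in\mathbb{E}^{\mathbb{N}}$ and all bijective (resp., increasing) maps $\pi:\mathbb{N}\to\mathbb{N}$. Its fundamental function is $\Lambda_m[\mathbb{S}]=\|\sum_{n\in A}e_n\|_{\mathbb{S}}$, for any $A$ with $|A|=m$. ''$X$ has $\mathbb{S}$ as a complemented subspace'' means that $\mathbb{S}$ is isomorphic to a complemented subspace of $X$. A basis $\mathcal{X}$ of $X$ is squeeze-symmetric if there are symmetric sequence spaces $\mathbb{S}_1,\mathbb{S}_2$ such that $(a_n)\mapsto\sum_n a_nx_n$ is a bounded operator from $\mathbb{S}_1$ into $X$, $f\mapsto(x_n^*(f))_n$ is a bounded operator from $X$ into $\mathbb{S}_2$, and $\Lambda_m[\mathbb{S}_1]\approx\Lambda_m[\mathbb{S}_2]$. It is bidemocratic if $\sup_m \frac1m\varphi_u[\mathcal{X},X](m)\,\varphi_u[\mathcal{X}^*,X^*](m)<\infty$. A finite set $A\subseteq\mathbb{N}$ is a greedy set of $f$ if $|x_n^*(f)|\ge|x_k^*(f)|$ whenever $n\in A$, $k\notin A$. A basis is quasi-greedy if there is a constant $C$ with $\|S_A(f)\|\le C\|f\|$ for all $f\in X$ and all greedy sets $A$ of $f$. Nontrivial type means type $>1$; nontrivial cotype means finite cotype. *)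

(* Defs.v *)
From HB Require Import structures.
From mathcomp Require Import all_boot all_order all_algebra.
From mathcomp Require Import all_classical all_reals all_analysis.
From mathcomp Require Import complex.

Set Implicit Arguments.
Unset Strict Implicit.
Unset Printing Implicit Defensive.

Import Order.TTheory GRing.Theory Num.Theory.
Import numFieldNormedType.Exports.

Local Open Scope classical_set_scope.
Local Open Scope ring_scope.

Variant scalar_kind := RealScalars | ComplexScalars.

Definition scalar_field (R : realType) (k : scalar_kind) : numFieldType :=
  match k with
  | RealScalars => R
  | ComplexScalars => R[i]
  end.

(* Norms over a numFieldType F take values in F.  For F = R[i] these values
   are nonnegative elements of R[i], hence have zero imaginary part, so
   [to_real] loses no information on them. *)
Definition to_real (R : realType) (k : scalar_kind) : scalar_field R k -> R :=
  match k with
  | RealScalars => fun a => a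
  | ComplexScalars => fun a => complex.Re a
  end.

(* alpha_m \approx beta_m, for m >= 1. *)
Definition approx_seq (R : realType) (u v : nat -> \bar R) : Prop :=
  exists C : R, 0 < C /\
    forall m, (0 < m)%N ->
      (u m <= C%:E * v m)%E /\ (v m <= C%:E * u m)%E.

Definition separable_space (T : topologicalType) : Prop :=
  exists D : set T, countable D /\ dense D.

(* Sequences are indexed from 0: the vector written x_(n+1) with 1-based
   indexing is [x n], and {1, ..., m} becomes [`I_m].  A sum over A : set nat
   is the sum of the finitely many nonzero terms with index in A. *)
Section Spaces.
Context {R : realType} {k : scalar_kind}.
Local Notation F := (scalar_field R k).

Definition rnorm (V : normedModType F) (v : V) : R := to_real `|v|.
Definition rabs (a : F) : R := to_real `|a|.

Definition linear_span (V : lmodType F) (E : set V) : set V :=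
  [set v | exists (n : nat) (c : 'I_n -> F) (u : 'I_n -> V),
     (forall i, E (u i)) /\ v = \sum_i c i *: u i].

Definition closed_span (V : normedModType F) (E : set V) : set V :=
  closure (linear_span E).

Definition unit_seq (n : nat) : nat -> F^o := fun i => (i == n)%:R.

Definition c00 : set (nat -> F^o) := [set a | finite_set [set n | a n != 0]].

(* A quasi-Banach space Y, [sq_norm] being relevant only on its underlying set
   [sq_car], in which c00 is dense and the coordinate functionals are bounded. *)
Record seq_space := SeqSpace {
  sq_car : set (nat -> F^o);
  sq_norm : (nat -> F^o) -> R;
  sq_c00 : c00 `<=` sq_car;
  sq_lin : forall (a : F) u v, sq_car u -> sq_car v -> sq_car (a *: u + v);
  sq_ge0 : forall u, sq_car u -> 0 <= sq_norm u;
  sq_eq0 : forall u, sq_car u -> sq_norm u = 0 -> u = 0;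
  sq_normZ : forall (a : F) u, sq_car u -> sq_norm (a *: u) = rabs a * sq_norm u;
  sq_quasi : exists K : R, forall u v, sq_car u -> sq_car v ->
    sq_norm (u + v) <= K * (sq_norm u + sq_norm v);
  sq_complete : forall u : nat -> nat -> F^o,
    (forall n, sq_car (u n)) ->
    (forall e : R, 0 < e -> exists N, forall p q, (N <= p)%N -> (N <= q)%N ->
       sq_norm (u p - u q) < e) ->
    exists l, sq_car l /\
      forall e : R, 0 < e -> exists N, forall p, (N <= p)%N ->
        sq_norm (u p - l) < e;
  sq_dense : forall u, sq_car u -> forall e : R, 0 < e ->
    exists v, c00 v /\ sq_norm (u - v) < e;
  sq_coord : forall n, exists C : R, forall u, sq_car u ->
    rabs (u n) <= C * sq_norm u
}.

Definition symmetric_space (S : seq_space) : Prop :=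
  forall (a : nat -> F^o) (eps : nat -> F) (pi : nat -> nat),
    c00 a -> (forall n, `|eps n| = 1) -> bijective pi ->
    sq_norm S (\sum_(n \in [set: nat]) (eps n * a n) *: unit_seq (pi n)) =
    sq_norm S (\sum_(n \in [set: nat]) a n *: unit_seq n).

Definition subsymmetric_space (S : seq_space) : Prop :=
  forall (a : nat -> F^o) (eps : nat -> F) (pi : nat -> nat),
    c00 a -> (forall n, `|eps n| = 1) -> {homo pi : m n / (m < n)%N} ->
    sq_norm S (\sum_(n \in [set: nat]) (eps n * a n) *: unit_seq (pi n)) =
    sq_norm S (\sum_(n \in [set: nat]) a n *: unit_seq n).

(* By (sub)symmetry any other set of m indices gives the same value. *)
Definition fundamental (S : seq_space) (m : nat) : R :=
  sq_norm S (\sum_(n \in `I_m) unit_seq n).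

Definition linear_on (V : lmodType F) (S : seq_space)
    (T : (nat -> F^o) -> V) : Prop :=
  forall (a : F) u v, sq_car S u -> sq_car S v ->
    T (a *: u + v) = a *: T u + T v.

Definition bounded_operator_from (V : normedModType F) (S : seq_space)
    (T : (nat -> F^o) -> V) : Prop :=
  linear_on S T /\
  exists C : R, forall u, sq_car S u -> rnorm (T u) <= C * sq_norm S u.

(* T is an isomorphism of S onto the range of the bounded projection P. *)
Definition has_complemented_subspace (X : normedModType F) (S : seq_space) :
    Prop :=
  exists (P : {linear X -> X}) (T : (nat -> F^o) -> X),
    continuous P /\ (forall f, P (P f) = P f) /\
    bounded_operator_from S T /\ T @` sq_car S = range P /\
    exists C : R, forall u, sq_car S u -> sq_norm S u <= C * rnorm (T u).

(* The average of ||\sum_i +-f_i||^p over all choices of signs. *)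
Definition rademacher_mean (X : normedModType F) (p : R) (n : nat)
    (f : 'I_n -> X) : R :=
  (2 ^+ n)^-1 * \sum_(e : {ffun 'I_n -> bool})
    rnorm (\sum_i (-1) ^+ e i *: f i) `^ p.

Definition has_type (X : normedModType F) (p : R) : Prop :=
  exists C : R, forall (n : nat) (f : 'I_n -> X),
    rademacher_mean p f `^ p^-1 <= C * (\sum_i rnorm (f i) `^ p) `^ p^-1.

Definition has_cotype (X : normedModType F) (q : R) : Prop :=
  exists C : R, forall (n : nat) (f : 'I_n -> X),
    (\sum_i rnorm (f i) `^ q) `^ q^-1 <= C * rademacher_mean q f `^ q^-1.

Definition nontrivial_type (X : normedModType F) : Prop :=
  exists p : R, 1 < p <= 2 /\ has_type X p.

Definition nontrivial_cotype (X : normedModType F) : Prop :=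
  exists q : R, 2 <= q /\ has_cotype X q.

Record space_basis (X : normedModType F) := Basis {
  bvec :> nat -> X;
  bdual : nat -> {linear X -> F^o};
  bdual_continuous : forall n, continuous (bdual n);
  bdual_bvec : forall n j, bdual n (bvec j) = (j == n)%:R;
  bvec_span : closed_span (range bvec) = setT
}.

Definition coeffs (X : normedModType F) (B : space_basis X) (f : X) : nat -> F^o :=
  fun n => bdual B n f.

Definition total_basis (X : normedModType F) (B : space_basis X) : Prop :=
  injective (coeffs B).

Definition coord_proj (X : normedModType F) (B : space_basis X) (A : set nat)
    (f : X) : X :=
  \sum_(n \in A) bdual B n f *: B n.

(* A need not be finite here: f has finitely many nonzero coefficients. *)
Definition ktilde (X : normedModType F) (B : space_basis X) (m : nat) : \bar R :=
  ereal_sup [set y | exists (f : X) (A : set nat),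
    [/\ rnorm f <= 1, closed_span (B @` `I_m) f
      & y = (rnorm (coord_proj B A f))%:E]].

Definition phi_u (V : zmodType) (N : V -> \bar R) (x : nat -> V) (m : nat) :
    \bar R :=
  ereal_sup [set N (\sum_(n \in A) x n) | A in [set A : set nat | (A #<= `I_m)%card]].

Definition dual_norm (X : normedModType F) (g : X -> F^o) : \bar R :=
  ereal_sup [set (rabs (g f))%:E | f in [set f : X | rnorm f <= 1]].

Definition phi_basis (X : normedModType F) (B : space_basis X) : nat -> \bar R :=
  phi_u (fun f : X => (rnorm f)%:E) B.

Definition phi_dual (X : normedModType F) (B : space_basis X) : nat -> \bar R :=
  phi_u (@dual_norm X) (fun n => bdual B n : X -> F^o).

Definition bidemocratic (X : normedModType F) (B : space_basis X) : Prop :=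
  (ereal_sup [set ((m%:R : R)^-1)%:E * (phi_basis B m * phi_dual B m)
             | m in [set m | (0 < m)%N]] < +oo)%E.

Definition squeeze_symmetric (X : normedModType F) (B : space_basis X) : Prop :=
  exists S1 S2 : seq_space,
    [/\ symmetric_space S1, symmetric_space S2,
        exists T : (nat -> F^o) -> X, bounded_operator_from S1 T /\
          forall a, sq_car S1 a -> series (fun n => a n *: B n) @ \oo --> T a,
        (forall f, sq_car S2 (coeffs B f)) /\
          exists C : R, forall f, sq_norm S2 (coeffs B f) <= C * rnorm f
      & approx_seq (fun m => (fundamental S1 m)%:E)
               (fun m => (fundamental S2 m)%:E)].

Definition greedy_set (X : normedModType F) (B : space_basis X) (f : X)
    (A : set nat) : Prop :=
  finite_set A /\
  forall n j, A n -> ~ A j -> `|bdual B j f| <= `|bdual B n f|.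

Definition quasi_greedy (X : normedModType F) (B : space_basis X) : Prop :=
  exists C : R, forall f A, greedy_set B f A ->
    rnorm (coord_proj B A f) <= C * rnorm f.

End Spaces.

(* Main.v *)
Require Import Defs.
From HB Require Import structures.
From mathcomp Require Import all_boot all_order all_algebra.
From mathcomp Require Import all_classical all_reals all_analysis.
From mathcomp Require Import complex ring lra zify.

Set Implicit Arguments.
Unset Strict Implicit.
Unset Printing Implicit Defensive.

Import Order.TTheory GRing.Theory Num.Theory.
Import numFieldNormedType.Exports.

Local Open Scope classical_set_scope.
Local Open Scope ring_scope.

(** The basis is obtained by replacing, in a well-behaved sequence [w] of vectors
    of the space, the means of long blocks by the members of a system [x] that
    is as conditional as possible: the construction of Dilworth, Kalton and
    Kutzarova. Everything that makes the result work is expressed by one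
    function [Lam], the fundamental function of [w].

    The sequence [w] comes from the complemented copy of the subsymmetric space.
    Let [Lam m] be the supremum of the norms of sums of [m] vectors [w j] with
    coefficients of modulus at most one. Averaging over shifts shows that the
    coordinate functionals, extended by the projection, satisfy the dual
    inequality: the coefficients of [f] over [m] indices have a sum of at most
    [C * m / Lam m * |f|] ([spreading_bidemocratic_family]). Nothing else
    about the subsymmetric space is used.

    Cotype forces [Lam] to double when its argument is multiplied by a suitable
    [r] ([cotype_lower_regular]); type forces this too, and moreover the same
    for [m / Lam m] ([type_regular]). For blocks whose lengths [N n] are in
    geometric progression of ratio [r], the sum of [Lam (N n) / N n] over [m]
    indices, [n] being the number of the block of the index, is then at most of
    order [Lam m] ([block_weights]). These numbers bound the changes made to [w]
    by the construction. Therefore the new basis [b] still satisfies two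
    estimates: sums over [m] indices with coefficients of modulus at most one
    have norm at most of order [Lam m] ([dkk_upper]), and a vector with [m]
    coefficients of modulus at least [t] has norm at least of order [t * Lam m]
    ([dkk_lower]). In terms of spaces, [b] lies between a symmetric space and
    the weak space of [Lam], both with fundamental function equivalent to [Lam]:
    this is squeeze symmetry. The two estimates also give the upper logarithmic
    bound, by halving the set of coordinates repeatedly ([projection_log]). If
    the growth of [m / Lam m] is regular as well, the sums of the dual
    coefficients are controlled ([dkk_dual]), and [b] is bidemocratic.

    What remains is to choose [x] conditional, and to span the whole space. Both
    are achieved by rows. The complement of the copy is separable, so it has a
    biorthogonal system [z] with dense span and total functionals
    ([markushevich]), on whose norms nothing is known. Each [z i], together with
    infinitely many vectors [w j], is turned into a row: a uniformly bounded
    biorthogonal system with the same span, in which the first [2 ^ i] vectors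
    have a bounded sum, while the first half of them has a sum of norm
    proportional to [2 ^ i] ([conditional_row]). Unbounded norms are cured by
    exchanging the vector in question against the mean of a very long block,
    whose members hardly notice their share of it ([exchange_bounds]).

    The rows and the normalised sums of the blocks of [w] form the system [x].
    Since the sum of [b] over the block [n] is a multiple of [x n], the sum of a
    row is a vector of bounded norm whose projection onto an initial segment of
    [b] has norm of order [2 ^ i], although it involves only the vectors of [b]
    up to a power of [r] with exponent of order [2 ^ i]. This is the lower
    logarithmic bound. The coefficients of that vector decrease from block to
    block because [Lam] is nondecreasing, hence the projection is greedy and [b]
    is not quasi-greedy ([assembled_witness]). *)

(** * Real norms and bounded functionals *)

(** Real scalars inside the scalar field; together with [to_real] this moves
    all estimates to the real line, whatever the scalars. *)
Definition sc {R : realType} {k : scalar_kind} : R -> scalar_field R k :=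
  match k with
  | RealScalars => fun r => r
  | ComplexScalars => fun r => (r%:C)%C
  end.

Section Scalars.
Context {R : realType} {k : scalar_kind}.
Local Notation F := (scalar_field R k).
Implicit Types (a b : F) (r s : R).

Lemma scD r s : sc (r + s) = sc r + sc s :> F.
Proof. by case: k => //=; rewrite rmorphD. Qed.
Lemma scB r s : sc (r - s) = sc r - sc s :> F.
Proof. by case: k => //=; rewrite rmorphB. Qed.
Lemma scN r : sc (- r) = - sc r :> F.
Proof. by case: k => //=; rewrite rmorphN. Qed.
Lemma scM r s : sc (r * s) = sc r * sc s :> F.
Proof. by case: k => //=; rewrite rmorphM. Qed.
Lemma sc1 : sc 1 = 1 :> F. Proof. by case: k. Qed.
Lemma sc0 : sc 0 = 0 :> F. Proof. by case: k. Qed.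
Lemma scV r : sc r^-1 = (sc r)^-1 :> F.
Proof. by case: k => //=; rewrite fmorphV. Qed.
Lemma sc_nat n : sc n%:R = n%:R :> F.
Proof. by case: k => //=; rewrite rmorph_nat. Qed.
Lemma sc_le r s : (sc r <= sc s :> F) = (r <= s).
Proof. by case: k => //=; rewrite lecR. Qed.
Lemma sc_lt r s : (sc r < sc s :> F) = (r < s).
Proof. by case: k => //=; rewrite ltcR. Qed.
Lemma sc_inj : injective (sc : R -> F).
Proof. by move=> r s rs; apply/le_anti; rewrite -!sc_le rs lexx. Qed.
Lemma sc_eq0 r : (sc r == 0 :> F) = (r == 0).
Proof. by rewrite -sc0 (inj_eq sc_inj). Qed.
Lemma norm_sc r : `|sc r : F| = sc `|r|.
Proof. by case: k => //=; rewrite normc_def /= expr0n addr0 sqrtr_sqr. Qed.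

Lemma sc_real (x : F) : 0 <= x -> x = sc (to_real x).
Proof.
by case: k x => //= -[a b]; rewrite lecE /= => /andP[/eqP -> _].
Qed.

Lemma rabsE a : `|a| = sc (rabs a).
Proof. exact: sc_real. Qed.

Lemma rabs_ge0 a : 0 <= rabs a.
Proof. by rewrite -(@sc_le 0) sc0 -rabsE. Qed.
Lemma rabs_sc r : rabs (sc r : F) = `|r|.
Proof. by apply: sc_inj; rewrite -rabsE norm_sc. Qed.
Lemma rabs0 : rabs (0 : F) = 0.
Proof. by rewrite -sc0 rabs_sc normr0. Qed.
Lemma rabs1 : rabs (1 : F) = 1.
Proof. by rewrite -sc1 rabs_sc normr1. Qed.
Lemma rabs_nat n : rabs (n%:R : F) = n%:R.
Proof. by rewrite -sc_nat rabs_sc normr_nat. Qed.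
Lemma rabsM a b : rabs (a * b) = rabs a * rabs b.
Proof. by apply: sc_inj; rewrite scM -!rabsE normrM. Qed.
Lemma rabsV a : rabs a^-1 = (rabs a)^-1.
Proof. by apply: sc_inj; rewrite scV -!rabsE normfV. Qed.
Lemma rabsD a b : rabs (a + b) <= rabs a + rabs b.
Proof. by rewrite -sc_le scD -!rabsE ler_normD. Qed.
Lemma rabsN a : rabs (- a) = rabs a.
Proof. by apply: sc_inj; rewrite -!rabsE normrN. Qed.
Lemma rabs_eq0 a : (rabs a == 0) = (a == 0).
Proof. by rewrite -sc_eq0 -rabsE normr_eq0. Qed.
Lemma rabs_gt0 a : (0 < rabs a) = (a != 0).
Proof. by rewrite lt0r rabs_eq0 rabs_ge0 andbT. Qed.
Lemma rabs_le a b : (`|a| <= `|b|) = (rabs a <= rabs b).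
Proof. by rewrite !rabsE sc_le. Qed.
Lemma rabs_unit a : (`|a| = 1) <-> (rabs a = 1).
Proof.
rewrite rabsE -sc1; split => [h|->//]; exact: sc_inj h.
Qed.

Section Norm.
Variable X : normedModType F.
Implicit Types x y : X.

Lemma rnormE x : `|x| = sc (rnorm x).
Proof. exact: sc_real. Qed.
Lemma rnorm_ge0 x : 0 <= rnorm x.
Proof. by rewrite -(@sc_le 0) sc0 -rnormE. Qed.
Lemma rnorm0 : rnorm (0 : X) = 0.
Proof. by apply: sc_inj; rewrite -rnormE normr0 sc0. Qed.
Lemma rnormZ a x : rnorm (a *: x) = rabs a * rnorm x.
Proof. by apply: sc_inj; rewrite scM -!rnormE -rabsE normrZ. Qed.
Lemma rnormD x y : rnorm (x + y) <= rnorm x + rnorm y.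
Proof. by rewrite -sc_le scD -!rnormE ler_normD. Qed.
Lemma rnormN x : rnorm (- x) = rnorm x.
Proof. by apply: sc_inj; rewrite -!rnormE normrN. Qed.
Lemma rnormB x y : rnorm (x - y) <= rnorm x + rnorm y.
Proof. by rewrite -(rnormN y) rnormD. Qed.
Lemma rdistC x y : rnorm (x - y) = rnorm (y - x).
Proof. by rewrite -rnormN opprB. Qed.
Lemma rnorm_eq0 x : (rnorm x == 0) = (x == 0).
Proof. by rewrite -sc_eq0 -rnormE normr_eq0. Qed.
Lemma rnorm0_eq0 x : rnorm x = 0 -> x = 0.
Proof. by move/eqP; rewrite rnorm_eq0 => /eqP. Qed.
Lemma rnorm_gt0 x : (0 < rnorm x) = (x != 0).
Proof. by rewrite lt0r rnorm_eq0 rnorm_ge0 andbT. Qed.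
Lemma rnorm_small x : (forall e, 0 < e -> rnorm x <= e) -> x = 0.
Proof.
move=> h; apply: rnorm0_eq0; apply/le_anti; rewrite rnorm_ge0 andbT.
by apply/ler_addgt0Pl => e /h; rewrite addr0.
Qed.
Lemma rnorm_sum I (s : seq I) (P : pred I) (f : I -> X) :
  rnorm (\sum_(i <- s | P i) f i) <= \sum_(i <- s | P i) rnorm (f i).
Proof.
elim/big_ind2 : _ => [|x r y s' hx hy|//]; first by rewrite rnorm0.
by apply: le_trans (rnormD _ _) _; exact: lerD.
Qed.

Lemma nbhs_rnorm x (E : set X) :
  nbhs x E <-> exists2 e : R, 0 < e & forall y, rnorm (x - y) < e -> E y.
Proof.
split.
  rewrite -nbhs_ballE => -[e /= e0 he]; exists (to_real e).
    by rewrite -(@sc_lt 0) sc0 -sc_real ?ltW.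
  move=> y xy; apply: he; rewrite -ball_normE /= rnormE (sc_real (ltW e0)).
  by rewrite sc_lt.
case=> e e0 he; rewrite -nbhs_ballE; exists (sc e).
  by rewrite /= -sc0 sc_lt.
by move=> y; rewrite -ball_normE /= rnormE sc_lt; exact: he.
Qed.

Lemma closure_rnorm (E : set X) x :
  closure E x <-> forall e : R, 0 < e -> exists2 v, E v & rnorm (x - v) < e.
Proof.
split=> [cl e e0|h B /nbhs_rnorm[e e0 he]].
  have /cl[v [Ev xv]] : nbhs x [set y | rnorm (x - y) < e].
    by apply/nbhs_rnorm; exists e.
  by exists v.
by have [v Ev xv] := h _ e0; exists v; split => //; exact: he.
Qed.

Lemma cvg_rnorm (u : nat -> X) (l : X) :
  (u @ \oo --> l) <-> forall e : R, 0 < e ->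
    exists N, forall n, (N <= n)%N -> rnorm (l - u n) < e.
Proof.
split=> [h e e0|h B /nbhs_rnorm[e e0 he]].
  have /h[N _ hN] : nbhs l [set y | rnorm (l - y) < e].
    by apply/nbhs_rnorm; exists e.
  by exists N => n; exact: hN.
have [N hN] := h _ e0; exists N => // n /= /hN; exact: he.
Qed.

End Norm.

Lemma rnormF a : rnorm (a : F^o) = rabs a. Proof. by []. Qed.

Lemma rabs_sum I (s : seq I) (P : pred I) (f : I -> F) :
  rabs (\sum_(i <- s | P i) f i) <= \sum_(i <- s | P i) rabs (f i).
Proof. exact: (@rnorm_sum F^o). Qed.

Section Func.
Variable X : normedModType F.
Implicit Types (x y : X) (phi psi : X -> F).

Definition bfunc (K : R) phi :=
  (forall a x y, phi (a *: x + y) = a * phi x + phi y) /\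
  (forall x, rabs (phi x) <= K * rnorm x).

Lemma bfunc0v K phi : bfunc K phi -> phi 0 = 0.
Proof. by case=> l _; have := l (-1) 0 0; rewrite scaler0 addr0 mulN1r addNr. Qed.
Lemma bfuncD K phi x y : bfunc K phi -> phi (x + y) = phi x + phi y.
Proof. by case=> l _; have := l 1 x y; rewrite scale1r mul1r. Qed.
Lemma bfuncZ K phi a x : bfunc K phi -> phi (a *: x) = a * phi x.
Proof.
by move=> b; have [l _] := b; have := l a x 0; rewrite !addr0 (bfunc0v b) addr0.
Qed.
Lemma bfuncN K phi x : bfunc K phi -> phi (- x) = - phi x.
Proof. by move=> b; rewrite -scaleN1r (bfuncZ _ _ b) mulN1r. Qed.
Lemma bfuncB K phi x y : bfunc K phi -> phi (x - y) = phi x - phi y.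
Proof. by move=> b; rewrite (bfuncD _ _ b) (bfuncN _ b). Qed.
Lemma bfunc_sum K phi I (s : seq I) (P : pred I) (f : I -> X) : bfunc K phi ->
  phi (\sum_(i <- s | P i) f i) = \sum_(i <- s | P i) phi (f i).
Proof.
move=> b; apply: (big_morph phi); last exact: bfunc0v b.
by move=> x y; exact: bfuncD b.
Qed.
Lemma bfunc_le K K' phi : bfunc K phi -> K <= K' -> bfunc K' phi.
Proof.
move=> [l h] KK; split => // x; apply: le_trans (h x) _.
by apply: ler_wpM2r => //; exact: rnorm_ge0.
Qed.
Lemma bfunc0 : bfunc 0 (fun=> 0).
Proof.
by split=> [a x y|x]; rewrite ?mulr0 ?addr0 // rabs0 mul0r.
Qed.
Lemma bfunc_add K L phi psi : bfunc K phi -> bfunc L psi ->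
  bfunc (K + L) (fun x => phi x + psi x).
Proof.
move=> [l h] [l' h']; split=> [a x y|x]; first by rewrite l l' mulrDr addrACA.
by rewrite mulrDl; apply: le_trans (rabsD _ _) _; exact: lerD.
Qed.
Lemma bfunc_scale K a phi : bfunc K phi ->
  bfunc (rabs a * K) (fun x => a * phi x).
Proof.
move=> [l h]; split=> [b x y|x]; first by rewrite l mulrDr !mulrA (mulrC a).
by rewrite rabsM -mulrA; apply: ler_wpM2l => //; exact: rabs_ge0.
Qed.
Lemma bfunc_bigsum I (s : seq I) (K : I -> R) (phi : I -> X -> F) :
  (forall i, bfunc (K i) (phi i)) ->
  bfunc (\sum_(i <- s) K i) (fun x => \sum_(i <- s) phi i x).
Proof.
move=> h; elim: s => [|i s IH].
  rewrite big_nil; split=> [a x y|x]; rewrite !big_nil ?mulr0 ?addr0 //.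
  by rewrite rabs0 mul0r.
rewrite big_cons; have [l b] := bfunc_add (h i) IH.
split=> [a x y|x]; rewrite !big_cons; [exact: l|exact: b].
Qed.
End Func.

Lemma rnorm_continuous_bounded (X Y : normedModType F) (f : {linear X -> Y}) :
  continuous f -> exists2 K : R, 0 < K & forall x, rnorm (f x) <= K * rnorm x.
Proof.
move=> /(_ 0) cf.
have /cf/nbhs_rnorm[e e0 he] : nbhs (f 0) [set y : Y | rnorm y < 1].
  by apply/nbhs_rnorm; exists 1 => // y; rewrite linear0 sub0r rnormN.
exists (2 / e) => [|x]; first by rewrite divr_gt0.
have [->|x0] := eqVneq x 0; first by rewrite linear0 !rnorm0 mulr0.
have nx : 0 < rnorm x by rewrite rnorm_gt0.
pose t := e / (2 * rnorm x).
have t0 : 0 < t by rewrite divr_gt0 ?mulr_gt0.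
have := he (sc t *: x); rewrite sub0r rnormN rnormZ rabs_sc gtr0_norm //.
have -> : t * rnorm x = e / 2 by rewrite /t; field; rewrite gt_eqF.
rewrite /= linearZ /= rnormZ rabs_sc gtr0_norm // => /(_ _)/ltW.
have -> : e / 2 < e by lra.
move=> /(_ isT) h; rewrite -(ler_pM2l t0); apply: le_trans h _.
by rewrite /t le_eqVlt; apply/orP; left; apply/eqP; field; rewrite !gt_eqF.
Qed.

Lemma rnorm_bounded_continuous (X Y : normedModType F) (f : {linear X -> Y}) (K : R) :
  (forall x, rnorm (f x) <= K * rnorm x) -> continuous f.
Proof.
move=> h x B /nbhs_rnorm[e e0 he]; apply/nbhs_rnorm.
have K1 : 0 < `|K| + 1 by rewrite ltr_wpDl.
exists (e / (`|K| + 1)) => [|y xy]; first by rewrite divr_gt0.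
apply: he; rewrite -linearB; apply: le_lt_trans (h _) _.
rewrite ltr_pdivlMr // mulrC in xy; apply: le_lt_trans xy.
apply: ler_wpM2r; first exact: rnorm_ge0.
by apply: le_trans (ler_norm _) _; rewrite lerDl.
Qed.
End Scalars.

(** * Norming functionals *)

Section HahnBanach.
Context {R : realType} {k : scalar_kind}.
Local Notation F := (scalar_field R k).

Definition sublinear (X : lmodType F) (q : X -> R) :=
  (forall x y, q (x + y) <= q x + q y) /\
  (forall t x, 0 < t -> q (sc t *: x) = t * q x).

Section Sublinear.
Variables (X : lmodType F) (q : X -> R).
Hypothesis qs : sublinear q.

Lemma sublinear0 : q 0 = 0.
Proof.
have [_ h] := qs; have := h 2 0; rewrite scaler0 => /(_ ltac:(lra)).
lra.
Qed.

Lemma sublinear_opp x : - q (- x) <= q x.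
Proof.
have [h _] := qs; have := h x (- x); rewrite subrr sublinear0.
lra.
Qed.

(** The largest sublinear functional below [q] taking the value [- q y] at
    [- y]: lowering [q] in this way is only possible where [q] fails to be
    odd. *)
Definition tilt (y x : X) : R :=
  inf [set q (x + sc t *: y) - t * q y | t in [set t : R | 0 <= t]].

Let tilt_lb y x :
  has_lbound [set q (x + sc t *: y) - t * q y | t in [set t : R | 0 <= t]].
Proof.
exists (- q (- x)) => _ [t /= t0 <-].
have [h hZ] := qs; have := h (x + sc t *: y) (- x).
rewrite [x + _]addrC addrK; have [t1|t1|t1] := ltgtP t 0.
- by have := le_lt_trans t0 t1; rewrite ltxx.
- by rewrite hZ //; lra.
by rewrite t1 sc0 scale0r add0r; have := sublinear_opp x; lra.
Qed.

Lemma tilt_le_at y x t : 0 <= t -> tilt y x <= q (x + sc t *: y) - t * q y.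
Proof. by move=> t0; apply: ge_inf; [exact: tilt_lb|exists t]. Qed.

Lemma tilt_ge y x c :
  (forall t, 0 <= t -> c <= q (x + sc t *: y) - t * q y) -> c <= tilt y x.
Proof.
move=> h; apply: lb_le_inf => [|_ [t /= t0 <-]]; last exact: h.
by exists (q (x + sc 0 *: y) - 0 * q y), 0 => //=.
Qed.

Lemma tilt_le y x : tilt y x <= q x.
Proof.
by have := @tilt_le_at y x 0 (lexx _); rewrite sc0 scale0r addr0 mul0r subr0.
Qed.

Lemma tilt_sublinear y : sublinear (tilt y).
Proof.
have [h hZ] := qs; split=> [a b|s x s0].
  rewrite -lerBlDr; apply: tilt_ge => t t0.
  rewrite lerBlDr [leRHS]addrC -lerBlDr; apply: tilt_ge => s s0.
  have := @tilt_le_at y (a + b) (t + s) (addr_ge0 t0 s0).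
  have := h (a + sc t *: y) (b + sc s *: y).
  rewrite addrACA -scalerDl -scD; lra.
apply/le_anti/andP; split.
  rewrite -ler_pdivrMl //; apply: tilt_ge => t t0.
  rewrite ler_pdivrMl //.
  have := @tilt_le_at y (sc s *: x) (s * t) (mulr_ge0 (ltW s0) t0).
  rewrite scM -scalerA -scalerDr hZ //; lra.
apply: tilt_ge => t t0.
have st : 0 <= s^-1 * t by rewrite mulr_ge0 // invr_ge0 ltW.
have := @tilt_le_at y x (s^-1 * t) st.
rewrite -(ler_pM2l s0) mulrBr -(hZ s _ s0) scalerDr scalerA -scM !mulrA mulfV ?gt_eqF //.
by rewrite !mul1r.
Qed.

End Sublinear.

Lemma tilt_opp (X : lmodType F) (q : X -> R) y :
  sublinear q -> tilt q y (- y) <= - q y.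
Proof.
move=> qs; have := tilt_le_at qs y (- y) ler01.
by rewrite sc1 scale1r addNr sublinear0 // sub0r mul1r.
Qed.

(** A minimal element among the sublinear functionals below a given one is
    linear, because it coincides with all its tilts. *)
Lemma minimal_sublinear (X : lmodType F) (p : X -> R) : sublinear p ->
  exists u : X -> R, [/\ forall x y, u (x + y) = u x + u y,
    forall t x, u (sc t *: x) = t * u x & forall x, u x <= p x].
Proof.
move=> ps.
pose T := {q : X -> R | sublinear q /\ forall x, q x <= p x}.
pose r (s t : T) := `[< forall x, sval t x <= sval s x >].
have [||||[q [qs qp]] qmin] := @Zorn T r.
- by move=> t; apply/asboolP.
- by move=> a b c /asboolP ab /asboolP bc; apply/asboolP => x; exact: le_trans (ab x).
- move=> [s hs] [t ht] /asboolP/= st /asboolP/= ts; apply: eq_exist.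
  by apply/funext => x; apply/le_anti; rewrite st ts.
- move=> A totA; have [[a0 Aa0]|noA] := pselect (A !=set0); last first.
    exists (exist _ p (conj ps (fun=> lexx _))) => s As.
    by case: noA; exists s.
  pose q x := inf [set sval s x | s in A].
  have qlb x : has_lbound [set sval s x | s in A].
    exists (- p (- x)) => _ [[s [ss sp]] _ <-] /=.
    by apply: le_trans (sublinear_opp ss x); rewrite lerN2.
  have q_le s x : A s -> q x <= sval s x.
    by move=> As; apply: ge_inf; [exact: qlb|exists s].
  have q_ge x c : (forall s, A s -> c <= sval s x) -> c <= q x.
    move=> h; apply: lb_le_inf => [|_ [s As <-]]; last exact: h.
    by exists (sval a0 x), a0.
  have qs : sublinear q.
    split=> [x y|t x t0].
      rewrite -lerBlDr; refine (q_ge _ _ _) => a Aa.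
      rewrite lerBlDr [leRHS]addrC -lerBlDr; refine (q_ge _ _ _) => b Ab; rewrite lerBlDr.
      have [/asboolP h|/asboolP h] := totA _ _ Aa Ab.
        have [hD _] := (svalP b).1.
        by have := q_le _ (x + y) Ab; have := hD x y; have := h x; lra.
      have [hD _] := (svalP a).1.
      by have := q_le _ (x + y) Aa; have := hD x y; have := h y; lra.
    apply/le_anti/andP; split.
      rewrite -ler_pdivrMl //; refine (q_ge _ _ _) => s As; rewrite ler_pdivrMl //.
      by have [_ hZ] := (svalP s).1; rewrite -hZ //; exact: q_le.
    refine (q_ge _ _ _) => s As; have [_ hZ] := (svalP s).1.
    by rewrite hZ // ler_pM2l //; exact: q_le.
  have qp x : q x <= p x.
    by apply: le_trans (q_le _ x Aa0) _; exact: (svalP a0).2.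
  by exists (exist _ q (conj qs qp)) => s As; apply/asboolP => x; exact: q_le.
have tq y : tilt q y = q.
  have tP : sublinear (tilt q y) /\ forall x, tilt q y x <= p x.
    split; first exact: tilt_sublinear.
    by move=> x; apply: le_trans (tilt_le qs _ _) _.
  have := qmin (exist _ _ tP) => /(_ _)/(congr1 sval)/= -> //.
  by apply/asboolP => x /=; exact: tilt_le.
have qD x y : q (x + y) = q x + q y.
  have [h _] := qs; apply/le_anti; rewrite h /= -lerBrDr.
  by rewrite -{1}(tq y); have := tilt_le_at qs y x ler01; rewrite sc1 scale1r mul1r.
have qN x : q (- x) = - q x.
  by have := qD x (- x); rewrite subrr sublinear0 //; lra.
exists q; split=> // t x.
have [t0|t0|->] := ltgtP t 0; last by rewrite sc0 scale0r mul0r sublinear0.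
  have [_ h] := qs; have := h (- t) x; rewrite oppr_gt0 => /(_ t0).
  by rewrite scN scaleNr qN mulNr => /oppr_inj.
by have [_ h] := qs; exact: h.
Qed.

End HahnBanach.

Section HahnBanachNormed.
Context {R : realType} {k : scalar_kind}.
Local Notation F := (scalar_field R k).

Lemma real_norming (X : normedModType F) (x0 : X) :
  exists u : X -> R, [/\ forall x y, u (x + y) = u x + u y,
    forall t x, u (sc t *: x) = t * u x, forall x, u x <= rnorm x
    & rnorm x0 <= u x0].
Proof.
have ns : sublinear (@rnorm R k X).
  split=> [x y|t x t0]; first exact: rnormD.
  by rewrite rnormZ rabs_sc gtr0_norm.
have [u [uD uZ u_le]] := minimal_sublinear (tilt_sublinear ns x0).
exists u; split=> // [x|]; first exact: le_trans (u_le x) (tilt_le ns _ _).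
have := le_trans (u_le (- x0)) (tilt_opp x0 ns).
have := uZ (-1) x0; rewrite scN sc1 scaleN1r => ->; lra.
Qed.
End HahnBanachNormed.

(** In the complex case a real functional [u] is the real part of
    [x |-> u x - i u (i x)]. *)
Lemma norming_functional {R : realType} {k : scalar_kind}
    (X : normedModType (scalar_field R k)) (x0 : X) :
  exists phi : X -> scalar_field R k, bfunc 2 phi /\ rnorm x0 <= rabs (phi x0).
Proof.
have [u [uD uZ u_le u0]] := real_norming x0.
have u_abs x : `|u x| <= rnorm x.
  rewrite ler_norml u_le andbT lerNl -(rnormN x); apply: le_trans (u_le _).
  by have := uZ (-1) x; rewrite scN sc1 scaleN1r => ->; rewrite mulN1r.
case: k X x0 u uD uZ u_le u0 u_abs => X x0 u uD uZ u_le u0 u_abs.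
  exists u; split; last exact: le_trans (ler_norm _).
  split=> [a x y|x]; first by rewrite uD (uZ a).
  by apply: le_trans (u_abs x) _; have := rnorm_ge0 x; lra.
pose phi x : R[i] := (u x +i* (- u ('i%C *: x)))%C.
exists phi; split; last first.
  apply: le_trans u0 _; rewrite /rabs /=.
  apply: le_trans (ler_norm _) _; rewrite -sqrtr_sqr ler_wsqrtr //.
  by rewrite lerDl sqr_ge0.
have uC a b x : u ((a +i* b)%C *: x) = a * u x + b * u ('i%C *: x).
  have -> : (a +i* b)%C = (a%:C + b%:C * 'i)%C :> R[i] by simpc.
  by rewrite scalerDl -scalerA uD (uZ a) (uZ b).
split=> [[a b] x y|x].
  rewrite /phi scalerDr !uD scalerA.
  have -> : ('i * (a +i* b) = (- b) +i* a :> R[i])%C by simpc.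
  rewrite (uC (- b) a) (uC a b); move: (u x) (u _) (u y) (u _) => p q r t.
  by apply/eqP; rewrite eq_complex /=; apply/andP; split; apply/eqP; ring.
pose j : scalar_field R ComplexScalars := 'i%C.
have -> : phi x = sc (u x) + j * sc (- u ('i%C *: x)).
  by rewrite /= /phi /j; simpc.
apply: le_trans (rabsD _ _) _; rewrite rabsM !rabs_sc normrN.
have ri : rabs j = 1.
  by rewrite /rabs /= expr0n /= add0r expr1n sqrtr1.
have := u_abs x; have := u_abs (j *: x); rewrite rnormZ ri !mul1r; lra.
Qed.

(** Norming functionals at the points of a dense sequence separate points. *)
Lemma separable_dense_total {R : realType} {k : scalar_kind}
    (X : normedModType (scalar_field R k)) : separable_space X ->
  exists (d : nat -> X) (h : nat -> X -> scalar_field R k),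
  [/\ forall x (e : R), 0 < e -> exists n, rnorm (x - d n) < e,
      forall n, bfunc 2 (h n)
    & forall x, (forall n, h n x = 0) -> x = 0].
Proof.
move=> [D [cD dD]].
have D0 : D !=set0.
  have [|x [_ Dx]] := dD [set: X] _ openT; last by exists x.
  by exists 0.
have [d dE] : exists d : nat -> X, D = range d.
  have /pfcard_geP := cD; case=> [D0'|[f]]; first by move: D0; rewrite D0' => -[].
  exists f; apply/esym; apply/seteqP; split=> [x [n _ <-]|x Dx]; first exact: funS.
  by have [n] := @surj _ _ _ _ f x Dx; exists n.
have dd x (e : R) : 0 < e -> exists n, rnorm (x - d n) < e.
  move=> e0; pose B := [set y | rnorm (x - y) < e].
  have oB : open B.
    rewrite openE => y By; apply/nbhs_rnorm.
    exists (e - rnorm (x - y)); first by rewrite subr_gt0.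
    move=> z yz; rewrite /B /=.
    have := rnormD (x - y) (y - z); rewrite addrA subrK; lra.
  have [|y [/= xy]] := dD B _ oB.
    by exists x; rewrite /B /= subrr rnorm0.
  by rewrite dE => -[n _ ny]; exists n; rewrite ny.
have /choice[h hP] n := norming_functional (d n).
exists d, h; split=> // [n|x hx]; first exact: (hP n).1.
apply: rnorm_small => e e0.
have [n xn] := dd x (e / 3) ltac:(lra).
have := (hP n).2; have -> : d n = x - (x - d n) by rewrite opprB addrC subrK.
rewrite (bfuncB _ _ (hP n).1) hx sub0r rabsN => h1.
have := (hP n).1.2 (x - d n).
have := rnormD (x - d n) (d n); rewrite subrK.
have := h1; have -> : x - (x - d n) = d n by rewrite opprB addrC subrK.
lra.
Qed.

(** * Spans and biorthogonal systems in separable spaces *)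

Definition submod (K : nzRingType) (V : lmodType K) (E : set V) :=
  E 0 /\ forall a x y, E x -> E y -> E (a *: x + y).

(** The linear span, encoded impredicatively: a vector is shown to lie in it
    by a derivation in an arbitrary subspace, without displaying coefficients. *)
Definition spn (K : nzRingType) (V : lmodType K) (I : Type) (u : I -> V) (v : V) :=
  forall E : set V, submod E -> (forall i, E (u i)) -> E v.

Section Submod.
Variables (K : nzRingType) (V : lmodType K).
Implicit Types (E : set V) (x y : V).

Lemma submodD E x y : submod E -> E x -> E y -> E (x + y).
Proof. by move=> [_ h] ex ey; rewrite -[x]scale1r; exact: h. Qed.
Lemma submodZ E a x : submod E -> E x -> E (a *: x).
Proof. by move=> [h0 h] ex; rewrite -[_ *: _]addr0; exact: h. Qed.
Lemma submodN E x : submod E -> E x -> E (- x).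
Proof. by move=> sE ex; rewrite -scaleN1r; exact: submodZ. Qed.
Lemma submodB E x y : submod E -> E x -> E y -> E (x - y).
Proof. by move=> sE ex ey; apply: submodD => //; exact: submodN. Qed.
Lemma submod_sum E I (s : seq I) (P : pred I) (f : I -> V) : submod E ->
  (forall i, P i -> E (f i)) -> E (\sum_(i <- s | P i) f i).
Proof.
move=> sE h; apply: (big_ind E) => //; first by case: sE.
by move=> x y; exact: submodD.
Qed.
Lemma submod_sum_seq E (I : eqType) (s : seq I) (f : I -> V) : submod E ->
  (forall i, i \in s -> E (f i)) -> E (\sum_(i <- s) f i).
Proof. by move=> sE h; rewrite big_seq; exact: submod_sum. Qed.
Lemma spn_submod I (u : I -> V) : submod (spn u).
Proof.
split=> [E [] //|a x y hx hy E sE uE].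
by case: (sE) => _; apply; [exact: hx|exact: hy].
Qed.
Lemma spn_in I (u : I -> V) i : spn u (u i).
Proof. by move=> E _; exact. Qed.
Lemma spn_trans I J (u : I -> V) (v : J -> V) x :
  spn u x -> (forall i, spn v (u i)) -> spn v x.
Proof. by move=> ux uv; apply: ux => //; exact: spn_submod. Qed.
End Submod.
Arguments submodD {K V E x y}.
Arguments submodB {K V E x y}.
Arguments submodN {K V E x}.
Arguments submodZ {K V E} a {x}.
Arguments submod_sum {K V E I s P f}.
Arguments submod_sum_seq {K V E I s f}.
Arguments spn_in {K V I} u i.
Arguments spn_submod {K V I} u.

Section SubmodFunc.
Context {R : realType} {k : scalar_kind}.
Local Notation F := (scalar_field R k).
Variable X : normedModType F.

Lemma submod_ker K (phi : X -> F) : bfunc K phi -> submod [set x | phi x = 0].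
Proof.
move=> b; split=> [|a x y /= hx hy]; first exact: bfunc0v b.
by have [l _] := b; rewrite l hx hy mulr0 addr0.
Qed.

Lemma submod_closure (E : set X) : submod E -> submod (closure E).
Proof.
move=> sE; split=> [|a x y /closure_rnorm hx /closure_rnorm hy].
  by apply: subset_closure; case: sE.
apply/closure_rnorm => e e0.
pose A := rabs a + 1; have A0 : 0 < A by have := rabs_ge0 a; rewrite /A; lra.
have [v Ev xv] := hx (e / (2 * A)) ltac:(by rewrite divr_gt0 // mulr_gt0).
have [w Ew yw] := hy (e / 2) ltac:(by rewrite divr_gt0).
exists (a *: v + w); first by case: sE => _; exact.
rewrite opprD addrACA -scalerBr.
apply: le_lt_trans (rnormD _ _) _; rewrite rnormZ.
have : rabs a * rnorm (x - v) <= A * (e / (2 * A)).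
  by apply: ler_pM; rewrite ?rabs_ge0 ?rnorm_ge0 ?ltW // /A; lra.
have -> : A * (e / (2 * A)) = e / 2 by field; rewrite gt_eqF.
lra.
Qed.

Lemma linear_span_submod (E : set X) : submod (linear_span E).
Proof.
split=> [|a _ _ [n [c [x [xE ->]]]] [m [d [y [yE ->]]]]].
  by exists 0%N, (fun=> 0), (fun=> 0); split=> [[]//|]; rewrite big_ord0.
exists (n + m)%N,
  (fun i => match fintype.split i with inl j => a * c j | inr j => d j end),
  (fun i => match fintype.split i with inl j => x j | inr j => y j end).
split=> [i|]; first by case: (fintype.split i).
rewrite big_split_ord /= scaler_sumr; congr (_ + _); apply: eq_bigr => i _.
  by rewrite (unsplitK (inl i)) scalerA.
by rewrite (unsplitK (inr i)).
Qed.

Lemma spn_linear_span I (u : I -> X) v : spn u v -> linear_span (range u) v.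
Proof.
apply=> [|i]; first exact: linear_span_submod.
exists 1%N, (fun=> 1), (fun=> u i); split=> [_|]; first by exists i.
by rewrite big_ord1 scale1r.
Qed.

Lemma bfunc_closure K (phi : X -> F) (E : set X) : bfunc K phi ->
  (forall x, E x -> phi x = 0) -> forall x, closure E x -> phi x = 0.
Proof.
move=> b h x /closure_rnorm cx; apply: (@rnorm0_eq0 _ _ F^o).
apply/le_anti; rewrite rnorm_ge0 andbT; apply/ler_addgt0Pl => e e0; rewrite addr0.
pose A := `|K| + 1; have A0 : 0 < A by rewrite ltr_wpDl.
have [v Ev xv] := cx (e / A) ltac:(by rewrite divr_gt0).
rewrite rnormF -(subrK v x) (bfuncD _ _ b) (h _ Ev) addr0.
have := b.2 (x - v).
have : K * rnorm (x - v) <= A * (e / A).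
  apply: le_trans (_ : A * rnorm (x - v) <= _).
    apply: ler_wpM2r; first exact: rnorm_ge0.
    by apply: le_trans (ler_norm _) _; rewrite /A lerDl.
  by rewrite ler_pM2l // ltW.
by rewrite mulrCA mulfV ?gt_eqF // mulr1; lra.
Qed.
End SubmodFunc.

Section Markushevich.
Context {R : realType} {k : scalar_kind}.
Local Notation F := (scalar_field R k).
Variable X : normedModType F.
Variables (pi : X -> X) (Kpi : R).
Hypothesis pi_lin : forall a x y, pi (a *: x + y) = a *: pi x + pi y.
Hypothesis pi_idem : forall x, pi (pi x) = pi x.
Hypothesis pi_bound : forall x, rnorm (pi x) <= Kpi * rnorm x.
Variables (d : nat -> X) (h : nat -> X -> F).
Hypothesis d_dense : forall x (e : R), 0 < e -> exists n, rnorm (x - d n) < e.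
Hypothesis h_bfunc : forall n, bfunc 2 (h n).
Hypothesis h_total : forall x, (forall n, h n x = 0) -> x = 0.

Local Notation pair := (X * (X -> F))%type.
Implicit Types (L : seq pair) (p : pair).

Let p0 : pair := (0, fun=> 0).

(** For a biorthogonal list [L], the projection along the span of its vectors
    onto the annihilator of its functionals. *)
Definition residual L x := x - \sum_(p <- L) p.2 x *: p.1.

(** Pairs of this kind live on the range of [pi], so that they can be combined
    with any biorthogonal system on its kernel. *)
Definition fixes_pair p := [/\ pi p.1 = p.1, exists K, bfunc K p.2
  & forall x, p.2 (pi x) = p.2 x].

Definition biorthogonal_list L := forall i, (i < size L)%N ->
  [/\ fixes_pair (nth p0 L i), residual L (nth p0 L i).1 = 0
    & forall x, (nth p0 L i).2 (residual L x) = 0].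

(** The obligation of step [n]: even steps put [pi (d n./2)] into the span of
    the vectors, odd steps make [h n./2] vanish on the annihilator of the
    functionals. *)
Definition captures n L :=
  if odd n then forall x, (forall i, (i < size L)%N -> (nth p0 L i).2 x = 0) ->
    h n./2 (pi x) = 0
  else exists c : nat -> F, pi (d n./2) = \sum_(i < size L) c i *: (nth p0 L i).1.

(** A step that finds its obligation already fulfilled adds the pair [p0]; such
    dead indices keep the position in the list equal to the number of the
    step. *)
Definition extends L n p := [/\ fixes_pair p, residual L p.1 = p.1,
  forall x, p.2 (residual L x) = p.2 x,
  p.2 p.1 = 1 \/ p = p0 & captures n (rcons L p)].

Let piZ a x : pi (a *: x) = a *: pi x.
Proof.
have pi0 : pi 0 = 0.
  by have := pi_lin (-1) 0 0; rewrite scaler0 addr0 scaleN1r addNr.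
by have := pi_lin a x 0; rewrite pi0 !addr0.
Qed.
Let piD x y : pi (x + y) = pi x + pi y.
Proof. by have := pi_lin 1 x y; rewrite !scale1r. Qed.
Let piN x : pi (- x) = - pi x.
Proof. by rewrite -scaleN1r piZ scaleN1r. Qed.
Let pi0 : pi 0 = 0.
Proof. by have := piZ 0 0; rewrite !scale0r. Qed.

Let resE L x : residual L x = x - \sum_(i < size L) (nth p0 L i).2 x *: (nth p0 L i).1.
Proof. by rewrite /residual (big_nth p0) big_mkord. Qed.

Let res_bounded L : biorthogonal_list L -> exists2 K : R, 0 <= K &
  (forall a x y, residual L (a *: x + y) = a *: residual L x + residual L y) /\
  (forall x, rnorm (residual L x) <= K * rnorm x).
Proof.
move=> bL.
have /choice[K hK] : forall i : 'I_(size L), exists K, bfunc K (nth p0 L i).2.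
  by move=> i; have [[_]] := bL i (ltn_ord i).
exists (1 + \sum_(i < size L) `|K i| * rnorm (nth p0 L i).1).
  apply: addr_ge0 => //; apply: sumr_ge0 => i _.
  by rewrite mulr_ge0 // rnorm_ge0.
split=> [a x y|x].
  rewrite !resE scalerBr scaler_sumr addrACA -opprD -big_split /=; congr (_ - _).
  by apply: eq_bigr => i _; have [l _] := hK i; rewrite l scalerDl scalerA.
rewrite resE; apply: le_trans (rnormB _ _) _; rewrite mulrDl mul1r lerD2l.
apply: le_trans (rnorm_sum _ _ _) _; rewrite mulr_suml; apply: ler_sum => i _.
rewrite rnormZ mulrAC; apply: ler_wpM2r; first exact: rnorm_ge0.
apply: le_trans ((hK i).2 x) _; apply: ler_wpM2r; first exact: rnorm_ge0.
exact: ler_norm.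
Qed.

Let res_idem L x : biorthogonal_list L -> residual L (residual L x) = residual L x.
Proof.
move=> bL; rewrite {1}resE big1 ?subr0 // => i _.
by have [_ _ ->] := bL i (ltn_ord i); rewrite scale0r.
Qed.

Let res_pi L x : biorthogonal_list L -> pi (residual L x) = residual L (pi x).
Proof.
move=> bL; rewrite !resE piD piN; congr (_ - _).
rewrite (big_morph pi piD pi0); apply: eq_bigr => i _.
by have [[e1 _ e2] _ _] := bL i (ltn_ord i); rewrite piZ e1 e2.
Qed.

Let hpi_func L i : biorthogonal_list L ->
  exists K, bfunc K (fun x => h i (pi (residual L x))).
Proof.
move=> bL; have [K K0 [rl rb]] := res_bounded bL; have [l b] := h_bfunc i.
exists (2 * (`|Kpi| * K)); split=> [a x y|x]; first by rewrite rl pi_lin l.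
apply: le_trans (b _) _; rewrite -mulrA ler_pM2l // -mulrA.
apply: le_trans (pi_bound _) _.
apply: le_trans (ler_wpM2r (rnorm_ge0 _) (ler_norm _)) _.
exact: ler_wpM2l.
Qed.

Let nth_rcons_lt L p i : (i < size L)%N -> nth p0 (rcons L p) i = nth p0 L i.
Proof. by move=> iL; rewrite nth_rcons iL. Qed.

Let nth_rcons_eq L p : nth p0 (rcons L p) (size L) = p.
Proof. by rewrite nth_rcons ltnn eqxx. Qed.

Let res0 L : biorthogonal_list L -> residual L 0 = 0.
Proof.
move=> bL; have [K _ [rl _]] := res_bounded bL.
by have := rl (-1) 0 0; rewrite scaler0 addr0 scaleN1r addNr.
Qed.

Let resZ L a x : biorthogonal_list L -> residual L (a *: x) = a *: residual L x.
Proof.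
move=> bL; have [K _ [rl _]] := res_bounded bL.
by have := rl a x 0; rewrite res0 // !addr0.
Qed.

Lemma fixes_pair0 : fixes_pair p0.
Proof. by split=> //; exists 0; exact: bfunc0. Qed.

(** When the obligation is open, one member of the new pair is forced: the
    residual of [pi (d n./2)], respectively the functional [h n./2] applied to
    the projected residual. As it does not vanish, totality of [h],
    respectively density of [d], provides a partner for it. *)
Lemma extension_step L n : biorthogonal_list L -> exists p, extends L n p.
Proof.
move=> bL; rewrite /extends /captures; case: (odd n).
  pose phi x := h n./2 (pi (residual L x)).
  have [K bK] : exists K, bfunc K phi := hpi_func n./2 bL.
  have phi_pi x : phi (pi x) = phi x.
    by rewrite /phi -res_pi // pi_idem.
  have phi_res x : phi (residual L x) = phi x by rewrite /phi res_idem.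
  have cap p : p = (p.1, phi) \/ phi = (fun=> 0) ->
      forall x, (forall i, (i < size (rcons L p))%N ->
        (nth p0 (rcons L p) i).2 x = 0) -> h n./2 (pi x) = 0.
    move=> hp x hx; have rx : residual L x = x.
      rewrite resE big1 ?subr0 // => i _.
      rewrite -(nth_rcons_lt p (ltn_ord i)) hx ?scale0r //.
      by rewrite size_rcons ltnS ltnW.
    have -> : pi x = pi (residual L x) by rewrite rx.
    rewrite -/(phi x); case: hp => [hp|->//].
    by have := hx (size L); rewrite nth_rcons_eq size_rcons hp; apply.
  have [[j hj]|hj] := pselect (exists j, phi (pi (d j)) <> 0).
    pose z := residual L (pi (d j)); pose c := (phi (pi (d j)))^-1.
    exists (c *: z, phi); split=> /=.
    - split=> //=; last by exists K.
      by rewrite piZ /z res_pi // pi_idem.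
    - by rewrite resZ // /z res_idem.
    - exact: phi_res.
    - by left; rewrite (bfuncZ _ _ bK) /z phi_res /c mulVf //; exact/eqP.
    - by apply: cap; left.
  have phi0 : phi = fun=> 0.
    apply/funext => x.
    apply: (@bfunc_closure _ _ _ K phi (range d) bK) => [_ [j _ <-]|].
      by rewrite -phi_pi; apply: contrapT => jn; apply: hj; exists j.
    apply/closure_rnorm => e e0; have [m xm] := d_dense x e0.
    by exists (d m) => //; exists m.
  exists p0; split=> //=; first exact: fixes_pair0.
  - exact: res0.
  - by right.
  - by apply: cap; right.
set z := residual L (pi (d n./2)).
have cap p : (exists a, z = a *: p.1) -> exists c : nat -> F,
    pi (d n./2) = \sum_(i < size (rcons L p)) c i *: (nth p0 (rcons L p) i).1.
  case=> a za; exists (fun i => if i == size L then a else (nth p0 L i).2 (pi (d n./2))).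
  rewrite size_rcons big_ord_recr /= eqxx nth_rcons_eq -za /z resE.
  under eq_bigr => i _ do rewrite nth_rcons_lt // ltn_eqF //.
  by rewrite addrC subrK.
have [z0|z0] := eqVneq z 0.
  exists p0; split=> //=; first exact: fixes_pair0.
  - exact: res0.
  - by right.
  - by apply: cap; exists 0; rewrite z0 scaler0.
have [j hj] : exists j, h j z <> 0.
  apply: contrapT => nj; move/eqP: z0; apply; apply: h_total => j.
  by apply: contrapT => hj; apply: nj; exists j.
have [K bK] := hpi_func j bL.
have piz : pi z = z by rewrite /z res_pi // pi_idem.
have rz : residual L z = z by rewrite /z res_idem.
exists (z, fun x => (h j z)^-1 * h j (pi (residual L x))); split=> //=.
- split=> //=; first by eexists; apply: bfunc_scale; exact: bK.
  by move=> x; rewrite -res_pi // pi_idem.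
- by move=> x; rewrite res_idem.
- by left; rewrite rz piz mulVf //; exact/eqP.
- by apply: cap; exists 1; rewrite scale1r.
Qed.

Lemma biorthogonal_rcons L n p : biorthogonal_list L -> extends L n p ->
  biorthogonal_list (rcons L p).
Proof.
move=> bL [fp rp pr pa _] i; rewrite size_rcons ltnS leq_eqVlt.
have resR x : residual (rcons L p) x = residual L x - p.2 x *: p.1.
  by rewrite /residual -cats1 big_cat big_seq1 opprD addrA.
have p20 : p.2 0 = 0 by have [_ [K bK] _] := fp; exact: bfunc0v bK.
case/predU1P => [->|iL].
  rewrite nth_rcons_eq; split=> // [|x].
    rewrite resR rp; case: pa => [->|->]; first by rewrite scale1r subrr.
    by rewrite /= scaler0 subrr.
  have [_ [K bK] _] := fp.
  rewrite resR (bfuncB _ _ bK) (bfuncZ _ _ bK) pr.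
  by case: pa => [->|->]; rewrite ?mulr1 ?subrr // /= mulr0 subrr.
have [fi ri hi] := bL i iL; rewrite nth_rcons_lt //; split=> // [|x].
  by rewrite resR ri sub0r -pr ri p20 scale0r oppr0.
have [_ [K bK] _] := fi.
by rewrite resR (bfuncB _ _ bK) (bfuncZ _ _ bK) hi -rp hi mulr0 subrr.
Qed.

(** Gram--Schmidt alternating between the vectors [pi (d n)] and the functionals
    [h n]: orthogonalising only the former gives a biorthogonal system whose
    functionals need not separate the points of the range of [pi]. *)
Lemma markushevich : exists (z : nat -> X) (zeta : nat -> X -> F) (alive : nat -> bool),
  [/\ forall i, fixes_pair (z i, zeta i),
      forall i j, zeta i (z j) = (alive i && (i == j))%:R,
      forall i, ~~ alive i -> z i = 0 /\ forall x, zeta i x = 0,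
      forall n, spn z (pi (d n))
    & forall x, (forall i, zeta i x = 0) -> pi x = 0].
Proof.
have /choice[g hg] : forall Ln : seq pair * nat, exists p,
    biorthogonal_list Ln.1 -> extends Ln.1 Ln.2 p.
  move=> [L n] /=; have [bL|nb] := pselect (biorthogonal_list L); last by exists p0.
  by have [p hp] := extension_step n bL; exists p.
pose fix Ls n := if n is m.+1 then rcons (Ls m) (g (Ls m, m)) else [::].
pose q n := g (Ls n, n).
have sL n : size (Ls n) = n by elim: n => //= n IH; rewrite size_rcons IH.
have bL n : biorthogonal_list (Ls n).
  elim: n => [//|n IH] /=; apply: biorthogonal_rcons IH (hg (Ls n, n) IH).
have hq n : extends (Ls n) n (q n) := hg (Ls n, n) (bL n).
have nL n i : (i < n)%N -> nth p0 (Ls n) i = q i.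
  elim: n => // n IH; rewrite ltnS leq_eqVlt => /predU1P[->|ni] /=.
    by have := nth_rcons_eq (Ls n) (q n); rewrite sL.
  by rewrite nth_rcons_lt ?sL // IH.
have lt1 i j : (i < j)%N -> (q i).2 (q j).1 = 0.
  move=> ij; have [_ rp _ _ _] := hq j; rewrite -rp.
  by have [|_ _] := bL j i; [rewrite sL|rewrite nL].
have lt2 i j : (i < j)%N -> (q j).2 (q i).1 = 0.
  move=> ij; have [[_ [K bK] _] _ rp _ _] := hq j; rewrite -rp.
  have [|_ + _] := bL j i; first by rewrite sL.
  by rewrite nL // => ->; exact: bfunc0v bK.
have fq i : fixes_pair ((q i).1, (q i).2) by have [] := hq i; case: (q i).
exists (fun i => (q i).1), (fun i => (q i).2), (fun i => (q i).2 (q i).1 == 1).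
split=> //.
- move=> i j; have [ij|ij|->] := ltngtP i j; [by rewrite andbF lt1|by rewrite andbF lt2|].
  rewrite andbT; case: eqP => [->//|ne].
  by have [_ _ _ [//|->]] := hq j.
- by move=> i ne; have [_ _ _ [/eqP|->]] := hq i; [rewrite (negbTE ne)|].
- move=> n E sE uE; have [_ _ _ _] := hq n.*2.
  rewrite /captures odd_double doubleK => -[c ->].
  apply: submod_sum => // i _; apply: submodZ => //.
  have := @nL n.*2.+1 i => /= -> //.
  by apply: leq_trans (ltn_ord i) _; rewrite size_rcons sL.
- move=> x hx; apply: h_total => n; have [_ _ _ _] := hq n.*2.+1.
  rewrite /captures /= odd_double /= uphalf_double; apply=> i.
  have -> : rcons (Ls n.*2.+1) (q n.*2.+1) = Ls n.*2.+2 by [].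
  by rewrite sL => /nL ->.
Qed.

End Markushevich.

(** * Exchange and shear of biorthogonal systems *)

Lemma sumr_const_seq (V : zmodType) (I : Type) (s : seq I) (x : V) :
  \sum_(i <- s) x = x *+ size s.
Proof. by rewrite big_const_seq count_predT iter_addr addr0. Qed.

Section ExchangeIdentities.
Variables (K : fieldType) (n mu la x : K).
Hypotheses (n0 : n != 0) (mu0 : mu != 0) (la0 : la != 0).
Lemma exchange_identity_aa : mu / n * (mu^-1 * n) = 1.
Proof. by field; rewrite n0 mu0. Qed.
Lemma exchange_identity_as : mu / n * (1 - n^-1 * n + la / n * 0) = 0.
Proof. by field. Qed.
Lemma exchange_identity_sa :
  mu^-1 * 1 - n^-1 * (mu^-1 * n) + la^-1 * (mu^-1 * 0) = 0.
Proof. by field; rewrite mu0 n0 la0. Qed.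
Lemma exchange_identity_ss :
  x - n^-1 * 1 + la / n * 0 - n^-1 * (1 - n^-1 * n + la / n * 0) +
  la^-1 * (0 - n^-1 * 0 + la / n * 1) = x.
Proof. by field; rewrite n0 la0. Qed.
End ExchangeIdentities.

Section Systems.
Context {R : realType} {k : scalar_kind}.
Local Notation F := (scalar_field R k).
Variable X : normedModType F.

Definition biorthogonal (I : eqType) (u : I -> X) (us : I -> X -> F) :=
  forall i j, us i (u j) = (i == j)%:R.

Definition bounded_functionals (I : Type) (us : I -> X -> F) :=
  forall i, exists K, bfunc K (us i).

(** Such systems are interchangeable in questions of density and totality. *)
Definition same_system (I J : Type) (u : I -> X) (us : I -> X -> F)
    (v : J -> X) (vs : J -> X -> F) :=
  [/\ forall i, spn v (u i), forall j, spn u (v j) &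
      forall x, (forall i, us i x = 0) <-> (forall j, vs j x = 0)].

Lemma same_system_trans (I J K : Type) (u : I -> X) us (v : J -> X) vs (w : K -> X) ws :
  same_system u us v vs -> same_system v vs w ws -> same_system u us w ws.
Proof.
move=> [uv vu a] [vw wv b]; split=> [i|i|x].
- exact: spn_trans (uv i) vw.
- exact: spn_trans (wv i) vu.
- by rewrite a b.
Qed.

Section BlockSums.
Variables (I : eqType) (u : I -> X) (us : I -> X -> F) (s : seq I).
Hypotheses (bu : biorthogonal u us) (fu : bounded_functionals us) (us_s : uniq s).

Lemma biorth_sum i : us i (\sum_(j <- s) u j) = (i \in s)%:R.
Proof.
have [K b] := fu i; rewrite (bfunc_sum _ _ _ b).
under eq_bigr => j _ do rewrite bu.
case: (boolP (i \in s)) => is_; last first.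
  by rewrite big_seq big1 // => j js; case: eqP => // ij; rewrite ij js in is_.
rewrite (bigD1_seq i) //= eqxx big1 ?addr0 // => j ji.
by rewrite eq_sym (negbTE ji).
Qed.

Lemma biorth_sumf j (c : I -> F) :
  \sum_(i <- s) c i * us i (u j) = (j \in s)%:R * c j.
Proof.
under eq_bigr => i _ do rewrite bu.
case: (boolP (j \in s)) => js; last first.
  rewrite mul0r big_seq big1 // => i is_.
  by case: eqP => [ij|]; [rewrite -ij is_ in js|rewrite mulr0].
rewrite (bigD1_seq j) //= eqxx big1 ?addr0 ?mulr1 ?mul1r // => i ij.
by rewrite (negbTE ij) mulr0.
Qed.

Lemma biorth_sumf1 j : \sum_(i <- s) us i (u j) = (j \in s)%:R.
Proof.
have := biorth_sumf j (fun=> 1); rewrite mulr1 => <-.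
by apply: eq_bigr => i _; rewrite mul1r.
Qed.

Lemma biorth_sumsum : \sum_(i <- s) us i (\sum_(j <- s) u j) = (size s)%:R.
Proof.
under eq_bigr => i _ do rewrite biorth_sum.
rewrite big_seq (eq_bigr (fun=> 1)) => [|i ->] //.
by rewrite -big_seq sumr_const_seq.
Qed.
End BlockSums.

(** Exchange of the vector [u a] against the mean of the block [s]. The members
    of [s] lose their mean and absorb equal shares of [u a], and the index [a]
    receives a multiple of their former sum: the number of vectors is the same,
    but now the sum of the block is a multiple of [u a]. *)
Section Exchange.
Variables (I : eqType) (u : I -> X) (us : I -> X -> F).
Variables (a : I) (s : seq I) (la mu : F).
Local Notation om := (\sum_(j <- s) u j).
Local Notation oms x := (\sum_(j <- s) us j x).
Local Notation N := ((size s)%:R : F).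

Definition exchange_vec i :=
  if i == a then mu^-1 *: om
  else if i \in s then u i - N^-1 *: om + (la / N) *: u a else u i.

Definition exchange_fun i x :=
  if i == a then mu / N * oms x
  else if i \in s then us i x - N^-1 * oms x + la^-1 * us a x else us i x.

Hypotheses (bu : biorthogonal u us) (fu : bounded_functionals us) (us_s : uniq s).
Hypotheses (as_ : a \notin s) (s0 : (0 < size s)%N) (la0 : la != 0) (mu0 : mu != 0).

Let N0 : N != 0. Proof. by rewrite pnatr_eq0 -lt0n. Qed.

Let neq_a i : i \in s -> (i == a) = false.
Proof. by move=> is_; apply: contraNF as_ => /eqP <-. Qed.

Lemma exchange_bounded : bounded_functionals exchange_fun.
Proof.
have /choice[K hK] := fu.
have bo c := bfunc_scale c (bfunc_bigsum s hK).
move=> i; rewrite /exchange_fun; case: (i == a); first by eexists; exact: bo.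
case: (i \in s); last by exists (K i).
eexists; apply: bfunc_add; last by apply: bfunc_scale; exact: hK.
have := bfunc_add (hK i) (bo (- N^-1)).
rewrite (_ : (fun x => us i x + - N^-1 * oms x) = fun x => us i x - N^-1 * oms x).
  by apply.
by apply/funext => x; rewrite mulNr.
Qed.

Lemma exchange_biorth : biorthogonal exchange_vec exchange_fun.
Proof.
have fsum := biorth_sum bu fu us_s.
move=> i j; rewrite /exchange_fun.
have so x : \sum_(j <- s) us j x = oms x by [].
have oa : oms (u a) = 0 by rewrite (biorth_sumf1 bu us_s) (negbTE as_).
have oo : oms om = N by exact: biorth_sumsum.
have Zo c x : oms (c *: x) = c * oms x.
  rewrite mulr_sumr; apply: eq_bigr => t _.
  by have [K b] := fu t; rewrite (bfuncZ _ _ b).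
have Do x y : oms (x + y) = oms x + oms y.
  rewrite -big_split; apply: eq_bigr => t _.
  by have [K b] := fu t; rewrite (bfuncD _ _ b).
have No x : oms (- x) = - oms x by rewrite -scaleN1r Zo mulN1r.
have Zu t c x : us t (c *: x) = c * us t x.
  by have [K b] := fu t; rewrite (bfuncZ _ _ b).
have Du t x y : us t (x + y) = us t x + us t y.
  by have [K b] := fu t; rewrite (bfuncD _ _ b).
have Nu t x : us t (- x) = - us t x by rewrite -scaleN1r Zu mulN1r.
have oj t : oms (u t) = (t \in s)%:R by rewrite (biorth_sumf1 bu us_s).
have [->|ia] := eqVneq i a.
  rewrite /exchange_vec; have [ja|ja] := eqVneq j a.
    by rewrite Zo oo; exact: exchange_identity_aa.
  case: ifP => js; last by rewrite oj js mulr0 ?(eq_sym a) ?(negbTE ja).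
  by rewrite !Do No !Zo oo oa oj js ?(eq_sym a) ?(negbTE ja); exact: exchange_identity_as.
case: ifP => is_.
  rewrite /exchange_vec; have [ja|ja] := eqVneq j a.
    rewrite ja !Zo !Zu oo !fsum is_ (negbTE as_) ?(negbTE ia).
    exact: exchange_identity_sa.
  case: ifP => js; last first.
    rewrite oj js !bu ?(eq_sym a) ?(negbTE ja) (negbTE (_ : i != j)).
      by rewrite !mulr0 subr0 addr0.
    by apply/eqP => ij; rewrite -ij is_ in js.
  rewrite !Do !No !Zo !Du !Nu !Zu oo oa oj js !fsum is_ (negbTE as_) !bu.
  rewrite ?eqxx ?(eq_sym a) ?(negbTE ja) ?(negbTE ia).
  exact: exchange_identity_ss.
rewrite /exchange_vec; have [ja|ja] := eqVneq j a.
  by rewrite ja Zu fsum is_ mulr0 ?(negbTE ia).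
case: ifP => js //.
by rewrite !Du Nu !Zu fsum is_ !bu ?(negbTE ia) !mulr0 subr0 addr0.
Qed.

Let ex_a : exchange_vec a = mu^-1 *: om.
Proof. by rewrite /exchange_vec eqxx. Qed.

Lemma exchange_block_sum : \sum_(i <- s) exchange_vec i = la *: u a.
Proof.
rewrite big_seq (eq_bigr (fun i => u i - N^-1 *: om + (la / N) *: u a)); last first.
  by move=> i is_; rewrite /exchange_vec neq_a // is_.
rewrite -big_seq !big_split /= sumrN !sumr_const_seq.
have mulrnE (x : X) : x *+ size s = N *: x by rewrite scaler_nat.
by rewrite !mulrnE !scalerA divff // scale1r subrr add0r mulrCA divff // mulr1.
Qed.

Lemma exchange_same_system : same_system u us exchange_vec exchange_fun.
Proof.
have sm := spn_submod exchange_vec.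
have so : spn exchange_vec om.
  have -> : om = mu *: exchange_vec a by rewrite ex_a scalerA divff // scale1r.
  by apply: (submodZ _ sm); exact: spn_in.
have sa : spn exchange_vec (u a).
  have -> : u a = la^-1 *: \sum_(i <- s) exchange_vec i.
    by rewrite exchange_block_sum scalerA mulVf // scale1r.
  by apply: (submodZ _ sm); apply: (submod_sum sm) => i _; exact: spn_in.
split.
- move=> i; have [->//|ia] := eqVneq i a.
  have := spn_in exchange_vec i; rewrite {2}/exchange_vec (negbTE ia).
  case: ifP => // is_ h.
  have -> : u i = u i - N^-1 *: om + (la / N) *: u a - (la / N) *: u a + N^-1 *: om.
    by rewrite addrK subrK.
  apply: (submodD sm); last by apply: (submodZ _ sm).
  by apply: (submodB sm h); apply: (submodZ _ sm).
- have su := spn_submod u.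
  have suo : spn u om by apply: (submod_sum su) => i _; exact: spn_in.
  move=> i; rewrite /exchange_vec; case: eqP => _; first by apply: (submodZ _ su).
  case: ifP => _; last exact: spn_in.
  apply: (submodD su); last by apply: (submodZ _ su); exact: spn_in.
  by apply: (submodB su); [exact: spn_in|apply: (submodZ _ su)].
- move=> x; split=> [h j|h].
    have o0 : oms x = 0 by rewrite big1.
    by rewrite /exchange_fun o0 !h !mulr0 subr0 addr0; case: eqP => // _; case: ifP.
  have o0 : oms x = 0.
    have := h a; rewrite /exchange_fun eqxx => /eqP.
    by rewrite mulf_eq0 mulf_eq0 invr_eq0 (negbTE N0) (negbTE mu0) /= => /eqP.
  have hs i : i \in s -> us i x + la^-1 * us a x = 0.
    by move=> is_; have := h i; rewrite /exchange_fun neq_a // is_ o0 mulr0 subr0.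
  have a0 : us a x = 0.
    have : \sum_(i <- s) (us i x + la^-1 * us a x) = 0.
      by rewrite big_seq big1 // => i /hs.
    rewrite big_split /= o0 add0r sumr_const_seq.
    rewrite -mulr_natl => /eqP; rewrite !mulf_eq0 invr_eq0 (negbTE N0) (negbTE la0).
    by move/eqP.
  move=> i; have [->//|ia] := eqVneq i a.
  case: (boolP (i \in s)) => is_; first by have := hs i is_; rewrite a0 mulr0 addr0.
  by have := h i; rewrite /exchange_fun (negbTE ia) (negbTE is_).
Qed.

End Exchange.

Section Shear.
Variables (I : eqType) (u : I -> X) (us : I -> X -> F).
Variables (e : I) (s : seq I) (eps : I -> F).

Definition shear_vec i := if i \in s then u i + eps i *: u e else u i.
Definition shear_fun i x :=
  if i == e then us e x - \sum_(j <- s) eps j * us j x else us i x.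

Hypotheses (bu : biorthogonal u us) (fu : bounded_functionals us) (us_s : uniq s).
Hypotheses (es_ : e \notin s).

Lemma shear_bounded : bounded_functionals shear_fun.
Proof.
have /choice[K hK] := fu.
move=> i; rewrite /shear_fun; case: (i == e); last by exists (K i).
have := bfunc_bigsum s (fun j => bfunc_scale (- eps j) (hK j)).
move=> /(bfunc_add (hK e)) b; eexists.
rewrite (_ : (fun x => _) = fun x => us e x + \sum_(j <- s) - eps j * us j x).
  exact: b.
apply/funext => x; rewrite -sumrN; congr (_ + _).
by apply: eq_bigr => j _; rewrite mulNr.
Qed.

Lemma shear_biorth : biorthogonal shear_vec shear_fun.
Proof.
have Zu t c x : us t (c *: x) = c * us t x.
  by have [K b] := fu t; rewrite (bfuncZ _ _ b).
have Du t x y : us t (x + y) = us t x + us t y.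
  by have [K b] := fu t; rewrite (bfuncD _ _ b).
have sE x y c : \sum_(j <- s) eps j * us j (x + c *: y) =
    \sum_(j <- s) eps j * us j x + c * \sum_(j <- s) eps j * us j y.
  rewrite mulr_sumr -big_split; apply: eq_bigr => j _.
  by rewrite Du Zu mulrDr mulrCA.
move=> i j; rewrite /shear_fun /shear_vec; have [->|ie] := eqVneq i e.
  case: ifP => js.
    rewrite Du Zu sE !(biorth_sumf bu us_s) js (negbTE es_) !bu eqxx.
    have -> : (e == j) = false by apply: contraNF es_ => /eqP ->.
    by rewrite mulr1 mul1r mul0r mulr0 addr0 add0r subrr.
  by rewrite (biorth_sumf bu us_s) js mul0r subr0 bu.
case: ifP => js; last exact: bu.
by rewrite Du Zu !bu (negbTE ie) mulr0 addr0.
Qed.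

Lemma shear_same_system : same_system u us shear_vec shear_fun.
Proof.
have ve : shear_vec e = u e by rewrite /shear_vec (negbTE es_).
split.
- move=> i; have sm := spn_submod shear_vec.
  have se : spn shear_vec (u e) by rewrite -ve; exact: spn_in.
  have := spn_in shear_vec i; rewrite {2}/shear_vec.
  case: ifP => // _ h; rewrite -[u i](addrK (eps i *: u e)).
  by apply: (submodB sm) => //; apply: (submodZ _ sm).
- have sm := spn_submod u.
  move=> i; rewrite /shear_vec; case: ifP => _; last exact: spn_in.
  by apply: (submodD sm); [exact: spn_in|apply: (submodZ _ sm); exact: spn_in].
- move=> x; split=> [h j|h].
    rewrite /shear_fun h; case: eqP => // _; rewrite sub0r big1 ?oppr0 // => i _.
    by rewrite h mulr0.
  have hn i : i != e -> us i x = 0.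
    by move=> ie; have := h i; rewrite /shear_fun (negbTE ie).
  move=> i; have [->|/hn//] := eqVneq i e.
  have := h e; rewrite /shear_fun eqxx big_seq big1 ?subr0 // => j js.
  by rewrite hn ?mulr0 //; apply: contraNneq es_ => <-.
Qed.
End Shear.
End Systems.

(** * Bidemocratic families and conditional rows *)

Section Rows.
Context {R : realType} {k : scalar_kind}.
Local Notation F := (scalar_field R k).
Variable X : normedModType F.

(** The properties of the fundamental function of a basis of a Banach space on
    which the constructions below rely. *)
Definition fundamental_growth (Lam : nat -> R) :=
  [/\ forall m n, Lam (m + n)%N <= Lam m + Lam n,
      {homo Lam : m n / (m <= n)%N >-> m <= n} & 0 < Lam 1%N].

(** On the indices satisfying [P], vectors and functionals behave, up to the
    constant [C], like the unit vectors of a space with an unconditional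
    bidemocratic basis of fundamental function [Lam]. *)
Definition bidemocratic_family (I : eqType) (P : pred I) (u : I -> X)
    (us : I -> X -> F) (Lam : nat -> R) (C : R) :=
  (forall (s : seq I) (c : I -> F), uniq s -> all P s ->
     (forall i, rabs (c i) <= 1) -> rnorm (\sum_(i <- s) c i *: u i) <= Lam (size s)) /\
  (forall (s : seq I) x, uniq s -> all P s ->
     (\sum_(i <- s) rabs (us i x)) * Lam (size s) <= C * (size s)%:R * rnorm x).

Section BidemocraticFamily.
Variables (I : eqType) (P : pred I) (u : I -> X) (us : I -> X -> F).
Variables (Lam : nat -> R) (C : R).
Hypothesis bf : bidemocratic_family P u us Lam C.

Lemma bidemocratic_sum_le (s : seq I) : uniq s -> all P s ->
  rnorm (\sum_(i <- s) u i) <= Lam (size s).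
Proof.
move=> us_s Ps; have := bf.1 s (fun=> 1) us_s Ps.
by under eq_bigr => i _ do rewrite scale1r; apply=> _; rewrite rabs1.
Qed.

Lemma bidemocratic_vec_le i : P i -> rnorm (u i) <= Lam 1%N.
Proof.
move=> Pi; have := @bidemocratic_sum_le [:: i] isT.
by rewrite big_seq1 /= Pi; apply.
Qed.

Lemma bidemocratic_sumf_le (s : seq I) x : 0 <= Lam (size s) -> uniq s -> all P s ->
  rabs (\sum_(i <- s) us i x) * Lam (size s) <= C * (size s)%:R * rnorm x.
Proof.
move=> L0 us_s Ps; apply: le_trans (bf.2 s x us_s Ps).
by apply: ler_wpM2r => //; exact: rabs_sum.
Qed.

Lemma bidemocratic_fun_bound i : 0 < Lam 1%N -> bounded_functionals us -> P i ->
  bfunc (C / Lam 1%N) (us i).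
Proof.
move=> L0 fu Pi; split=> [|x]; first by have [K []] := fu i.
have := bf.2 [:: i] x isT; rewrite big_seq1 /= Pi.
by move=> /(_ isT); rewrite mulr1 mulrAC ler_pdivlMr.
Qed.
End BidemocraticFamily.

(** Coefficients can be carried along an injection, so that bounds for sums over
    sets of indices apply to rearranged sums. *)
Lemma reindex_coeffs (s : seq nat) (c : nat -> F) (g : nat -> nat) :
  {in s &, injective g} -> (forall i, i \in s -> rabs (c i) <= 1) ->
  exists2 c' : nat -> F, forall j, rabs (c' j) <= 1 &
    forall u : nat -> X, \sum_(i <- s) c i *: u (g i) = \sum_(j <- map g s) c' j *: u j.
Proof.
move=> ig hc.
exists (fun j => if j \in map g s then c (nth 0%N s (index j (map g s))) else 0) => [j|u].
  case: ifP => [h|_]; last by rewrite rabs0.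
  by apply: hc; rewrite mem_nth // -(size_map g) index_mem.
rewrite big_map big_seq [RHS]big_seq; apply: eq_bigr => i is_.
by rewrite map_f // nth_index_map.
Qed.

Lemma fundamental_growth_le Lam : fundamental_growth Lam ->
  forall n, (0 < n)%N -> Lam n <= n%:R * Lam 1%N.
Proof.
move=> [sub _ _]; elim=> // -[_ _|n IH _]; first by rewrite mul1r.
rewrite -addn1; apply: le_trans (sub _ _) _.
by rewrite natrD mulrDl mul1r lerD2r IH.
Qed.

Lemma fundamental_growth_gt0 Lam : fundamental_growth Lam ->
  forall n, (0 < n)%N -> 0 < Lam n.
Proof. by move=> [_ mono l1] n n0; apply: lt_le_trans l1 (mono _ _ n0). Qed.

Lemma exchange_vec_out (I : eqType) (u : I -> X) a s (la mu : F) i :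
  i != a -> i \notin s -> exchange_vec u a s la mu i = u i.
Proof. by move=> ia is_; rewrite /exchange_vec (negbTE ia) (negbTE is_). Qed.
Lemma exchange_fun_out (I : eqType) (us : I -> X -> F) a s (la mu : F) i :
  i != a -> i \notin s -> exchange_fun us a s la mu i = us i.
Proof. by move=> ia is_; rewrite /exchange_fun (negbTE ia) (negbTE is_). Qed.


(** The exchanged vector may have a functional of large norm: choosing [la]
    proportional to that norm, and the block long compared with it, keeps the
    new vectors and functionals bounded. *)
Lemma exchange_bounds (I : eqType) (P : pred I) (u : I -> X) (us : I -> X -> F)
    (Lam : nat -> R) (C D' L' la Ka : R) (a : I) (s : seq I) :
  fundamental_growth Lam -> bidemocratic_family P u us Lam C -> 0 <= C ->
  bounded_functionals us ->
  uniq s -> all P s -> (0 < size s)%N -> 0 < la ->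
  la * rnorm (u a) <= (size s)%:R * L' -> bfunc Ka (us a) -> Ka <= la * D' ->
  let v := exchange_vec u a s (sc la) (sc (Lam (size s))) in
  let vs := exchange_fun us a s (sc la) (sc (Lam (size s))) in
  [/\ rnorm (v a) <= 1, bfunc C (vs a) &
  forall i, i != a -> i \in s -> rnorm (v i) <= 2 * Lam 1%N + L' /\
       bfunc (2 * (C / Lam 1%N) + D') (vs i)].
Proof.
move=> fg bf C0 fu us_s Ps s0 la0 hL bK hD v vs.
have N0 : 0 < (size s)%:R :> R by rewrite ltr0n.
have L0 : 0 < Lam (size s) := fundamental_growth_gt0 fg s0.
have L10 : 0 < Lam 1%N by case: fg.
have om_le := bidemocratic_sum_le bf us_s Ps.
have oms_le x := bidemocratic_sumf_le bf x (ltW L0) us_s Ps.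
have u1 i : i \in s -> rnorm (u i) <= Lam 1%N.
  by move=> /(allP Ps); exact: bidemocratic_vec_le bf i.
have us1 i x : i \in s -> rabs (us i x) <= C / Lam 1%N * rnorm x.
  by move=> /(allP Ps) Pi; exact: (bidemocratic_fun_bound bf L10 fu Pi).2.
have fb : bounded_functionals vs by exact: exchange_bounded.
have lin i : forall b x y, vs i (b *: x + y) = b * vs i x + vs i y.
  by have [K []] := fb i.
split.
- rewrite /v /exchange_vec eqxx rnormZ rabsV rabs_sc gtr0_norm // mulrC.
  by rewrite ler_pdivrMr // mul1r.
- split=> [|x]; first exact: lin.
  rewrite /vs /exchange_fun eqxx rabsM -sc_nat -scV -scM rabs_sc gtr0_norm ?divr_gt0 //.
  rewrite mulrAC ler_pdivrMr // mulrC; apply: le_trans (oms_le x) _.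
  by rewrite mulrAC.
move=> i ia is_; rewrite /v /vs /exchange_vec /exchange_fun (negbTE ia) is_; split.
  apply: le_trans (rnormD _ _) _; apply: lerD; last first.
    rewrite rnormZ -sc_nat -scV -scM rabs_sc gtr0_norm ?divr_gt0 //.
    by rewrite mulrAC ler_pdivrMr // [L' * _]mulrC.
  apply: le_trans (rnormB _ _) _.
  rewrite rnormZ -sc_nat -scV rabs_sc gtr0_norm ?invr_gt0 //.
  have : (size s)%:R^-1 * rnorm (\sum_(j <- s) u j) <= Lam 1%N.
    rewrite mulrC ler_pdivrMr // mulrC; apply: le_trans om_le _.
    exact: fundamental_growth_le.
  by have := u1 i is_; lra.
split=> [|x]; first by have := lin i; rewrite /vs /exchange_fun (negbTE ia) is_.
apply: le_trans (rabsD _ _) _; rewrite mulrDl; apply: lerD; last first.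
  rewrite rabsM -scV rabs_sc gtr0_norm ?invr_gt0 //.
  rewrite mulrC ler_pdivrMr //; apply: le_trans (bK.2 x) _.
  by rewrite mulrAC; apply: ler_wpM2r; [exact: rnorm_ge0|rewrite mulrC].
apply: le_trans (rabsD _ _) _; rewrite mulrDl !mul1r.
have h2 : rabs (- ((size s)%:R^-1 * \sum_(j <- s) us j x)) <= C / Lam 1%N * rnorm x.
  rewrite rabsN rabsM -sc_nat -scV rabs_sc gtr0_norm ?invr_gt0 //.
  rewrite mulrC ler_pdivrMr // mulrAC.
  have := oms_le x; rewrite -ler_pdivlMr // => h; apply: le_trans h _.
  have -> : C / Lam 1%N * (size s)%:R * rnorm x = C * (size s)%:R * rnorm x / Lam 1%N.
    by ring.
  apply: ler_wpM2l; first by rewrite !mulr_ge0 ?rnorm_ge0 // ltW.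
  by rewrite lef_pV2 ?posrE //; case: fg => _ mono _; exact: mono.
by have := us1 i x is_; lra.
Qed.

Definition row_bound (L C : R) : R := 4 * L + 3 * (C / L) + C + 2.

(** Conditionality at a single place: an exchange makes the sum of the first [n]
    vectors equal to [u n.+2], and a shear adds [u n.+1] to the vectors of the
    first half and subtracts it from those of the second half. These multiples
    cancel in the whole sum, but the functional of [u n.+1] detects them in the
    sum of a half. The position [n] is free for an arbitrary vector, which comes
    with no bound on its norm or that of its functional. *)
Lemma conditional_row (u : nat -> X) (us : nat -> X -> F) (Lam : nat -> R) (C : R) n :
  fundamental_growth Lam -> 0 <= C -> (0 < n)%N ->
  biorthogonal u us -> bounded_functionals us ->
  bidemocratic_family (fun t => t != n) u us Lam C ->
  let B := row_bound (Lam 1%N) C in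
  exists (y : nat -> X) (ys : nat -> X -> F),
  [/\ biorthogonal y ys, same_system u us y ys,
      forall t, rnorm (y t) <= B /\ bfunc B (ys t),
      rnorm (\sum_(0 <= t < n) y t) <= B
    & (n./2)%:R <= B * rnorm (\sum_(0 <= t < n./2) y t)].
Proof.
move=> fg C0 n0 bu fu bf B.
have L0 : 0 < Lam 1%N by case: fg.
have D0 : 0 <= C / Lam 1%N by rewrite divr_ge0 // ltW.
have [W1 W3] := bf.
have u1 t : t != n -> rnorm (u t) <= Lam 1%N by exact: bidemocratic_vec_le bf t.
have us1 t : t != n -> bfunc (C / Lam 1%N) (us t).
  by move=> tn; exact: (bidemocratic_fun_bound bf L0 fu tn).
have far t : (n.+3 <= t)%N -> [/\ (n <= t)%N, t != n, t != n.+1 & t != n.+2].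
  by move=> h; split; lia.
pose s1 := iota 0 n.
have ms1 t : (t \in s1) = (t < n)%N by rewrite mem_iota add0n.
have u_s1 : uniq s1 by exact: iota_uniq.
have Ps1 : all (fun t => t != n) s1.
  by apply/allP => t; rewrite ms1 => tn; rewrite ltn_eqF.
have s1_0 : (0 < size s1)%N by rewrite size_iota.
have a1 : n.+2 \notin s1 by rewrite ms1; lia.
have scn0 (r : R) : 0 < r -> (sc r : F) != 0 by move=> r0; rewrite sc_eq0 gt_eqF.
(* the sum of the first n vectors becomes the single vector u n.+2 *)
pose v1 := exchange_vec u n.+2 s1 (sc 1) (sc (Lam (size s1))).
pose f1 := exchange_fun us n.+2 s1 (sc 1) (sc (Lam (size s1))).
have Lam0 m : (0 < m)%N -> 0 < Lam m by exact: fundamental_growth_gt0.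
have bv1 : biorthogonal v1 f1.
  by apply: exchange_biorth => //; apply: scn0 => //; exact: Lam0.
have fv1 : bounded_functionals f1 by exact: exchange_bounded.
have sv1 : same_system u us v1 f1.
  by apply: exchange_same_system => //; apply: scn0 => //; exact: Lam0.
have [||||E1a E1b E1c] := @exchange_bounds nat (fun t => t != n) u us Lam C (C / Lam 1%N)
    (Lam 1%N) 1 (C / Lam 1%N) n.+2 s1 fg bf C0 fu u_s1 Ps1 s1_0.
- by [].
- rewrite mul1r; apply: le_trans (u1 _ _) _; first by lia.
  by apply: ler_peMl; [exact: ltW|rewrite ler1n].
- by apply: us1; lia.
- by rewrite mul1r.
rewrite -/v1 -/f1 in E1a E1b E1c.
have v1_out t : (n <= t)%N -> t != n.+2 -> v1 t = u t.
  by move=> nt t2; apply: exchange_vec_out => //; rewrite ms1 -leqNgt.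
have f1_out t : (n <= t)%N -> t != n.+2 -> f1 t = us t.
  by move=> nt t2; apply: exchange_fun_out => //; rewrite ms1 -leqNgt.
have v1_sum : \sum_(0 <= t < n) v1 t = u n.+2.
  by rewrite /index_iota subn0 exchange_block_sum // ?scn0 // sc1 scale1r.
(* multiples of u n.+1 with signs that cancel over the row, but not over its half *)
pose eps t : F := if (t < n./2)%N then 1 else if (t < (n./2).*2)%N then -1 else 0.
pose v2 := shear_vec v1 n.+1 s1 eps.
pose f2 := shear_fun f1 n.+1 s1 eps.
have a2 : n.+1 \notin s1 by rewrite ms1; lia.
have bv2 : biorthogonal v2 f2 by exact: shear_biorth.
have fv2 : bounded_functionals f2 by exact: shear_bounded.
have sv2 : same_system v1 f1 v2 f2 by exact: shear_same_system.
have v2_in t : (t < n)%N -> v2 t = v1 t + eps t *: u n.+1.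
  by move=> tn; rewrite /v2 /shear_vec ms1 tn (v1_out n.+1) //; lia.
have v2_out t : (n <= t)%N -> v2 t = v1 t.
  by move=> tn; rewrite /v2 /shear_vec ms1 ltnNge tn.
have f2_out t : t != n.+1 -> f2 t = f1 t.
  by move=> tn; apply/funext => x; rewrite /f2 /shear_fun (negbTE tn).
have eps_le t : rabs (eps t) <= 1.
  by rewrite /eps; case: ifP => _; [|case: ifP => _]; rewrite ?rabsN ?rabs1 ?rabs0.
have nn : ((n./2).*2 <= n)%N by rewrite -{2}(odd_double_half n) leq_addl.
have sum_eps : \sum_(0 <= t < n) eps t = 0.
  rewrite (big_cat_nat _ nn) //= (@big_cat_nat _ _ _ n./2) //=; last first.
    by rewrite -addnn leq_addr.
  have -> : \sum_(0 <= t < n./2) eps t = \sum_(0 <= t < n./2) 1.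
    by apply: eq_big_nat => i /andP[_ h]; rewrite /eps h.
  have -> : \sum_(n./2 <= t < (n./2).*2) eps t = \sum_(n./2 <= t < (n./2).*2) -1.
    by apply: eq_big_nat => i /andP[h1 h2]; rewrite /eps h2 ltnNge h1.
  have -> : \sum_((n./2).*2 <= t < n) eps t = \sum_((n./2).*2 <= t < n) 0.
    apply: eq_big_nat => i /andP[h1 h2]; rewrite /eps !ltnNge h1 /=.
    by rewrite (leq_trans _ h1) // -addnn leq_addr.
  by rewrite !sumr_const_nat subn0 -addnn addnK mulNrn mul0rn addr0 subrr.
(* only the functional at n.+1, changed by the shear, and the pair at n, where
   nothing is assumed, may exceed the bound: each of them is cured by an
   exchange against a long block to the right of everything used so far *)
have cure (v : nat -> X) (f : nat -> X -> F) (a b : nat) :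
    (a < b)%N -> (n <= a)%N -> biorthogonal v f -> bounded_functionals f ->
    (forall t, (b <= t)%N -> v t = u t /\ f t = us t) ->
    exists M (w : nat -> X) (g : nat -> X -> F), [/\ biorthogonal w g,
      bounded_functionals g, same_system v f w g,
      rnorm (w a) <= B /\ bfunc B (g a) &
      forall t, t != a -> if (b <= t < b + M)%N then rnorm (w t) <= B /\ bfunc B (g t)
         else w t = v t /\ g t = f t].
  move=> ab na bv fv out.
  have [K bK] := fv a.
  have [M hM] : exists M : nat, (`|K| + 1) * rnorm (v a) <= M.+1%:R.
    have := archi_boundP (mulr_ge0 (addr_ge0 (normr_ge0 K) ler01) (rnorm_ge0 (v a))).
    set m := Num.bound _ => hm; exists m; apply: le_trans (ltW hm) _.
    by rewrite ler_nat.
  pose s := iota b M.+1.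
  have ms t : (t \in s) = (b <= t < b + M.+1)%N by rewrite mem_iota.
  have us_ : uniq s by exact: iota_uniq.
  have as_ : a \notin s by rewrite ms leqNgt ab.
  have s_0 : (0 < size s)%N by rewrite size_iota.
  have la0 : 0 < `|K| + 1 by rewrite ltr_wpDl.
  have Pb : all (fun t => (b <= t)%N) s by apply/allP => t; rewrite ms => /andP[].
  have bfb : bidemocratic_family (fun t => (b <= t)%N) v f Lam C.
    have sub r : all (fun t => (b <= t)%N) r -> all (fun t => t != n) r.
      apply: sub_all => t bt; apply: contraTneq bt => ->.
      by rewrite -ltnNge; exact: leq_ltn_trans na ab.
    split=> [r c ur Pr c1|r x ur Pr].
      rewrite big_seq (eq_bigr (fun i => c i *: u i)) => [|i /(allP Pr)/out[-> _]] //.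
      by rewrite -big_seq; apply: W1 => //; exact: sub.
    rewrite big_seq (eq_bigr (fun i => rabs (us i x))) => [|i /(allP Pr)/out[_ ->]] //.
    by rewrite -big_seq; apply: W3 => //; exact: sub.
  have [||||Ea Eb Ec] := @exchange_bounds nat _ v f Lam C 1
    1 (`|K| + 1) K a s fg bfb C0 fv us_ Pb s_0.
  - by [].
  - by rewrite mulr1 size_iota.
  - by [].
  - by rewrite mulr1; apply: le_trans (ler_norm _) _; rewrite lerDl.
  exists M.+1, (exchange_vec v a s (sc (`|K| + 1)) (sc (Lam (size s)))),
    (exchange_fun f a s (sc (`|K| + 1)) (sc (Lam (size s)))); split.
  - by apply: exchange_biorth => //; apply: scn0 => //; exact: Lam0.
  - exact: exchange_bounded.
  - by apply: exchange_same_system => //; apply: scn0 => //; exact: Lam0.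
  - split; first by apply: le_trans Ea _; rewrite /B /row_bound; lra.
    by apply: bfunc_le Eb _; rewrite /B /row_bound; lra.
  move=> t ta; rewrite -ms; case: ifP => ts.
    have [h1 h2] := Ec t ta ts; split.
      by apply: le_trans h1 _; rewrite /B /row_bound; lra.
    by apply: bfunc_le h2 _; rewrite /B /row_bound; lra.
  by split; [exact: exchange_vec_out ta (negbT ts)|exact: exchange_fun_out ta (negbT ts)].
have out2 t : (n.+3 <= t)%N -> v2 t = u t /\ f2 t = us t.
  move=> t3; rewrite v2_out; last by have [] := far t t3.
  by have [nt _ t1 t2] := far t t3; rewrite f2_out // v1_out // f1_out.
have [M3 [v3 [f3 [bv3 fv3 sv3 B3 out3]]]] := cure v2 f2 n n.+3
  (leqW (leqW (leqnn n.+1))) (leqnn n) bv2 fv2 out2.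
have out3' t : (n.+3 + M3 <= t)%N -> v3 t = u t /\ f3 t = us t.
  move=> t3; have [h1 h2] := out2 t (leq_trans (leq_addr _ _) t3).
  have := out3 t; rewrite [(t < _)%N]ltnNge t3 andbF -h1 -h2; apply.
  rewrite gtn_eqF //; apply: leq_trans t3; rewrite !addSn ltnS.
  exact/leqW/leqW/leq_addr.
have [M4 [v4 [f4 [bv4 fv4 sv4 B4 out4]]]] := cure v3 f3 n.+1 (n.+3 + M3)%N
  ltac:(by rewrite addSn ltnS leqW // leq_addr) (leqnSn n) bv3 fv3 out3'.
have low t : (t < n)%N -> v4 t = v1 t + eps t *: u n.+1.
  move=> tn; rewrite -v2_in //.
  have := out3 t; have := out4 t.
  have tn3 : (t < n.+3)%N by rewrite ltnW // ltnW // ltnS ltnW.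
  have -> : (n.+3 + M3 <= t)%N = false by apply/negbTE; rewrite -ltnNge ltn_addr.
  have -> : (n.+3 <= t)%N = false by apply/negbTE; rewrite -ltnNge.
  move=> /= h4 h3; have [-> _] := h4 ltac:(by rewrite ltn_eqF // ltnS ltnW).
  by have [-> _] := h3 ltac:(by rewrite ltn_eqF).
exists v4, f4; split => //.
- apply: same_system_trans sv1 _; apply: same_system_trans sv2 _.
  exact: same_system_trans sv3 sv4.
- move=> t; have [->//|t1] := eqVneq t n.+1.
  have := out4 t t1; case: ifP => // _ [-> ->].
  have [->//|tn] := eqVneq t n.
  have := out3 t tn; case: ifP => // _ [-> ->].
  rewrite f2_out //; case: (ltnP t n) => ltn_t.
    have [h1 h2] := E1c t ltac:(by rewrite ltn_eqF // ltnS ltnW // ltnS ltnW)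
      ltac:(by rewrite ms1).
    split; last by apply: bfunc_le h2 _; rewrite /B /row_bound; lra.
    rewrite v2_in //; apply: le_trans (rnormD _ _) _; rewrite rnormZ.
    have : rabs (eps t) * rnorm (u n.+1) <= 1 * Lam 1%N.
      by apply: ler_pM; rewrite ?rabs_ge0 ?rnorm_ge0 // u1 // gtn_eqF.
    by move: h1; rewrite /B /row_bound; lra.
  rewrite v2_out //; have [->|t2] := eqVneq t n.+2.
    split; first by apply: le_trans E1a _; rewrite /B /row_bound; lra.
    by apply: bfunc_le E1b _; rewrite /B /row_bound; lra.
  rewrite v1_out // f1_out //; split.
    by apply: le_trans (u1 _ tn) _; rewrite /B /row_bound; lra.
  by apply: bfunc_le (us1 _ tn) _; rewrite /B /row_bound; lra.
- rewrite (eq_big_nat _ _ (F2 := fun t => v1 t + eps t *: u n.+1)); last first.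
    by move=> t /andP[_]; exact: low.
  rewrite big_split /= -scaler_suml sum_eps scale0r addr0 v1_sum.
  apply: le_trans (u1 _ _) _; first by rewrite gtn_eqF.
  by rewrite /B /row_bound; lra.
have e1 : v1 n.+1 = u n.+1 by apply: v1_out => //; rewrite ltn_eqF.
have g1 : f1 n.+1 = us n.+1 by apply: f1_out => //; rewrite ltn_eqF.
have p_le_n : (n./2 <= n)%N by apply: leq_trans nn; rewrite -addnn leq_addr.
have [K bK] := fu n.+1.
have val : us n.+1 (\sum_(0 <= t < n./2) v4 t) = (n./2)%:R.
  rewrite (bfunc_sum _ _ _ bK).
  have -> : \sum_(0 <= t < n./2) us n.+1 (v4 t) = \sum_(0 <= t < n./2) 1.
    apply: eq_big_nat => t /andP[_ tp].
    rewrite low; last exact: leq_trans tp p_le_n.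
    rewrite /eps tp scale1r (bfuncD _ _ bK) -e1 -g1 !bv1 eqxx.
    by rewrite gtn_eqF ?add0r // ltnS ltnW // (leq_trans tp).
  by rewrite sumr_const_nat subn0.
rewrite -(@rabs_nat R k) -val.
apply: le_trans ((us1 n.+1 _).2 _) _; first by rewrite gtn_eqF.
by apply: ler_wpM2r; [exact: rnorm_ge0|rewrite /B /row_bound; lra].
Qed.

End Rows.

(** * Blocks in geometric progression *)

Lemma ler_sum_uniq_sub (R : numDomainType) (I : eqType) (s1 s2 : seq I) (f : I -> R) :
  uniq s1 -> uniq s2 -> {subset s1 <= s2} -> (forall i, 0 <= f i) ->
  \sum_(i <- s1) f i <= \sum_(i <- s2) f i.
Proof.
move=> u1 u2 s12 f0.
have -> : \sum_(i <- s1) f i = \sum_(i <- s2 | i \in s1) f i.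
  rewrite -[RHS]big_filter; apply: perm_big; apply: uniq_perm => //.
    exact: filter_uniq.
  by move=> i; rewrite mem_filter; case: (boolP (i \in s1)) => // /s12 ->.
by rewrite [leRHS](bigID (mem s1)) /= lerDl sumr_ge0.
Qed.

(** The [n]-th block consists of the [j] with [r ^ n <= j.+1 < r ^ n.+1]; the
    shift by one lets the first block start at [0]. *)
Section Blocks.
Variable r : nat.
Hypothesis r1 : (1 < r)%N.

Definition block_length n := (r.-1 * r ^ n)%N.
Definition block n := iota (r ^ n).-1 (block_length n).
Definition block_of j := trunc_log r j.+1.

Let rn0 n : (0 < r ^ n)%N. Proof. by rewrite expn_gt0 ltnW. Qed.

Lemma block_end n : ((r ^ n).-1 + block_length n = (r ^ n.+1).-1)%N.
Proof.
rewrite /block_length expnS; move: (rn0 n); case: (r ^ n)%N => // p _.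
by case: r r1 => // q _; rewrite /= mulSn.
Qed.

Lemma block_length_gt0 n : (0 < block_length n)%N.
Proof. by rewrite muln_gt0 rn0 andbT -subn1 subn_gt0. Qed.

Lemma block_lengthS n : block_length n.+1 = (r * block_length n)%N.
Proof. by rewrite /block_length expnS mulnCA. Qed.

Lemma block_length_homo : {homo block_length : m n / (m <= n)%N >-> (m <= n)%N}.
Proof. by move=> m n mn; rewrite leq_mul2l leq_pexp2l ?orbT // ltnW. Qed.

Lemma mem_block n j : (j \in block n) = (block_of j == n).
Proof.
rewrite mem_iota block_end /block_of; apply/andP/eqP => [[h1 h2]|<-].
  apply: trunc_log_eq => //; rewrite -ltnS prednK // in h1; rewrite h1 /=.
  by rewrite -(prednK (rn0 n.+1)) ltnS.
have /andP[h1 h2] := trunc_log_bounds r1 (ltn0Sn j).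
by rewrite -ltnS prednK // h1 -ltnS prednK.
Qed.

Lemma block_uniq n : uniq (block n). Proof. exact: iota_uniq. Qed.
Lemma size_block n : size (block n) = block_length n. Proof. exact: size_iota. Qed.

Lemma block_length_ge j : (j < 2 * block_length (block_of j))%N.
Proof.
have /andP[_ h2] := trunc_log_bounds r1 (ltn0Sn j).
apply: leq_trans (ltnW h2) _; rewrite /block_length expnS mulnA leq_mul2r.
by apply/orP; right; rewrite -{1}(prednK (ltnW r1)); case: r r1 => // -[|m] //= _; lia.
Qed.

Lemma block_length_gt n : (n < block_length n)%N.
Proof.
apply: leq_trans (_ : r ^ n <= _)%N; first exact: ltn_expl.
by rewrite leq_pmull // -subn1 subn_gt0.
Qed.

(** An index in a block of length at least [size s] carries a weight of order at
    most [g (size s) / size s]; the shorter blocks, even if they are contained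
    in [s], contribute a sum that grows geometrically and is dominated by its
    last term. *)
Lemma block_weights (R : realType) (g : nat -> R) :
  (forall n, (0 < n)%N -> 0 <= g n) ->
  (forall m n, (0 < m <= n)%N -> g m <= 2 * g n) ->
  (forall m n, (0 < m <= n)%N -> g n / n%:R <= 2 * (g m / m%:R)) ->
  (forall n, (0 < n)%N -> 2 * g n <= g (r * n)%N) ->
  forall s : seq nat, uniq s -> (0 < size s)%N ->
  \sum_(j <- s) g (block_length (block_of j)) / (block_length (block_of j))%:R
    <= 6 * g (size s).
Proof.
move=> g0 gmono gquasi ggrow s us s0.
pose h n := g (block_length n) / (block_length n)%:R.
have N0 n : 0 < (block_length n)%:R :> R by rewrite ltr0n block_length_gt0.
have h0 n : 0 <= h n.
  by apply: divr_ge0; [apply: g0; exact: block_length_gt0|exact: ltW].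
have gN n : 2 * g (block_length n) <= g (block_length n.+1).
  by rewrite block_lengthS ggrow // block_length_gt0.
have heads n : \sum_(0 <= j < (r ^ n.+1).-1) h (block_of j) <= 2 * g (block_length n).
  have last m : \sum_((r ^ m).-1 <= j < (r ^ m.+1).-1) h (block_of j) = g (block_length m).
    rewrite -block_end /index_iota addKn -/(block m).
    rewrite big_seq (eq_bigr (fun=> h m)); last by move=> j; rewrite mem_block => /eqP ->.
    rewrite -big_seq sumr_const_seq size_block -[LHS]mulr_natr /h divfK //; exact: lt0r_neq0.
  elim: n => [|n IH].
    by have := last 0%N; rewrite expn0 => ->; have := g0 _ (block_length_gt0 0); lra.
  rewrite (@big_cat_nat _ _ _ (r ^ n.+1).-1) //=; last first.
    by rewrite -(block_end n.+1) leq_addr.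
  by rewrite last; have := gN n; lra.
rewrite (bigID (fun j => (size s <= block_length (block_of j))%N)) /=.
have part1 : \sum_(j <- s | (size s <= block_length (block_of j))%N)
    h (block_of j) <= 2 * g (size s).
  apply: le_trans (_ : \sum_(j <- s) 2 * (g (size s) / (size s)%:R) <= _); last first.
    rewrite sumr_const_seq -[leLHS]mulr_natr -!mulrA mulVf ?mulr1 //.
    by rewrite pnatr_eq0 -lt0n.
  rewrite big_mkcond; apply: ler_sum => j _; case: ifP => hj.
    by apply: gquasi; rewrite s0.
  by rewrite mulr_ge0 // divr_ge0 // g0.
have part2 : \sum_(j <- s | ~~ (size s <= block_length (block_of j))%N)
    h (block_of j) <= 4 * g (size s).
  rewrite -big_filter.
  have exQ : exists Q, (size s <= block_length Q)%N.
    by exists (size s); exact: ltnW (block_length_gt _).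
  have [Q hQ minQ] := ex_minnP exQ.
  have sub j : j \in [seq j <- s | ~~ (size s <= block_length (block_of j))%N] ->
      (block_of j < Q)%N.
    rewrite mem_filter => /andP[nj _]; rewrite ltnNge; apply: contra nj => Qj.
    by apply: leq_trans hQ _; exact: block_length_homo.
  case: Q hQ minQ sub => [|Q] hQ minQ sub.
    rewrite big_seq big1 => [|j /sub//]; have := g0 _ s0; lra.
  have QS : (block_length Q < size s)%N.
    by rewrite ltnNge; apply/negP => /minQ; rewrite ltnn.
  apply: le_trans (_ : 2 * g (block_length Q) <= _); last first.
    have := gmono (block_length Q) (size s); rewrite block_length_gt0 ltnW //.
    by move=> /(_ isT); lra.
  apply: le_trans (heads Q); apply: ler_sum_uniq_sub => //.
  - exact: filter_uniq.
  - exact: iota_uniq.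
  move=> j /sub jQ; rewrite mem_index_iota /=.
  have /andP[_ h2] := trunc_log_bounds r1 (ltn0Sn j).
  rewrite -ltnS prednK //; apply: leq_trans h2 _.
  by rewrite leq_pexp2l // ltnW.
by have := g0 _ s0; rewrite /h in part1 part2; lra.
Qed.
End Blocks.

(** * The Dilworth--Kalton--Kutzarova construction *)

Lemma ratio_swap (R : realFieldType) (a b p q : R) :
  0 < a -> 0 < b -> 0 < p -> 0 < q -> b / q <= 2 * (a / p) -> p / a <= 2 * (q / b).
Proof.
move=> a0 b0 p0 q0; rewrite ler_pdivrMr // => h; rewrite ler_pdivrMr //.
have := ler_wpM2r (ltW p0) h.
have -> : 2 * (a / p) * q * p = 2 * a * q by field; rewrite gt_eqF.
move=> h'; rewrite -(ler_pM2r b0).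
have -> : 2 * (q / b) * a * b = 2 * q * a by field; rewrite gt_eqF.
lra.
Qed.

Section GrowthRatio.
Variables (R : realType) (Lam : nat -> R).
Hypothesis fg : fundamental_growth Lam.

Lemma fundamental_growthM q m : Lam (q.+1 * m)%N <= q.+1%:R * Lam m.
Proof.
have [sub _ _] := fg; elim: q => [|q IH]; first by rewrite !mul1n mul1r.
rewrite mulSn; apply: le_trans (sub _ _) _.
by rewrite -[in leRHS]natr1 mulrDl mul1r [leRHS]addrC lerD2l.
Qed.

Lemma fundamental_growth_quasi m n : (0 < m <= n)%N ->
  Lam n / n%:R <= 2 * (Lam m / m%:R).
Proof.
move=> /andP[m0 mn]; have [_ mono _] := fg.
have n0 : (0 < n)%N by exact: leq_trans mn.
have mR : 0 < m%:R :> R by rewrite ltr0n.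
have nR : 0 < n%:R :> R by rewrite ltr0n.
have Lm : 0 < Lam m := fundamental_growth_gt0 fg m0.
rewrite ler_pdivrMr // -mulrA mulrAC mulrA ler_pdivlMr //.
have h1 : Lam n <= (n %/ m).+1%:R * Lam m.
  apply: le_trans (fundamental_growthM _ _); apply: mono.
  by rewrite ltnW // ltn_ceil.
have h2 : (n %/ m).+1%:R * m%:R <= 2 * n%:R :> R.
  rewrite -!natrM ler_nat mulSn mul2n -addnn leq_add //.
  exact: leq_divM.
apply: le_trans (ler_wpM2r (ltW mR) h1) _.
rewrite mulrAC; apply: le_trans (ler_wpM2r (ltW Lm) h2) _.
by rewrite -!mulrA [Lam m * _]mulrC.
Qed.
End GrowthRatio.

(** The Dilworth--Kalton--Kutzarova construction: in each block of the vectors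
    [w j] the mean is replaced by a multiple of a vector [x n] of an arbitrary
    bounded system. Over an arbitrary set of indices the replaced terms do not
    exceed the fundamental function, by the triangle inequality alone, while the
    sums over entire blocks reproduce the system [x]. *)
Section DKK.
Context {R : realType} {k : scalar_kind}.
Local Notation F := (scalar_field R k).
Variable X : normedModType F.
Variables (r : nat) (Lam : nat -> R) (C B : R).
Variables (w : nat -> X) (ws : nat -> X -> F) (x : nat -> X) (xs : nat -> X -> F).
Local Notation nb := (block_of r).
Local Notation N n := (block_length r n).
Local Notation om n := (\sum_(j <- block r n) w j).
Local Notation oms n f := (\sum_(j <- block r n) ws j f).
Local Notation L n := (Lam (block_length r n)).

Hypothesis r1 : (1 < r)%N.
Hypothesis fg : fundamental_growth Lam.
Hypotheses (C0 : 0 <= C) (B0 : 0 <= B).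
Hypotheses (bw : biorthogonal w ws) (fw : bounded_functionals ws).
Hypothesis dw : bidemocratic_family predT w ws Lam C.
Hypothesis bx : biorthogonal x xs.
Hypothesis x_bound : forall n, rnorm (x n) <= B.
Hypothesis xs_bound : forall n, bfunc B (xs n).
Hypothesis xs_w : forall m j, xs m (w j) = (N (nb j))%:R^-1 * xs m (om (nb j)).
Hypothesis ws_x : forall m j, ws j (x m) = (N (nb j))%:R^-1 * oms (nb j) (x m).
Hypothesis om_x : forall n, spn x (om n).
Hypothesis oms_xs : forall f, (forall m, xs m f = 0) -> forall n, oms n f = 0.
Hypothesis wx_dense : forall E : set X, submod E -> (forall j, E (w j)) ->
  (forall n, E (x n)) -> forall f, closure E f.
Hypothesis wx_total : forall f, (forall j, ws j f = 0) -> (forall n, xs n f = 0) -> f = 0.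

Definition dkk_vec j : X :=
  w j - (N (nb j))%:R^-1 *: om (nb j) + sc (L (nb j) / (N (nb j))%:R) *: x (nb j).
Definition dkk_fun j (f : X) : F :=
  ws j f - (N (nb j))%:R^-1 * oms (nb j) f + sc (L (nb j))^-1 * xs (nb j) f.

Let Lpos n : 0 < L n.
Proof. by apply: fundamental_growth_gt0 => //; exact: block_length_gt0. Qed.
Let Npos n : 0 < (N n)%:R :> R.
Proof. by rewrite ltr0n block_length_gt0. Qed.
Let NF0 n : (N n)%:R != 0 :> F.
Proof. by rewrite pnatr_eq0 -lt0n block_length_gt0. Qed.
Let LF0 n : sc (L n) != 0 :> F.
Proof. by rewrite sc_eq0 gt_eqF. Qed.
Let allT (s : seq nat) : all predT s. Proof. exact: all_predT. Qed.

Let ws1 j : bfunc (C / Lam 1%N) (ws j).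
Proof. by apply: (bidemocratic_fun_bound dw _ fw) => //; case: fg. Qed.

Let om_norm n : rnorm (om n) <= L n.
Proof.
rewrite -[in leRHS](size_block r n).
by have := bidemocratic_sum_le dw (block_uniq r n) (allT (block r n)).
Qed.

Let oms_norm n f : rabs ((N n)%:R^-1 * oms n f) <= C / L n * rnorm f.
Proof.
rewrite rabsM rabsV rabs_nat mulrC ler_pdivrMr //.
have := bidemocratic_sumf_le (s := block r n) dw f; rewrite size_block.
move=> /(_ (ltW (Lpos n)) (block_uniq _ _) (allT _)).
rewrite -ler_pdivlMr // => h; apply: le_trans h _.
by rewrite le_eqVlt; apply/orP; left; apply/eqP; ring.
Qed.

Let xsZ n c f : xs n (c *: f) = c * xs n f.
Proof. by rewrite (bfuncZ _ _ (xs_bound n)). Qed.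
Let xsD n f g : xs n (f + g) = xs n f + xs n g.
Proof. by rewrite (bfuncD _ _ (xs_bound n)). Qed.
Let wsZ n c f : ws n (c *: f) = c * ws n f.
Proof. by rewrite (bfuncZ _ _ (ws1 n)). Qed.
Let wsD n f g : ws n (f + g) = ws n f + ws n g.
Proof. by rewrite (bfuncD _ _ (ws1 n)). Qed.

Let deviation i f : F := ws i f - (N (nb i))%:R^-1 * oms (nb i) f.

Let devD i f g : deviation i (f + g) = deviation i f + deviation i g.
Proof.
rewrite /deviation wsD; under eq_bigr => j _ do rewrite wsD.
by rewrite big_split /= mulrDr opprD addrACA.
Qed.
Let devZ i c f : deviation i (c *: f) = c * deviation i f.
Proof.
rewrite /deviation wsZ; under eq_bigr => j _ do rewrite wsZ.
by rewrite -mulr_sumr mulrBr mulrCA.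
Qed.
Let devN i f : deviation i (- f) = - deviation i f.
Proof. by rewrite -scaleN1r devZ mulN1r. Qed.

Let dev_w i j : deviation i (w j) = (i == j)%:R - (N (nb i))%:R^-1 * (nb j == nb i)%:R.
Proof.
by rewrite /deviation bw (biorth_sumf1 bw (block_uniq _ _)) mem_block.
Qed.

Let dev_om i m : deviation i (om m) = 0.
Proof.
rewrite (big_morph (deviation i) (devD i) (_ : deviation i 0 = 0)); last first.
  by rewrite -(scale0r (0 : X)) devZ mul0r.
under eq_bigr => j _ do rewrite dev_w.
have eB : \sum_(j <- block r m) (i == j)%:R = (nb i == m)%:R :> F.
  rewrite -(mem_block r1) -(biorth_sum bw fw (block_uniq _ _)).
  by rewrite (bfunc_sum _ _ _ (ws1 i)); apply: eq_bigr => j _; rewrite bw.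
rewrite big_split /= eB sumrN.
rewrite [X in _ - X](_ : _ = (nb i == m)%:R) ?subrr //.
rewrite big_seq (eq_bigr (fun=> (N (nb i))%:R^-1 * (m == nb i)%:R)); last first.
  by move=> j; rewrite mem_block // => /eqP ->.
rewrite -big_seq sumr_const_seq size_block -[LHS]mulr_natl mulrA eq_sym.
by case: eqP => [<-|_]; rewrite ?mulr0 // mulfV // mulr1.
Qed.

Let dev_x i m : deviation i (x m) = 0.
Proof. by rewrite /deviation ws_x subrr. Qed.

Let xs_dev m j : xs m (w j - (N (nb j))%:R^-1 *: om (nb j)) = 0.
Proof.
by rewrite xsD -scaleNr xsZ mulNr xs_w subrr.
Qed.

Lemma dkk_fun_x i m : dkk_fun i (x m) = (nb i == m)%:R * sc (L m)^-1.
Proof.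
rewrite /dkk_fun -/(deviation i (x m)) dev_x add0r bx.
by case: eqP => [->|_]; rewrite ?mulr1 ?mul1r ?mulr0 ?mul0r.
Qed.

Lemma dkk_biorth : biorthogonal dkk_vec dkk_fun.
Proof.
move=> i j; rewrite /dkk_fun -/(deviation i (dkk_vec j)) /dkk_vec.
rewrite devD devZ dev_x mulr0 addr0 devD devN devZ dev_om mulr0 oppr0 addr0.
rewrite dev_w xsD xs_dev add0r xsZ bx (eq_sym (nb j)).
case: (nb i =P nb j) => [ij|_]; last by rewrite !mulr0 subr0 addr0.
rewrite ij !mulr1 -scM mulrA mulVf; last exact: lt0r_neq0.
by rewrite mul1r scV sc_nat subrK.
Qed.

Lemma dkk_block_sum n : \sum_(j <- block r n) dkk_vec j = sc (L n) *: x n.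
Proof.
rewrite big_seq (eq_bigr (fun j => w j - (N n)%:R^-1 *: om n + sc (L n / (N n)%:R) *: x n));
  last by move=> j; rewrite mem_block // => /eqP <-.
have mulrnE (f : X) : f *+ size (block r n) = (N n)%:R *: f.
  by rewrite size_block scaler_nat.
rewrite -big_seq !big_split /= sumrN !sumr_const_seq !mulrnE !scalerA divff //.
by rewrite scale1r subrr add0r scM scV sc_nat mulrCA divff ?mulr1.
Qed.

Lemma dkk_dense f : closure (spn dkk_vec) f.
Proof.
have sm := spn_submod dkk_vec.
have sx n : spn dkk_vec (x n).
  have -> : x n = (sc (L n))^-1 *: \sum_(j <- block r n) dkk_vec j.
    by rewrite dkk_block_sum scalerA mulVf // scale1r.
  by apply: (submodZ _ sm); apply: (submod_sum sm) => j _; exact: spn_in.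
apply: (wx_dense sm) => // j.
have so : spn dkk_vec (om (nb j)) by exact: spn_trans (om_x _) sx.
have -> : w j = dkk_vec j - sc (L (nb j) / (N (nb j))%:R) *: x (nb j)
    + (N (nb j))%:R^-1 *: om (nb j).
  by rewrite /dkk_vec addrK subrK.
apply: (submodD sm); last by apply: (submodZ _ sm).
by apply: (submodB sm); [exact: spn_in|apply: (submodZ _ sm)].
Qed.

Lemma dkk_total f : (forall j, dkk_fun j f = 0) -> f = 0.
Proof.
move=> h.
have xs0 n : xs n f = 0.
  have : \sum_(j <- block r n) dkk_fun j f = 0 by rewrite big1.
  rewrite big_seq (eq_bigr (fun j => ws j f - (N n)%:R^-1 * oms n f + sc (L n)^-1 * xs n f));
    last by move=> j; rewrite mem_block // => /eqP <-.
  have mulrnE (c : F) : c *+ size (block r n) = (N n)%:R * c.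
    by rewrite size_block mulr_natl.
  rewrite -big_seq !big_split /= sumrN !sumr_const_seq !mulrnE !mulrA divff //.
  rewrite mul1r subrr add0r => /eqP; rewrite !mulf_eq0 scV invr_eq0.
  by rewrite (negbTE (NF0 n)) (negbTE (LF0 n)) => /eqP.
apply: wx_total => // j; have := h j.
by rewrite /dkk_fun xs0 (oms_xs xs0) !mulr0 subr0 addr0.
Qed.

Lemma dkk_fun_le j f : rabs (dkk_fun j f) <= rabs (ws j f) + (C + B) / L (nb j) * rnorm f.
Proof.
apply: le_trans (rabsD _ _) _; rewrite mulrDl mulrDl addrA; apply: lerD; last first.
  rewrite rabsM rabs_sc gtr0_norm ?invr_gt0 // [B / _]mulrC -mulrA.
  by apply: ler_wpM2l; [rewrite invr_ge0 ltW|exact: (xs_bound _).2].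
apply: le_trans (rabsD _ _) _; rewrite rabsN lerD2l; exact: oms_norm.
Qed.

Lemma dkk_fun_bfunc j : exists K, bfunc K (dkk_fun j).
Proof.
exists (C / Lam 1%N + (C + B) / L (nb j)); split=> [a f g|f].
  have dkkE h : dkk_fun j h = deviation j h + sc (L (nb j))^-1 * xs (nb j) h by [].
  rewrite !dkkE devD devZ xsD xsZ [_ * (_ + xs _ g)]mulrDr addrACA.
  by rewrite [sc _ * (a * _)]mulrCA -mulrDr.
apply: le_trans (dkk_fun_le _ _) _; rewrite [leRHS]mulrDl lerD2r; exact: (ws1 j).2.
Qed.

Hypothesis lower_regular : forall m, (0 < m)%N -> 2 * Lam m <= Lam (r * m)%N.

Let lower_regular_sum (s : seq nat) : uniq s -> (0 < size s)%N ->
  \sum_(j <- s) L (nb j) / (N (nb j))%:R <= 6 * Lam (size s).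
Proof.
move=> us s0; have Lp n : (0 < n)%N -> 0 < Lam n by exact: fundamental_growth_gt0.
have [_ mono _] := fg.
apply: block_weights => //.
- by move=> n /Lp/ltW.
- move=> m n /andP[m0 mn]; have := mono _ _ mn; have := Lp m m0; lra.
- by move=> m n; exact: fundamental_growth_quasi.
Qed.

(** The terms in [w j] are controlled by the democracy of [w]; all others are of norm at most [L n / N n] up to a constant, which are the weights
    that [block_weights] controls. *)
Lemma dkk_upper (s : seq nat) (c : nat -> F) : uniq s -> (0 < size s)%N ->
  (forall i, rabs (c i) <= 1) ->
  rnorm (\sum_(j <- s) c j *: dkk_vec j) <= (7 + 6 * B) * Lam (size s).
Proof.
move=> us s0 hc.
have h1 : rnorm (\sum_(j <- s) c j *: w j) <= Lam (size s) by apply: dw.1.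
have h2 := lower_regular_sum us s0.
have -> : \sum_(j <- s) c j *: dkk_vec j = \sum_(j <- s) c j *: w j +
   \sum_(j <- s) c j *: (sc (L (nb j) / (N (nb j))%:R) *: x (nb j)
      - (N (nb j))%:R^-1 *: om (nb j)).
  rewrite -big_split /=; apply: eq_bigr => j _; rewrite -scalerDr; congr (_ *: _).
  by rewrite /dkk_vec addrA addrAC.
apply: le_trans (rnormD _ _) _.
have : rnorm (\sum_(j <- s) c j *: (sc (L (nb j) / (N (nb j))%:R) *: x (nb j)
      - (N (nb j))%:R^-1 *: om (nb j))) <= (B + 1) * \sum_(j <- s) L (nb j) / (N (nb j))%:R.
  apply: le_trans (rnorm_sum _ _ _) _; rewrite mulr_sumr; apply: ler_sum => j _.
  rewrite rnormZ; apply: le_trans (ler_piMl (rnorm_ge0 _) (hc j)) _.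
  apply: le_trans (rnormB _ _) _; rewrite mulrDl mul1r !rnormZ; apply: lerD.
    rewrite rabs_sc gtr0_norm ?divr_gt0 // mulrC.
    by apply: ler_wpM2r; [rewrite divr_ge0 ?ltW|exact: x_bound].
  by rewrite rabsV rabs_nat mulrC ler_pM2r ?invr_gt0 //; exact: om_norm.
have : (B + 1) * (\sum_(j <- s) L (nb j) / (N (nb j))%:R) <= (B + 1) * (6 * Lam (size s)).
  by apply: ler_wpM2l => //; exact: addr_ge0.
lra.
Qed.

(** At least half of the indices in [s] exceed half the size of [s], hence lie in
    blocks of length comparable to [size s], and there the correction to the
    coordinates of [w] is of order [1 / Lam (size s)]. *)
Lemma dkk_lower (s : seq nat) (f : X) (t : R) : uniq s -> (0 < size s)%N -> 0 <= t ->
  (forall j, j \in s -> t <= rabs (dkk_fun j f)) ->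
  t * Lam (size s) <= (6 * C + 4 * B) * rnorm f.
Proof.
move=> us s0 t0 ht; set m := size s.
have Lm : 0 < Lam m by exact: fundamental_growth_gt0.
pose s' := [seq j <- s | (m./2 <= j)%N].
have us' : uniq s' by exact: filter_uniq.
have size' : (m <= (size s').*2)%N.
  have e : (size s' + size [seq j <- s | ~~ (m./2 <= j)%N])%N = m.
    by rewrite !size_filter count_predC.
  have h : (size [seq j <- s | ~~ (m./2 <= j)%N] <= m./2)%N.
    rewrite -[leqRHS](size_iota 0); apply: uniq_leq_size; first exact: filter_uniq.
    by move=> j; rewrite mem_filter mem_iota -ltnNge => /andP[].
  have := odd_double_half m; have := leq_b1 (odd m).
  rewrite -!muln2; move: e h; move: (size s') (size _) (m./2) (nat_of_bool _).
  by move=> a b c d; lia.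
have s'0 : (0 < size s')%N.
  by rewrite -double_gt0; exact: leq_trans s0 size'.
have [_ mono _] := fg.
have Lm' : Lam m <= 2 * Lam (size s').
  apply: le_trans (mono _ _ size') _; rewrite -mul2n.
  exact: fundamental_growthM.
have far j : j \in s' -> Lam m <= 4 * L (nb j).
  rewrite mem_filter => /andP[mj _].
  apply: le_trans (_ : Lam (4 * N (nb j))%N <= _); last exact: fundamental_growthM.
  apply: mono; have := block_length_ge r1 j => h.
  have := odd_double_half m; have := leq_b1 (odd m).
  rewrite -!muln2; move: mj h; move: (m./2) (nat_of_bool _) (N (nb j)).
  by move=> c d e; lia.
have Ls' : 0 < Lam (size s') by exact: fundamental_growth_gt0.
have n' : 0 < (size s')%:R :> R by rewrite ltr0n.
have nf := rnorm_ge0 f.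
have each j : j \in s' -> t <= rabs (ws j f) + (C + B) * (4 / Lam m) * rnorm f.
  move=> js; have js1 : j \in s by move: js; rewrite mem_filter => /andP[].
  apply: le_trans (ht j js1) _; apply: le_trans (dkk_fun_le _ _) _; rewrite lerD2l.
  apply: ler_wpM2r => //; apply: ler_wpM2l; first exact: addr_ge0.
  by rewrite ler_pdivlMr // mulrC ler_pdivrMr //; exact: far.
have sum' : t * (size s')%:R <= C * (size s')%:R * rnorm f / Lam (size s')
    + (C + B) * (4 / Lam m) * rnorm f * (size s')%:R.
  have -> : t * (size s')%:R = \sum_(j <- s') t by rewrite sumr_const_seq mulr_natr.
  apply: le_trans (_ : \sum_(j <- s') (rabs (ws j f) + (C + B) * (4 / Lam m) * rnorm f) <= _).
    by rewrite big_seq [leRHS]big_seq; apply: ler_sum => j; exact: each.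
  rewrite big_split /= sumr_const_seq -[X in _ + X <= _]mulr_natr lerD2r.
  by rewrite ler_pdivlMr //; exact: dw.2.
have tle : t <= C * rnorm f / Lam (size s') + (C + B) * (4 / Lam m) * rnorm f.
  rewrite -(ler_pM2r n') mulrDl; apply: le_trans sum' _.
  by rewrite lerD2r le_eqVlt; apply/orP; left; apply/eqP; ring.
apply: le_trans (ler_wpM2r (ltW Lm) tle) _; rewrite mulrDl.
have -> : (C + B) * (4 / Lam m) * rnorm f * Lam m = 4 * (C + B) * rnorm f.
  by field; rewrite gt_eqF.
have : C * rnorm f / Lam (size s') * Lam m <= C * rnorm f * 2.
  rewrite -[leLHS]mulrA; apply: ler_wpM2l; first exact: mulr_ge0.
  by rewrite mulrC ler_pdivrMr.
have := mulr_ge0 C0 nf; lra.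
Qed.

(** The corrections to the coordinates of [w] are now summed by means of
    [block_weights] for the dual fundamental function [m / Lam m]; the growth of
    the latter is the regularity assumed here. *)
Lemma dkk_dual (s : seq nat) (f : X) :
  (forall m, (0 < m)%N -> 2 * Lam (r * m)%N <= r%:R * Lam m) ->
  uniq s -> (0 < size s)%N ->
  (\sum_(j <- s) rabs (dkk_fun j f)) * Lam (size s)
    <= (7 * C + 6 * B) * (size s)%:R * rnorm f.
Proof.
move=> upper us s0.
have Lp n : (0 < n)%N -> 0 < Lam n by exact: fundamental_growth_gt0.
have Lm : 0 < Lam (size s) by exact: Lp.
have [_ mono _] := fg.
have h1 : \sum_(j <- s) (L (nb j))^-1 <= 6 * ((size s)%:R / Lam (size s)).
  have := @block_weights r r1 R (fun n => n%:R / Lam n) _ _ _ _ s us s0.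
  under eq_bigr => j _ do rewrite mulrAC mulfV ?mul1r ?gt_eqF //.
  apply.
  - by move=> n n0; rewrite divr_ge0 // ltW // Lp.
  - move=> m n /andP[m0 mn]; have n0 : (0 < n)%N by exact: leq_trans mn.
    have := @fundamental_growth_quasi _ _ fg m n; rewrite m0 mn => /(_ isT).
    have ? := Lp _ m0; have ? := Lp _ n0.
    have ? : 0 < m%:R :> R by rewrite ltr0n.
    have ? : 0 < n%:R :> R by rewrite ltr0n.
    exact: ratio_swap.
  - move=> m n /andP[m0 mn]; have n0 : (0 < n)%N by exact: leq_trans mn.
    have ? := Lp _ m0; have ? := Lp _ n0.
    have e q : (0 < q)%N -> q%:R / Lam q / q%:R = (Lam q)^-1.
      by move=> q0; rewrite mulrAC mulfV ?mul1r // pnatr_eq0 -lt0n.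
    rewrite !e //.
    have h : (Lam n)^-1 <= (Lam m)^-1 by rewrite lef_pV2 ?posrE //; exact: mono.
    by apply: le_trans h _; rewrite ler_peMl ?invr_ge0 ?ler1n // ltW.
  - move=> n n0; have rn0 : (0 < r * n)%N by rewrite muln_gt0 n0 ltnW.
    have ? := Lp _ n0; have ? := Lp _ rn0.
    have := upper n n0; have n0R : 0 < n%:R :> R by rewrite ltr0n.
    rewrite natrM mulrA ler_pdivrMr // mulrAC ler_pdivlMr //.
    by move=> /(ler_wpM2l (ltW n0R)); lra.
apply: le_trans (_ : (\sum_(j <- s) (rabs (ws j f) + (C + B) / L (nb j) * rnorm f)) *
    Lam (size s) <= _).
  by apply: ler_wpM2r; [exact: ltW|apply: ler_sum => j _; exact: dkk_fun_le].
rewrite big_split /= -mulr_suml -mulr_sumr mulrDl.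
have := dw.2 s f us (allT _).
have : (C + B) * (\sum_(j <- s) (L (nb j))^-1) * rnorm f * Lam (size s) <=
   (C + B) * (6 * ((size s)%:R / Lam (size s))) * rnorm f * Lam (size s).
  apply: ler_wpM2r; first exact: ltW.
  apply: ler_wpM2r; first exact: rnorm_ge0.
  by apply: ler_wpM2l => //; exact: addr_ge0.
have -> : (C + B) * (6 * ((size s)%:R / Lam (size s))) * rnorm f * Lam (size s) =
   (C + B) * 6 * (size s)%:R * rnorm f by field; rewrite gt_eqF.
lra.
Qed.

End DKK.

(** * Sequence spaces from systems of bounds *)

Section Completeness.
Context {R : realType} {k : scalar_kind}.
Local Notation F := (scalar_field R k).

Lemma rnorm_complete (X : completeNormedModType F) (u : nat -> X) :
  (forall e : R, 0 < e -> exists N, forall p q, (N <= p)%N -> (N <= q)%N ->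
     rnorm (u p - u q) < e) -> exists l : X, u @ \oo --> l.
Proof.
move=> h; suff cu : cvg (u @ \oo) by exists (lim (u @ \oo)).
apply: cauchy_cvg; apply: cauchy_exP.
move=> e e0; have e0' : 0 < to_real e by rewrite -(@sc_lt R k) sc0 -sc_real // ltW.
have [N hN] := h _ e0'; exists (u N), N => // p /= Np.
rewrite -ball_normE /= rnormE (sc_real (ltW e0)) sc_lt; exact: hN.
Qed.
End Completeness.

Lemma scalar_complete {R : realType} {k : scalar_kind} (u : nat -> scalar_field R k) :
  (forall e : R, 0 < e -> exists N, forall p q, (N <= p)%N -> (N <= q)%N ->
     rabs (u p - u q) < e) ->
  exists l, forall e : R, 0 < e -> exists N, forall p, (N <= p)%N -> rabs (u p - l) < e.
Proof.
have real (v : nat -> R) : (forall e : R, 0 < e -> exists N, forall p q,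
    (N <= p)%N -> (N <= q)%N -> `|v p - v q| < e) ->
    exists l, forall e : R, 0 < e -> exists N, forall p, (N <= p)%N -> `|v p - l| < e.
  move=> hv; have [l /(@cvg_rnorm R RealScalars R^o)hl] :=
    @rnorm_complete R RealScalars R^o v hv.
  exists l => e e0; have [N hN] := hl e e0; exists N => p Np.
  by have := hN p Np; rewrite rdistC.
case: k u => [|u hu]; first exact: real.
have re_le (a : R[i]) : `|complex.Re a| <= rabs (a : scalar_field R ComplexScalars).
  case: a => a b; rewrite /rabs /= -sqrtr_sqr ler_wsqrtr //.
  by rewrite lerDl sqr_ge0.
have im_le (a : R[i]) : `|complex.Im a| <= rabs (a : scalar_field R ComplexScalars).
  case: a => a b; rewrite /rabs /= -sqrtr_sqr ler_wsqrtr //.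
  by rewrite lerDr sqr_ge0.
have [l hl] : exists l, forall e : R, 0 < e -> exists N, forall p, (N <= p)%N ->
    `|complex.Re (u p) - l| < e.
  apply: real => e e0; have [N hN] := hu e e0; exists N => p q Np Nq.
  apply: le_lt_trans (hN p q Np Nq); apply: le_trans (re_le _).
  by case: (u p) (u q) => ? ? [].
have [m hm] : exists m, forall e : R, 0 < e -> exists N, forall p, (N <= p)%N ->
    `|complex.Im (u p) - m| < e.
  apply: real => e e0; have [N hN] := hu e e0; exists N => p q Np Nq.
  apply: le_lt_trans (hN p q Np Nq); apply: le_trans (im_le _).
  by case: (u p) (u q) => ? ? [].
exists (l +i* m)%C => e e0.
have [N hN] := hl (e / 2) ltac:(by rewrite divr_gt0).
have [M hM] := hm (e / 2) ltac:(by rewrite divr_gt0).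
exists (maxn N M) => p; rewrite geq_max => /andP[/hN h1 /hM h2].
have split (a b : R) : rabs ((a +i* b)%C : scalar_field R ComplexScalars) <= `|a| + `|b|.
  rewrite /rabs /= -(ger0_norm (addr_ge0 (normr_ge0 a) (normr_ge0 b))) -sqrtr_sqr.
  apply: ler_wsqrtr; rewrite -(real_normK (num_real a)) -(real_normK (num_real b)).
  have := mulr_ge0 (normr_ge0 a) (normr_ge0 b); rewrite !expr2; lra.
move: h1 h2; case: (u p) => a b /= h1 h2.
apply: le_lt_trans (split _ _) _; lra.
Qed.

Section FiniteSequences.
Context {R : realType} {k : scalar_kind}.
Local Notation F := (scalar_field R k).
Implicit Types a : nat -> F^o.

Lemma c00P a : @c00 R k a <-> exists N, forall n, (N <= n)%N -> a n = 0.
Proof.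
split=> [/finite_seqP[s sE]|[N hN]].
  exists (\max_(n <- s) n).+1 => n; apply: contraTeq => an; rewrite -ltnNge ltnS.
  have : [set n | a n != 0] n by [].
  by rewrite sE /= => ns; rewrite (big_rem _ ns) /= leq_maxl.
apply: sub_finite_set (finite_seq (iota 0 N)) => n /= an.
by rewrite mem_iota /= add0n ltnNge; apply: contra an => /hN ->.
Qed.

Lemma scale_unit_seqE (c : F) i n : (c *: unit_seq (R := R) (k := k) i) n = c * (n == i)%:R.
Proof. by []. Qed.

Lemma sum_unit_seq a N : (forall n, (N <= n)%N -> a n = 0) ->
  a = \sum_(i < N) a i *: unit_seq i.
Proof.
move=> aN; apply/funext => n; rewrite fct_sumE.
under eq_bigr => i _ do rewrite scale_unit_seqE.
have [nN|Nn] := ltnP n N; last first.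
  rewrite aN // big1 // => i _; rewrite gtn_eqF ?mulr0 //.
  exact: leq_trans (ltn_ord i) Nn.
rewrite (bigD1 (Ordinal nN)) //= eqxx mulr1 big1 ?addr0 //.
by move=> i; rewrite -val_eqE /= eq_sym => /negbTE ->; rewrite mulr0.
Qed.

Lemma fsbig_bounded (V : nmodType) (A : set nat) (f : nat -> V) N :
  (forall n, A n -> (N <= n)%N -> f n = 0) ->
  \sum_(n \in A) f n = \sum_(0 <= n < N | n \in A) f n.
Proof.
move=> hN; pose r := [seq n <- iota 0 N | n \in A].
rewrite (@fsbigE _ _ _ _ A r f).
- rewrite /index_iota subn0 /r big_filter_cond; apply: eq_bigl => n.
  by rewrite andbb.
- exact/filter_uniq/iota_uniq.
- by move=> n; rewrite /= mem_filter => /andP[/set_mem].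
move=> n An; rewrite mem_filter mem_set // mem_iota /= add0n -leqNgt.
exact: hN.
Qed.

Lemma fsbigT_bounded (V : nmodType) (f : nat -> V) N :
  (forall n, (N <= n)%N -> f n = 0) -> \sum_(n \in [set: nat]) f n = \sum_(n < N) f n.
Proof.
move=> hN; rewrite (fsbig_bounded (N := N)) ?big_mkord => [|n _]; last exact: hN.
by apply: eq_bigl => n; rewrite in_setT.
Qed.

End FiniteSequences.

(** A sequence space presented by its scaled balls: [Bd a M] stands for
    [|a| <= M], the norm being infinite where no such [M] exists. The Fatou
    property makes completeness automatic, and passing to the closure of the
    finitely supported sequences makes them dense. *)
Section SpaceOfBounds.
Context {R : realType} {k : scalar_kind}.
Local Notation F := (scalar_field R k).
Implicit Types a b : nat -> F^o.

Record norm_bounds (Bd : (nat -> F^o) -> R -> Prop) (K : R) : Prop := NormBounds {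
  nb_K : 0 < K;
  nb_ge0 : forall a M, Bd a M -> 0 <= M;
  nb_le : forall a M M', Bd a M -> M <= M' -> Bd a M';
  nb_inf : forall a M, (forall e, 0 < e -> Bd a (M + e)) -> Bd a M;
  nb_scale : forall (c : F) a M, Bd a M -> Bd (c *: a) (rabs c * M);
  nb_add : forall a b M M', Bd a M -> Bd b M' -> Bd (a + b) (K * (M + M'));
  nb_coord : forall n, exists2 C : R, 0 <= C & forall a M, Bd a M -> rabs (a n) <= C * M;
  nb_unit : forall n, exists M, Bd (unit_seq n) M;
  nb_fatou : forall (u : nat -> nat -> F^o) l M, (forall p, Bd (u p) M) ->
    (forall n (e : R), 0 < e -> exists N, forall p, (N <= p)%N -> rabs (u p n - l n) < e) ->
    Bd l M
}.

Section Build.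
Variables (Bd : (nat -> F^o) -> R -> Prop) (K : R).
Hypothesis nb : norm_bounds Bd K.

Definition bound_norm a : R := inf [set M | Bd a M].
Definition bound_car : set (nat -> F^o) :=
  [set a | (exists M, Bd a M) /\ forall e : R, 0 < e -> exists2 v, c00 v & Bd (a - v) e].

Lemma bound_norm_le a M : Bd a M -> bound_norm a <= M.
Proof.
by move=> h; apply: ge_inf => //; exists 0 => M'; exact: (nb_ge0 nb).
Qed.

Lemma bound_norm_attained a M : Bd a M -> Bd a (bound_norm a).
Proof.
move=> h; apply: (nb_inf nb) => e e0.
have hi : has_inf [set M | Bd a M].
  by split; [exists M|exists 0 => M'; exact: (nb_ge0 nb)].
have [M' hM' lt] := inf_adherent e0 hi.
exact: (nb_le nb) hM' (ltW lt).
Qed.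

Lemma bd0 : Bd 0 0.
Proof.
have [M hM] := nb_unit nb 0%N.
by have := nb_scale nb 0 hM; rewrite scale0r rabs0 mul0r.
Qed.

Lemma bd_opp a M : Bd a M -> Bd (- a) M.
Proof.
by move=> /(nb_scale nb (-1)); rewrite scaleN1r rabsN rabs1 mul1r.
Qed.

Lemma bd_c00 a : c00 a -> exists M, Bd a M.
Proof.
move=> /c00P[N hN]; rewrite (sum_unit_seq hN).
elim/big_ind : _ => [|x y [M hM] [M' hM']|i _]; first by exists 0; exact: bd0.
  by eexists; apply: (nb_add nb); [exact: hM|exact: hM'].
by have [M hM] := nb_unit nb i; eexists; apply: (nb_scale nb); exact: hM.
Qed.

Lemma c00_lin (c : F) a b : c00 a -> c00 b -> c00 (c *: a + b).
Proof.
move=> /c00P[N hN] /c00P[M hM]; apply/c00P; exists (maxn N M) => n.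
rewrite geq_max => /andP[/hN h1 /hM h2].
have -> : (c *: a + b) n = c * a n + b n by [].
by rewrite h1 h2 mulr0 addr0.
Qed.

Lemma bound_car_c00 : c00 `<=` bound_car.
Proof.
move=> a ca; split; first exact: bd_c00.
move=> e e0; exists a => //; rewrite subrr; apply: (nb_le nb) bd0 _; exact: ltW.
Qed.

Lemma bound_car_lin (c : F) a b : bound_car a -> bound_car b -> bound_car (c *: a + b).
Proof.
have K0 := nb_K nb.
move=> [[M hM] ha] [[M' hM'] hb]; split.
  by eexists; apply: (nb_add nb); [apply: (nb_scale nb); exact: hM|exact: hM'].
move=> e e0; pose A := rabs c + 1.
have A0 : 0 < A by rewrite ltr_wpDl // rabs_ge0.
have [v cv av] := ha (e / (2 * K * A)) ltac:(by rewrite !(divr_gt0, mulr_gt0)).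
have [v' cv' bv] := hb (e / (2 * K)) ltac:(by rewrite !(divr_gt0, mulr_gt0)).
exists (c *: v + v'); first exact: c00_lin.
rewrite opprD addrACA -scalerBr.
apply: (nb_le nb) (nb_add nb (nb_scale nb c av) bv) _.
have : rabs c * (e / (2 * K * A)) <= A * (e / (2 * K * A)).
  by apply: ler_wpM2r; [rewrite divr_ge0 ?mulr_ge0 ?ltW|rewrite lerDl].
have -> : A * (e / (2 * K * A)) = e / (2 * K) by field; rewrite !gt_eqF.
move=> h; apply: le_trans (ler_wpM2l (ltW K0) (lerD h (lexx _))) _.
by rewrite le_eqVlt; apply/orP; left; apply/eqP; field; rewrite gt_eqF.
Qed.

Lemma bound_complete (u : nat -> nat -> F^o) : (forall n, bound_car (u n)) ->
  (forall e : R, 0 < e -> exists N, forall p q, (N <= p)%N -> (N <= q)%N ->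
     bound_norm (u p - u q) < e) ->
  exists l, bound_car l /\ forall e : R, 0 < e -> exists N, forall p, (N <= p)%N ->
     bound_norm (u p - l) < e.
Proof.
move=> cu hu; have K0 := nb_K nb.
have cau e : 0 < e -> exists N, forall p q, (N <= p)%N -> (N <= q)%N -> Bd (u p - u q) e.
  move=> e0; have [N hN] := hu e e0; exists N => p q Np Nq.
  have := hN p q Np Nq => /ltW; apply: (nb_le nb).
  have [[M hM] _] := bound_car_lin (-1) (cu q) (cu p).
  by apply: (@bound_norm_attained _ M); move: hM; rewrite scaleN1r addrC.
have /choice[l hl] n : exists l : F, forall e : R, 0 < e -> exists N, forall p, (N <= p)%N ->
    rabs (u p n - l) < e.
  apply: scalar_complete => e e0; have [C C0 hC] := nb_coord nb n.
  have [N hN] := cau (e / (C + 1)) ltac:(by rewrite divr_gt0 // ltr_wpDl).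
  exists N => p q Np Nq; apply: le_lt_trans (hC _ _ (hN p q Np Nq)) _.
  rewrite mulrA ltr_pdivrMr; last by rewrite ltr_wpDl.
  by rewrite mulrC mulrDr mulr1 ltrDl.
have lim e : 0 < e -> exists N, forall p, (N <= p)%N -> Bd (u p - (l : nat -> F^o)) e.
  move=> e0; have [N hN] := cau e e0; exists N => p Np.
  apply: (nb_fatou nb) (fun q => hN p (N + q)%N Np (leq_addr _ _)) _ => n d d0.
  have [M hM] := hl n d d0; exists M => q Mq.
  have -> : (u p - u (N + q)%N) n - (u p - (l : nat -> F^o)) n = - (u (N + q)%N n - l n).
    rewrite -[LHS]/(u p n - u (N + q)%N n - (u p n - l n)).
    by rewrite opprB addrC addrA subrK opprB.
  by rewrite rabsN; apply: hM; exact: leq_trans Mq (leq_addl _ _).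
exists l; split; last first.
  move=> e e0; have [N hN] := lim (e / 2) ltac:(by rewrite divr_gt0).
  exists N => p /hN/bound_norm_le h; apply: le_lt_trans h _; lra.
have shift p v : (l : nat -> F^o) - v = (u p - v) + - (u p - (l : nat -> F^o)).
  by rewrite opprB [RHS]addrC addrA subrK.
split=> [|e e0].
  have [N hN] := lim 1 ltr01; have [[M hM] _] := cu N.
  have -> : l = u N + - (u N - (l : nat -> F^o)) by rewrite opprB addrC subrK.
  by eexists; apply: (nb_add nb); [exact: hM|apply: bd_opp; exact: (hN N)].
have [N hN] := lim (e / (2 * K)) ltac:(by rewrite divr_gt0 ?mulr_gt0).
have [_ /(_ (e / (2 * K)))[|v cv hv]] := cu N; first by rewrite divr_gt0 ?mulr_gt0.
exists v => //; rewrite (shift N).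
apply: (nb_le nb) (nb_add nb hv (bd_opp (hN N (leqnn _)))) _.
by rewrite le_eqVlt; apply/orP; left; apply/eqP; field; rewrite gt_eqF.
Qed.

Lemma bound_norm_ge0 a : 0 <= bound_norm a.
Proof.
have [[M hM]|h] := pselect (exists M, Bd a M).
  by apply: lb_le_inf => [|M']; [exists M|exact: (nb_ge0 nb)].
rewrite /bound_norm (_ : [set M | Bd a M] = set0) ?inf0 //.
by apply/seteqP; split=> M //= hM; apply: h; exists M.
Qed.

Lemma bound_normZ_le (c : F) a M : Bd a M -> bound_norm (c *: a) <= rabs c * bound_norm a.
Proof.
move=> h; apply: bound_norm_le; apply: (nb_scale nb); exact: bound_norm_attained h.
Qed.

Definition space_of_bounds : @seq_space R k.
Proof.
refine (@SeqSpace R k bound_car bound_norm bound_car_c00 bound_car_lin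
  (fun u _ => bound_norm_ge0 u) _ _ _ bound_complete _ _).
- move=> a [[M hM] _] a0; apply/funext => n; have [C _ hC] := nb_coord nb n.
  have := hC _ _ (bound_norm_attained hM); rewrite a0 mulr0 => h.
  by apply/eqP; rewrite -rabs_eq0; apply/eqP/le_anti; rewrite h rabs_ge0.
- move=> c a [[M hM] _]; apply/le_anti; rewrite (bound_normZ_le c hM) /=.
  have [->|c0] := eqVneq c 0; first by rewrite rabs0 mul0r bound_norm_ge0.
  have := bound_normZ_le c^-1 (nb_scale nb c hM).
  rewrite scalerA mulVf // scale1r rabsV => h.
  by rewrite -ler_pdivlMl // rabs_gt0.
- exists K => a b [[M hM] _] [[M' hM'] _]; apply: bound_norm_le.
  by apply: (nb_add nb); [exact: bound_norm_attained hM|exact: bound_norm_attained hM'].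
- move=> a [_ ha] e e0; have [v cv hv] := ha (e / 2) ltac:(by rewrite divr_gt0).
  by exists v; split=> //; apply: le_lt_trans (bound_norm_le hv) _; lra.
- move=> n; have [C _ hC] := nb_coord nb n; exists C => a [[M hM] _].
  exact/hC/(bound_norm_attained hM).
Defined.

Lemma symmetric_space_of_bounds :
  (forall a a' (eps : nat -> F) (pi : nat -> nat) M, (forall n, rabs (eps n) = 1) ->
     bijective pi -> (forall n, a' (pi n) = eps n * a n) -> Bd a M -> Bd a' M) ->
  symmetric_space space_of_bounds.
Proof.
move=> inv a eps pi /c00P[N hN] heps [pi' piK pi'K].
have eps1 n : rabs (eps n) = 1 by apply/rabs_unit.
rewrite (fsbigT_bounded (N := N)); last by move=> n Nn; rewrite hN ?mulr0 ?scale0r.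
rewrite (fsbigT_bounded (N := N)); last by move=> n Nn; rewrite hN ?mulr0 ?scale0r.
rewrite -(sum_unit_seq hN); set a' := \sum_(n < N) _.
have a'E n : a' (pi n) = eps n * a n.
  rewrite /a' fct_sumE.
  under eq_bigr => i _ do rewrite scale_unit_seqE (inj_eq (can_inj piK)).
  have [nN|Nn] := ltnP n N; last first.
    rewrite hN // mulr0 big1 // => i _.
    by rewrite gtn_eqF ?mulr0 // (leq_trans _ Nn).
  rewrite (bigD1 (Ordinal nN)) //= eqxx mulr1 big1 ?addr0 //.
  by move=> i; rewrite -val_eqE /= eq_sym => /negbTE ->; rewrite mulr0.
rewrite /= /bound_norm; congr (inf _); apply/seteqP; split=> M /=.
  apply: (inv a' a (fun n => (eps (pi' n))^-1) pi') => //.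
  - by move=> n; rewrite rabsV eps1 invr1.
  - by exists pi.
  move=> n; have := a'E (pi' n); rewrite pi'K => ->; rewrite mulKf //.
  by rewrite -rabs_eq0 eps1 oner_eq0.
by apply: inv a'E => //; exists pi'.
Qed.

End Build.
End SpaceOfBounds.

(** * Bases squeezed between symmetric spaces *)

Section SqueezedBasis.
Context {R : realType} {k : scalar_kind}.
Local Notation F := (scalar_field R k).
Variable X : completeNormedModType F.
Variables (Lam : nat -> R) (CU CL : R) (b : nat -> X) (bs : nat -> X -> F).
Hypothesis fg : fundamental_growth Lam.
Hypotheses (CU0 : 0 <= CU) (CL0 : 0 <= CL).
Hypotheses (bb : biorthogonal b bs) (fb : bounded_functionals bs).
Hypothesis b_dense : forall f, closure (spn b) f.
Hypothesis b_total : forall f, (forall j, bs j f = 0) -> f = 0.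
Hypothesis b_upper : forall (s : seq nat) (c : nat -> F), uniq s -> (0 < size s)%N ->
  (forall i, rabs (c i) <= 1) ->
  rnorm (\sum_(j <- s) c j *: b j) <= CU * Lam (size s).
Hypothesis b_lower : forall (s : seq nat) (f : X) (t : R), uniq s -> (0 < size s)%N ->
  0 <= t -> (forall j, j \in s -> t <= rabs (bs j f)) ->
  t * Lam (size s) <= CL * rnorm f.

Let bs_linear n : linear_for *:%R (bs n : X -> F^o).
Proof. by move=> a x y; have [K [l _]] := fb n; rewrite l. Qed.

Let bs_lin n : {linear X -> F^o} := HB.pack (bs n : X -> F^o)
  (@GRing.isLinear.Build F X F^o *:%R (bs n : X -> F^o) (bs_linear n)).

Let bs_continuous n : continuous (bs_lin n).
Proof.
have [K [_ h]] := fb n.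
exact: (@rnorm_bounded_continuous R k X F^o (bs_lin n) K h).
Qed.

Let b_span : closed_span (range b) = setT.
Proof.
apply/seteqP; split=> // f _.
have sub : spn b `<=` linear_span (range b) by move=> v; exact: spn_linear_span.
exact: (closure_subset sub (@b_dense f)).
Qed.

Let bs_b n j : bs_lin n (b j) = (j == n)%:R.
Proof. by rewrite eq_sym; exact: bb. Qed.

Definition squeezed_basis : space_basis X := Basis bs_continuous bs_b b_span.

Lemma squeezed_basis_total : total_basis squeezed_basis.
Proof.
move=> f g fg_eq; apply/eqP; rewrite -subr_eq0; apply/eqP/b_total => j.
have [K bK] := fb j; rewrite (bfuncB _ _ bK).
by have := congr1 (fun a => a j) fg_eq; rewrite /coeffs /= => ->; rewrite subrr.
Qed.

Let Lam1 : 0 < Lam 1%N. Proof. by case: fg. Qed.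
Let Lam_mono : {homo Lam : m n / (m <= n)%N >-> m <= n}. Proof. by case: fg. Qed.
Let Lam_gt0 n : (0 < n)%N -> 0 < Lam n. Proof. exact: fundamental_growth_gt0. Qed.

Lemma b_bound j : rnorm (b j) <= CU * Lam 1%N.
Proof.
have := b_upper (s := [:: j]) (c := fun=> 1) isT isT; rewrite big_seq1 scale1r.
by apply=> _; rewrite rabs1.
Qed.

Lemma b_upper_inj (s : seq nat) (c : nat -> F) (pi : nat -> nat) : uniq s ->
  {in s &, injective pi} -> (forall i, i \in s -> rabs (c i) <= 1) ->
  rnorm (\sum_(i <- s) c i *: b (pi i)) <= CU * Lam (size s).
Proof.
move=> us ipi hc; have [/size0nil ->|s0] := posnP (size s).
  rewrite big_nil rnorm0 mulr_ge0 //.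
  have [sub _ _] := fg; have := sub 0%N 0%N; rewrite addn0; lra.
have [c' hc' ->] := reindex_coeffs X ipi hc.
by rewrite -(size_map pi); apply: b_upper; rewrite ?size_map ?map_inj_in_uniq.
Qed.

Let uniform_limit (u : nat -> nat -> F) (l : nat -> F) (s : seq nat) (d : R) : 0 < d ->
  (forall n (e : R), 0 < e -> exists N, forall p, (N <= p)%N -> rabs (u p n - l n) < e) ->
  exists N, forall i, i \in s -> rabs (u N i - l i) <= d.
Proof.
move=> d0 lim; suff [N hN] : exists N, forall p i, (N <= p)%N -> i \in s ->
  rabs (u p i - l i) <= d by exists N => i; exact: hN.
elim: s => [|i s' [N hN]]; first by exists 0%N.
have [N' hN'] := lim i d d0.
exists (maxn N N') => p j; rewrite geq_max => /andP[Np N'p].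
by rewrite inE => /predU1P[->|js]; [exact/ltW/hN'|exact: hN].
Qed.

Let ind m : nat -> F^o := fun i => (i < m)%:R.

Let indE m : \sum_(n \in `I_m) @unit_seq R k n = ind m.
Proof.
rewrite -fsbig_ord (@sum_unit_seq R k (ind m) m); last first.
  by move=> n mn; rewrite /ind ltnNge mn.
by apply: eq_bigr => i _; rewrite /ind ltn_ord scale1r.
Qed.

(** The least symmetric norm dominating the norm of [\sum_i a i *: b i]. *)
Definition upper_bounds (a : nat -> F^o) (M : R) := 0 <= M /\
  forall (s : seq nat) (c : nat -> F) (pi : nat -> nat), uniq s ->
    {in s &, injective pi} -> (forall i, rabs (c i) <= 1) ->
    rnorm (\sum_(i <- s) (c i * a i) *: b (pi i)) <= M.

Let sum_unit_restrict (s : seq nat) (c : nat -> F) (a : nat -> F^o) (pi : nat -> nat)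
    (A : pred nat) : uniq s -> (forall i, i \in s -> ~~ A i -> a i = 0) ->
  \sum_(i <- s) (c i * a i) *: b (pi i) =
  \sum_(i <- [seq i <- s | A i]) (c i * a i) *: b (pi i).
Proof.
move=> us h; rewrite big_filter (bigID A) /= [X in _ + X]big1_seq ?addr0 //.
by move=> i /andP[Ai is_]; rewrite h // mulr0 scale0r.
Qed.

Let b_neq0 n : 0 < rnorm (b n).
Proof.
rewrite rnorm_gt0; apply/eqP => b0.
have [K bK] := fb n; have := bb n n; rewrite b0 (bfunc0v bK) eqxx => /eqP.
by rewrite eq_sym oner_eq0.
Qed.

Lemma upper_bounds_norm : norm_bounds upper_bounds 1.
Proof.
split.
- by [].
- by move=> a M [].
- move=> a M M' [M0 h] MM; split; first exact: le_trans MM.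
  by move=> s c pi us ip hc; apply: le_trans MM; exact: h.
- move=> a M h; split; first by apply/ler_addgt0Pl => e /h[]; rewrite addrC.
  by move=> s c pi us ip hc; apply/ler_addgt0Pl => e /h[_]; rewrite addrC; exact.
- move=> d a M [M0 h]; split; first by rewrite mulr_ge0 // rabs_ge0.
  move=> s c pi us ip hc.
  have -> : \sum_(i <- s) (c i * (d *: a) i) *: b (pi i) =
      d *: \sum_(i <- s) (c i * a i) *: b (pi i).
    rewrite scaler_sumr; apply: eq_bigr => i _; rewrite scalerA.
    by rewrite -[(d *: a) i]/(d * a i) mulrCA.
  by rewrite rnormZ; apply: ler_wpM2l; [exact: rabs_ge0|exact: h].
- move=> a a' M M' [M0 h] [M0' h']; rewrite mul1r; split; first exact: addr_ge0.
  move=> s c pi us ip hc.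
  have -> : \sum_(i <- s) (c i * (a + a') i) *: b (pi i) =
     \sum_(i <- s) (c i * a i) *: b (pi i) + \sum_(i <- s) (c i * a' i) *: b (pi i).
    by rewrite -big_split /=; apply: eq_bigr => i _; rewrite -scalerDl -mulrDr.
  by apply: le_trans (rnormD _ _) _; apply: lerD; [exact: h|exact: h'].
- move=> n; exists (rnorm (b n))^-1; first by rewrite invr_ge0 rnorm_ge0.
  move=> a M [M0 h]; rewrite mulrC ler_pdivlMr //.
  have := h [:: n] (fun=> 1) id isT; rewrite big_seq1 mul1r rnormZ; apply.
    by move=> i j _ _.
  by move=> i; rewrite rabs1.
- move=> n; exists (CU * Lam 1%N); split; first by rewrite mulr_ge0 // ltW.
  move=> s c pi us ip hc; rewrite (@sum_unit_restrict s c _ pi (pred1 n)) //; last first.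
    by move=> i _ /= /negbTE ni; rewrite /unit_seq ni.
  have un : uniq [seq i <- s | pred1 n i] by exact: filter_uniq.
  apply: le_trans (b_upper_inj un _ _) _.
  + by move=> i j; rewrite !mem_filter => /andP[_ is_] /andP[_ js]; exact: ip.
  + move=> i; rewrite mem_filter => /andP[/eqP -> _].
    by rewrite /unit_seq eqxx mulr1.
  rewrite ler_wpM2l // Lam_mono // size_filter count_uniq_mem //.
  exact: leq_b1.
- move=> u l M h lim; split; first by have [] := h 0%N.
  move=> s c pi us ip hc; apply/ler_addgt0Pl => e e0.
  pose A := CU * Lam 1%N * (size s)%:R + 1.
  have A0 : 0 < A by rewrite ltr_wpDl // !mulr_ge0 // ltW.
  have [N hN] := uniform_limit s (divr_gt0 e0 A0) lim.
  have -> : \sum_(i <- s) (c i * l i) *: b (pi i) =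
      \sum_(i <- s) (c i * u N i) *: b (pi i) -
      \sum_(i <- s) (c i * (u N i - l i)) *: b (pi i).
    by rewrite -sumrB; apply: eq_bigr => i _; rewrite -scalerBl -mulrBr subKr.
  apply: le_trans (rnormB _ _) _; rewrite addrC; apply: lerD; last exact: (h N).2.
  apply: le_trans (rnorm_sum _ _ _) _.
  apply: le_trans (_ : \sum_(i <- s) e / A * (CU * Lam 1%N) <= _).
    rewrite big_seq [leRHS]big_seq; apply: ler_sum => i is_; rewrite rnormZ rabsM.
    apply: ler_pM; rewrite ?rnorm_ge0 ?mulr_ge0 ?rabs_ge0 ?b_bound //.
    by apply: le_trans (ler_piMl (rabs_ge0 _) (hc i)) _; exact: hN.
  rewrite sumr_const_seq -[leLHS]mulr_natr -!mulrA [A^-1 * _]mulrC !mulrA.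
  by rewrite ler_pdivrMr // -!mulrA ler_pM2l // !mulrA lerDl.
Qed.

Lemma upper_bounds_invariant (a a' : nat -> F^o) (eps : nat -> F) (pi : nat -> nat) M :
  (forall n, rabs (eps n) = 1) -> bijective pi -> (forall n, a' (pi n) = eps n * a n) ->
  upper_bounds a M -> upper_bounds a' M.
Proof.
move=> eps1 [pi' piK pi'K] a'E [M0 h]; split=> // s c rho us ir hc.
have -> : \sum_(i <- s) (c i * a' i) *: b (rho i) =
    \sum_(i <- map pi' s) (c (pi i) * eps i * a i) *: b (rho (pi i)).
  rewrite big_map; apply: eq_bigr => i _; rewrite pi'K -mulrA -a'E pi'K //.
apply: (h _ (fun i => c (pi i) * eps i) (rho \o pi)).
- by rewrite map_inj_uniq //; exact: can_inj pi'K.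
- move=> i j /mapP[i' is_ ->] /mapP[j' js ->] /=; rewrite !pi'K.
  by move=> /ir ->.
- by move=> i; rewrite rabsM eps1 mulr1.
Qed.

(** The weak (Marcinkiewicz) space of the fundamental function. *)
Definition weak_bounds (a : nat -> F^o) (M : R) := 0 <= M /\
  forall (s : seq nat) (t : R), uniq s -> (0 < size s)%N -> 0 <= t ->
    (forall j, j \in s -> t <= rabs (a j)) -> t * Lam (size s) <= M.

Lemma weak_bounds_norm : norm_bounds weak_bounds 4.
Proof.
split.
- by [].
- by move=> a M [].
- move=> a M M' [M0 h] MM; split; first exact: le_trans MM.
  by move=> s t us s0 t0 hc; apply: le_trans MM; exact: h.
- move=> a M h; split; first by apply/ler_addgt0Pl => e /h[]; rewrite addrC.
  by move=> s t us s0 t0 hc; apply/ler_addgt0Pl => e /h[_]; rewrite addrC; exact.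
- move=> d a M [M0 h]; split; first by rewrite mulr_ge0 // rabs_ge0.
  move=> s t us s0 t0 hc.
  have {}hc j : j \in s -> t <= rabs d * rabs (a j).
    by move=> /hc; rewrite -[(d *: a) j]/(d * a j) rabsM.
  have [d0|d0] := eqVneq d 0.
    have [j js] : exists j, j \in s by case: (s) s0 => // j s' _; exists j; rewrite mem_head.
    have := hc j js; rewrite d0 rabs0 !mul0r => t0'.
    by apply: mulr_le0_ge0 => //; exact/ltW/Lam_gt0.
  have d1 : 0 < rabs d by rewrite rabs_gt0.
  rewrite -ler_pdivrMl // mulrA; apply: h => //.
    by rewrite mulr_ge0 // invr_ge0 ltW.
  by move=> j /hc; rewrite ler_pdivrMl.
- move=> a a' M M' [M0 h] [M0' h']; split; first by rewrite mulr_ge0 // addr_ge0.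
  move=> s t us s0 t0 hc.
  pose A := [pred j | t / 2 <= rabs (a j)].
  have sz : (size [seq j <- s | A j] + size [seq j <- s | predC A j])%N = size s.
    by rewrite !size_filter count_predC.
  have half (s' : seq nat) : (size s <= 2 * size s')%N -> (0 < size s')%N /\
      Lam (size s) <= 2 * Lam (size s').
    move=> le; have s'0 : (0 < size s')%N.
      by rewrite lt0n; apply: contraTneq le => ->; rewrite muln0 -ltnNge.
    split=> //; apply: le_trans (Lam_mono le) _.
    exact: fundamental_growthM.
  have t20 : 0 <= t / 2 by rewrite divr_ge0.
  have [le|lt] := leqP (size s) (2 * size [seq j <- s | A j]).
    have [s'0 L] := half _ le.
    have h1 : t / 2 * Lam (size [seq j <- s | A j]) <= M.
      apply: h => //; first exact: filter_uniq.
      by move=> j; rewrite mem_filter => /andP[].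
    have := ler_wpM2l t0 L; lra.
  have le : (size s <= 2 * size [seq j <- s | predC A j])%N by lia.
  have [s'0 L] := half _ le.
  have h1 : t / 2 * Lam (size [seq j <- s | predC A j]) <= M'.
    apply: h' => //; first exact: filter_uniq.
    move=> j; rewrite mem_filter /= -ltNge => /andP[aj /hc].
    have := rabsD (a j) (a' j); rewrite -[(a + a') j]/(a j + a' j); lra.
  have := ler_wpM2l t0 L; lra.
- move=> n; exists (Lam 1%N)^-1; first by rewrite invr_ge0 ltW.
  move=> a M [M0 h]; rewrite mulrC ler_pdivlMr //.
  apply: (h [:: n]) => //; first exact: rabs_ge0.
  by move=> j; rewrite inE => /eqP ->.
- move=> n; exists (Lam 1%N); split; first exact: ltW.
  move=> s t us s0 t0 hc.
  have [t_gt0|t_le0] := ltP 0 t; last first.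
    by apply: le_trans (mulr_le0_ge0 t_le0 (ltW (Lam_gt0 s0))) (ltW Lam1).
  have sn j : j \in s -> j = n /\ t <= 1.
    move=> /hc; rewrite /unit_seq; case: eqP => [->|_]; first by rewrite rabs1.
    by rewrite rabs0 leNgt t_gt0.
  have s1 : (size s <= 1)%N.
    by apply: (@uniq_leq_size _ s [:: n]) => // j /sn[-> _]; exact: mem_head.
  have t1 : t <= 1 by case: (s) s0 sn => // j s' _ /(_ j (mem_head _ _))[].
  apply: le_trans (ler_piMl (ltW (Lam_gt0 s0)) t1) _; exact: Lam_mono.
- move=> u l M h lim; split; first by have [] := h 0%N.
  move=> s t us s0 t0 hc; apply/ler_addgt0Pl => e e0.
  have L0 := Lam_gt0 s0.
  pose d := e / Lam (size s); have d0 : 0 < d by rewrite divr_gt0.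
  have [N hN] := uniform_limit s d0 lim.
  have [td|dt] := leP t d.
    have : t * Lam (size s) <= d * Lam (size s) by rewrite ler_pM2r.
    by rewrite /d divfK ?gt_eqF //; have := (h N).1; lra.
  have := (h N).2 s (t - d) us s0; rewrite subr_ge0 ltW // => /(_ isT).
  rewrite mulrBl /d divfK ?gt_eqF // => hh.
  suff : t * Lam (size s) - e <= M by lra.
  apply: hh => j js; have := hc j js; have := hN j js.
  by have := rabsD (u N j) (- (u N j - l j)); rewrite subKr rabsN -/d; lra.
Qed.

Lemma weak_bounds_invariant (a a' : nat -> F^o) (eps : nat -> F) (pi : nat -> nat) M :
  (forall n, rabs (eps n) = 1) -> bijective pi -> (forall n, a' (pi n) = eps n * a n) ->
  weak_bounds a M -> weak_bounds a' M.
Proof.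
move=> eps1 [pi' piK pi'K] a'E [M0 h]; split=> // s t us s0 t0 hc.
rewrite -(size_map pi'); apply: h => //.
- by rewrite map_inj_uniq //; exact: can_inj pi'K.
- by rewrite size_map.
- move=> _ /mapP[j js ->]; apply: le_trans (hc j js) _.
  by rewrite -{1}(pi'K j) a'E rabsM eps1 mul1r.
Qed.

Lemma weak_bounds_coeffs (f : X) : weak_bounds (fun n => bs n f) (CL * rnorm f).
Proof.
split; first by rewrite mulr_ge0 // rnorm_ge0.
by move=> s t us s0 t0 hc; exact: b_lower.
Qed.

Let rlim (u : nat -> X) (l : X) := forall e : R, 0 < e ->
  exists N, forall n, (N <= n)%N -> rnorm (l - u n) < e.

Let partial (a : nat -> F^o) n := \sum_(0 <= i < n) a i *: b i.

Let partial_bound a M n : upper_bounds a M -> rnorm (partial a n) <= M.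
Proof.
move=> [M0 h]; have := h (index_iota 0 n) (fun=> 1) id (iota_uniq _ _).
under eq_bigr => i _ do rewrite mul1r.
by apply=> [i j _ _|i] //; rewrite rabs1.
Qed.

Let partial_lin (c : F) a a' n : partial (c *: a + a') n = c *: partial a n + partial a' n.
Proof.
rewrite /partial scaler_sumr -big_split /=; apply: eq_bigr => i _.
by rewrite -[(c *: a + a') i]/(c * a i + a' i) scalerDl scalerA.
Qed.

Let rlim_unique u l l' : rlim u l -> rlim u l' -> l = l'.
Proof.
move=> h h'; apply/eqP; rewrite -subr_eq0; apply/eqP/rnorm_small => e e0.
have [N hN] := h (e / 2) ltac:(by rewrite divr_gt0).
have [N' hN'] := h' (e / 2) ltac:(by rewrite divr_gt0).
have := hN _ (leq_maxl N N'); have := hN' _ (leq_maxr N N').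
set x := u _; have := rnormB (l - x) (l' - x).
by rewrite opprB addrA subrK; lra.
Qed.

Let rlim_lin (c : F) u l u' l' : rlim u l -> rlim u' l' ->
  rlim (fun n => c *: u n + u' n) (c *: l + l').
Proof.
move=> h h' e e0; pose A := rabs c + 1.
have A0 : 0 < A by rewrite ltr_wpDl // rabs_ge0.
have [N hN] := h (e / (2 * A)) ltac:(by rewrite divr_gt0 // mulr_gt0).
have [N' hN'] := h' (e / 2) ltac:(by rewrite divr_gt0).
exists (maxn N N') => n; rewrite geq_max => /andP[/hN h1 /hN' h2].
rewrite opprD addrACA -scalerBr; apply: le_lt_trans (rnormD _ _) _; rewrite rnormZ.
have : rabs c * rnorm (l - u n) <= A * (e / (2 * A)).
  by apply: ler_pM; rewrite ?rabs_ge0 ?rnorm_ge0 ?ltW // /A; lra.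
have -> : A * (e / (2 * A)) = e / 2 by field; rewrite gt_eqF.
lra.
Qed.

Let rlim_bound u l M : rlim u l -> (forall n, rnorm (u n) <= M) -> rnorm l <= M.
Proof.
move=> h hu; apply/ler_addgt0Pl => e /h[N /(_ N (leqnn N)) hN].
have := rnormD (l - u N) (u N); rewrite subrK; have := hu N; lra.
Qed.

Let partial_cvg a : bound_car upper_bounds a -> exists l, rlim (partial a) l.
Proof.
move=> [_ ha]; have [|l hl] := rnorm_complete (u := partial a); last first.
  by exists l; apply/cvg_rnorm.
move=> e e0; have [v cv [_ hv]] := ha (e / 2) ltac:(by rewrite divr_gt0).
have [N hN] := (c00P v).1 cv; exists N.
have main p q : (N <= p)%N -> (p <= q)%N -> rnorm (partial a q - partial a p) < e.
  move=> Np pq; rewrite /partial (big_cat_nat (leq0n p) pq) /= addrAC subrr add0r.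
  apply: le_lt_trans (_ : e / 2 < e); last by lra.
  have := hv (index_iota p q) (fun=> 1) id (iota_uniq _ _).
  rewrite (@eq_big_nat _ _ _ p q _ (fun i => a i *: b i)).
    by apply=> [i j _ _|i] //; rewrite rabs1.
  move=> i /andP[pi _]; rewrite mul1r -[(a - v) i]/(a i - v i).
  by rewrite hN ?subr0 // (leq_trans Np).
move=> p q Np Nq; have [pq|qp] := leqP p q; first by rewrite rdistC; exact: main.
by apply: main => //; exact: ltnW.
Qed.

Let upper_space := space_of_bounds upper_bounds_norm.
Let weak_space := space_of_bounds weak_bounds_norm.

Let fundamental_upper m : (0 < m)%N ->
  fundamental upper_space m <= CU * Lam m /\ Lam m <= CL * fundamental upper_space m.
Proof.
move=> m0; rewrite /fundamental indE /=.
have ub : upper_bounds (ind m) (CU * Lam m).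
  split; first by rewrite mulr_ge0 // ltW // Lam_gt0.
  move=> s c pi us ip hc.
  rewrite (@sum_unit_restrict s c _ pi (fun i => (i < m)%N)) //; last first.
    by move=> i _ /negbTE h; rewrite /ind h.
  apply: le_trans (b_upper_inj (filter_uniq _ us) _ _) _.
  - by move=> i j; rewrite !mem_filter => /andP[_ is_] /andP[_ js]; exact: ip.
  - by move=> i; rewrite mem_filter => /andP[im _]; rewrite /ind im mulr1.
  rewrite ler_wpM2l // Lam_mono // -[leqRHS](size_iota 0).
  apply: uniq_leq_size; first exact: filter_uniq.
  by move=> i; rewrite mem_filter mem_iota => /andP[].
split; first exact: (bound_norm_le upper_bounds_norm).
have [_ h] := bound_norm_attained upper_bounds_norm ub.
have one_le (i : nat) : rabs (1 : F) <= 1 by rewrite rabs1.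
have hh := h (iota 0 m) (fun=> 1) id (iota_uniq _ _) (fun _ _ _ _ e => e) one_le.
have := b_lower (s := iota 0 m) (f := \sum_(j <- iota 0 m) b j) (t := 1) (iota_uniq _ _).
rewrite size_iota mul1r => /(_ m0 ler01 _) hl.
apply: le_trans (hl _) _.
  by move=> j js; rewrite (biorth_sum bb fb (iota_uniq _ _)) js rabs1.
apply: ler_wpM2l => //; apply: le_trans hh.
rewrite le_eqVlt; apply/orP; left; apply/eqP; congr rnorm.
rewrite big_seq [RHS]big_seq; apply: eq_bigr => i; rewrite mem_iota => /= im.
by rewrite mul1r /ind im scale1r.
Qed.

Let fundamental_weak m : (0 < m)%N -> fundamental weak_space m = Lam m.
Proof.
move=> m0; rewrite /fundamental indE /=.
have wb : weak_bounds (ind m) (Lam m).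
  split; first by rewrite ltW // Lam_gt0.
  move=> s t us s0 t0 hc; have [t_gt0|t_le0] := ltP 0 t; last first.
    by apply: le_trans (mulr_le0_ge0 t_le0 (ltW (Lam_gt0 s0))) (ltW (Lam_gt0 m0)).
  have sm j : j \in s -> (j < m)%N /\ t <= 1.
    move=> /hc; rewrite /ind; case: ltnP => _; first by rewrite rabs1.
    by rewrite rabs0 leNgt t_gt0.
  have t1 : t <= 1 by case: (s) s0 sm => // j s' _ /(_ j (mem_head _ _))[].
  apply: le_trans (ler_piMl (ltW (Lam_gt0 s0)) t1) _; apply: Lam_mono.
  rewrite -[leqRHS](size_iota 0); apply: uniq_leq_size => // j /sm[jm _].
  by rewrite mem_iota.
apply/le_anti; rewrite (bound_norm_le weak_bounds_norm wb) /=.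
have [_ h] := bound_norm_attained weak_bounds_norm wb.
have := h (iota 0 m) 1 (iota_uniq _ _); rewrite size_iota mul1r; apply=> //.
by move=> j; rewrite mem_iota => /= jm; rewrite /ind jm rabs1.
Qed.

(** The two spaces have the same fundamental function up to constants: by
    [b_upper] the first one is at most [CU * Lam m], and by [b_lower] at least
    [Lam m / CL], while the second one is [Lam m]. *)
Lemma squeezed_basis_squeeze_symmetric : squeeze_symmetric squeezed_basis.
Proof.
exists upper_space, weak_space; split.
- exact/symmetric_space_of_bounds/upper_bounds_invariant.
- exact/symmetric_space_of_bounds/weak_bounds_invariant.
- have /choice[T hT] a : exists l, bound_car upper_bounds a -> rlim (partial a) l.
    have [/partial_cvg[l hl]|na] := pselect (bound_car upper_bounds a); first by exists l.
    by exists 0.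
  exists T; split; [split|].
  + move=> c a a' ca ca'; have cl := bound_car_lin upper_bounds_norm c ca ca'.
    apply: rlim_unique (hT _ cl) _.
    have := rlim_lin c (hT _ ca) (hT _ ca').
    rewrite (_ : (fun n => _) = partial (c *: a + a')) //.
    by apply/funext => n; rewrite partial_lin.
  + exists 1 => a ca; have [[M hM] _] := ca; rewrite mul1r.
    apply: rlim_bound (hT _ ca) _ => n; apply: partial_bound.
    exact (bound_norm_attained upper_bounds_norm hM).
  + by move=> a ca; apply/cvg_rnorm; exact: hT.
- split=> [f|]; last first.
    exists CL => f; apply: (bound_norm_le weak_bounds_norm); exact: weak_bounds_coeffs.
  split; first by exists (CL * rnorm f); exact: weak_bounds_coeffs.
  move=> e e0; have /closure_rnorm := @b_dense f.
  move=> /(_ (e / (CL + 1)))[|g sg fg_lt]; first by rewrite divr_gt0 // ltr_wpDl.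
  exists (fun n => bs n g).
    apply/c00P; apply: (sg [set g | exists N, forall n, (N <= n)%N -> bs n g = 0]).
      split; first by exists 0%N => n _; have [K bK] := fb n; exact: bfunc0v bK.
      move=> c x y [N hN] [M hM]; exists (maxn N M) => n.
      rewrite geq_max => /andP[/hN h1 /hM h2]; have [K [l _]] := fb n.
      by rewrite l h1 h2 mulr0 addr0.
    by move=> j; exists j.+1 => n jn; rewrite bb gtn_eqF.
  have -> : coeffs squeezed_basis f - (fun n => bs n g : F^o) = fun n => bs n (f - g).
    apply/funext => n; have [K bK] := fb n; rewrite (bfuncB _ _ bK).
    by [].
  apply: (nb_le weak_bounds_norm) (weak_bounds_coeffs (f - g)) _.
  apply: le_trans (ler_wpM2l CL0 (ltW fg_lt)) _.
  rewrite mulrA ler_pdivrMr; last by rewrite ltr_wpDl.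
  by rewrite mulrC mulrDr mulr1 lerDl ltW.
exists (CU + CL + 1); split=> [|m m0]; first by rewrite ltr_wpDl // addr_ge0.
rewrite fundamental_weak // -!EFinM !lee_fin.
have [h1 h2] := fundamental_upper m0; have Lm := Lam_gt0 m0.
have f0 : 0 <= fundamental upper_space m by exact: bound_norm_ge0 upper_bounds_norm _.
have := mulr_ge0 CL0 (ltW Lm); have := mulr_ge0 CU0 f0; split; lra.
Qed.

(** The assumption bounds, for the elements of the unit ball, the sums of the
    coefficients over [s]; for sets with fewer than [m] elements, passing from
    [size s / Lam (size s)] to [m / Lam m] costs the factor 2. *)
Lemma squeezed_basis_bidemocratic (CD : R) : 0 <= CD ->
  (forall (s : seq nat) (f : X), uniq s -> (0 < size s)%N ->
    (\sum_(j <- s) rabs (bs j f)) * Lam (size s) <= CD * (size s)%:R * rnorm f) ->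
  bidemocratic squeezed_basis.
Proof.
move=> CD0 dual; apply: (@le_lt_trans _ _ (2 * CU * CD)%:E); last exact: ltry.
apply: ge_ereal_sup => _ [m /= m0 <-].
have Lm := Lam_gt0 m0; have mR : 0 < m%:R :> R by rewrite ltr0n.
have cardA (A : set nat) : (A #<= `I_m)%card -> exists s : seq nat,
    [/\ uniq s, (size s <= m)%N &
    forall (V : nmodType) (f : nat -> V), \sum_(n \in A) f n = \sum_(n <- s) f n].
  move=> Am; exists (finmap.enum_fset (fset_set A)); split; first exact: finmap.fset_uniq.
    exact: geq_card_fset_set.
  by move=> V f; apply: fsbig_finite; apply: card_le_finite Am _; exact: finite_II.
have small0 : ((@set0 nat) #<= `I_m)%card by exact: card_ge0.
have sum0 (V : nmodType) (f : nat -> V) : \sum_(n \in set0) f n = 0.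
  exact: fsbig_set0.
have phi1 : (phi_basis squeezed_basis m <= (CU * Lam m)%:E)%E.
  apply: ge_ereal_sup => _ [A /= /cardA[s [us sm sE]] <-].
  rewrite lee_fin sE; under eq_bigr => j _ do rewrite -[_ j]scale1r.
  apply: le_trans (b_upper_inj (pi := id) us _ _) _ => // [i _|].
    by rewrite rabs1.
  by rewrite ler_wpM2l // Lam_mono.
have phi1_ge0 : (0 <= phi_basis squeezed_basis m)%E.
  apply: ereal_sup_ubound; exists set0 => //.
  by rewrite sum0 rnorm0.
have phi2 : (phi_dual squeezed_basis m <= (2 * CD * (m%:R / Lam m))%:E)%E.
  apply: ge_ereal_sup => _ [A /= /cardA[s [us sm sE]] <-].
  apply: ge_ereal_sup => _ [f /= f1 <-]; rewrite lee_fin sE fct_sumE.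
  have c0 : 0 <= 2 * CD * (m%:R / Lam m).
    by rewrite !mulr_ge0 // invr_ge0 ltW.
  have [s0|s0] := posnP (size s).
    by rewrite (size0nil s0) big_nil rabs0.
  have Ls := Lam_gt0 s0; have sR : 0 < (size s)%:R :> R by rewrite ltr0n.
  apply: le_trans (_ : \sum_(j <- s) rabs (bs j f) <= _).
    exact: rabs_sum.
  have := dual s f us s0; rewrite -ler_pdivlMr // => h; apply: le_trans h _.
  have sw : (size s)%:R / Lam (size s) <= 2 * (m%:R / Lam m).
    apply: ratio_swap => //; apply: fundamental_growth_quasi => //.
    by rewrite s0.
  apply: le_trans (_ : CD * ((size s)%:R / Lam (size s)) <= _).
    rewrite -!mulrA; apply: ler_wpM2l => //; apply: ler_wpM2l; first exact: ltW.
    by rewrite ler_piMl // invr_ge0 ltW.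
  by rewrite (mulrC 2) -mulrA; apply: ler_wpM2l.
have phi2_ge0 : (0 <= phi_dual squeezed_basis m)%E.
  apply: (@le_trans _ _ (dual_norm (0 : X -> F^o))).
    by apply: ereal_sup_ubound; exists 0; rewrite /= ?rnorm0 ?rabs0.
  by apply: ereal_sup_ubound; exists set0 => //; rewrite sum0.
apply: (@le_trans _ _ ((m%:R : R)^-1%:E * ((CU * Lam m)%:E * (2 * CD * (m%:R / Lam m))%:E))%E).
  apply: lee_pmul; [by rewrite lee_fin invr_ge0 ltW|exact: mule_ge0|exact: lexx|].
  exact: lee_pmul.
rewrite -!EFinM lee_fin le_eqVlt; apply/orP; left; apply/eqP.
by field; rewrite !gt_eqF.
Qed.

Lemma coord_proj_bounded (A : set nat) (f : X) m :
  (forall n, A n -> (m <= n)%N -> bs n f = 0) ->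
  coord_proj squeezed_basis A f = \sum_(0 <= n < m | n \in A) bs n f *: b n.
Proof.
by move=> h; apply: fsbig_bounded => n An mn; rewrite /= h ?scale0r.
Qed.

Let coeff_vanish f m n : closed_span (squeezed_basis @` `I_m) f -> (m <= n)%N -> bs n f = 0.
Proof.
move=> cf mn; have [K bK] := fb n.
apply: (bfunc_closure bK) cf => _ [q [c [u [hu ->]]]].
rewrite (bfunc_sum _ _ _ bK) big1 // => i _; rewrite (bfuncZ _ _ bK).
have [j /= jm <-] := hu i; rewrite /= bb gtn_eqF ?mulr0 //.
exact: leq_trans jm mn.
Qed.

(** Sort the coordinates by size and split them in the middle: those of the
    second half are at most the size [t] of the middle one, so that [b_upper]
    bounds their sum by [t * Lam h.+1], which [b_lower] controls through the
    first half. Hence every halving costs a bounded multiple of the norm. *)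
Let projection_log (f : X) n (s : seq nat) : uniq s -> (size s < 2 ^ n)%N ->
  rnorm (\sum_(i <- s) bs i f *: b i) <= n%:R * (CU * CL * rnorm f).
Proof.
elim: n s => [|n IH] s us ss.
  move: ss; rewrite expn0 ltnS leqn0 => /nilP ->.
  by rewrite big_nil rnorm0 mul0r.
have C0 : 0 <= CU * CL * rnorm f by rewrite !mulr_ge0 // rnorm_ge0.
have [s0|s0] := posnP (size s).
  by rewrite (size0nil s0) big_nil rnorm0 mulr_ge0.
pose le i j := rabs (bs j f) <= rabs (bs i f).
have le_tr : transitive le by move=> i j l h1 h2; exact: le_trans h2 h1.
have le_tot : total le by move=> i j; exact: le_total.
have le_refl : reflexive le by move=> i; exact: lexx.
pose s' := sort le s.
have perm : perm_eq s s' by rewrite perm_sym; exact: permEl (perm_sort _ _).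
have us' : uniq s' by rewrite sort_uniq.
have sz : size s' = size s by rewrite size_sort.
have srt : sorted le s' by exact: sort_sorted.
pose h := (size s)./2.
have hs : (h < size s)%N by rewrite /h -divn2 ltn_Pdiv.
pose t := rabs (bs (nth 0%N s' h) f).
have big i : i \in take h.+1 s' -> t <= rabs (bs i f).
  move=> /(nthP 0%N)[j]; rewrite size_take sz => jh <-.
  have jh1 : (j < h.+1)%N by apply: leq_trans jh _; case: ifP => // /negbT; rewrite -leqNgt.
  rewrite nth_take //; apply: (sorted_leq_nth le_tr le_refl 0%N srt) => //.
    by rewrite inE sz; exact: leq_trans jh1 hs.
  by rewrite inE sz.
have small i : i \in drop h s' -> rabs (bs i f) <= t.
  move=> /(nthP 0%N)[j]; rewrite size_drop sz => jh <-; rewrite nth_drop.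
  apply: (sorted_leq_nth le_tr le_refl 0%N srt); rewrite ?inE ?sz ?leq_addr //.
  by rewrite -ltn_subRL.
have t0 : 0 <= t by exact: rabs_ge0.
have low : t * Lam h.+1 <= CL * rnorm f.
  have := b_lower (s := take h.+1 s') (f := f) (t := t) (take_uniq _ us').
  have -> : size (take h.+1 s') = h.+1.
    by rewrite size_take sz; case: ltnP => // le1; apply/eqP; rewrite eqn_leq hs le1.
  by apply.
have tail : rnorm (\sum_(i <- drop h s') bs i f *: b i) <= CU * CL * rnorm f.
  have [t1|t1] := eqVneq t 0.
    rewrite big_seq big1 ?rnorm0 // => i /small; rewrite t1 => hi.
    have /eqP : rabs (bs i f) = 0 by apply/le_anti; rewrite hi rabs_ge0.
    by rewrite rabs_eq0 => /eqP ->; rewrite scale0r.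
  have tp : 0 < t by rewrite lt0r t1 t0.
  have -> : \sum_(i <- drop h s') bs i f *: b i =
      sc t *: \sum_(i <- drop h s') ((sc t)^-1 * bs i f) *: b i.
    rewrite scaler_sumr; apply: eq_bigr => i _.
    by rewrite scalerA mulrA mulfV ?mul1r // sc_eq0.
  rewrite rnormZ rabs_sc gtr0_norm //.
  apply: le_trans (_ : t * (CU * Lam h.+1) <= _); last first.
    by rewrite mulrCA -mulrA; apply: ler_wpM2l.
  apply: ler_wpM2l => //.
  apply: le_trans (b_upper_inj (pi := id) (drop_uniq _ us') _ _) _ => //.
    move=> i /small hi; rewrite rabsM rabsV rabs_sc gtr0_norm //.
    by rewrite mulrC ler_pdivrMr // mul1r.
  rewrite ler_wpM2l // Lam_mono // size_drop sz leq_subLR addnS addnn.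
  have := odd_double_half (size s); rewrite -/h.
  by case: (odd _) => <-; rewrite ?ltnS // addn0.
rewrite (perm_big _ perm) /= -(cat_take_drop h s') big_cat /=.
apply: le_trans (rnormD _ _) _; rewrite -natr1 mulrDl mul1r; apply: lerD => //.
apply: IH; first exact: take_uniq.
rewrite size_take sz hs -ltn_double -[X in (_ < X)%N]mul2n -expnS.
by apply: leq_ltn_trans ss; rewrite -[leqRHS]odd_double_half leq_addl.
Qed.

Lemma ktilde_upper m : (0 < m)%N ->
  (ktilde squeezed_basis m <= (2 / ln 2 * CU * CL * ln (1 + m%:R))%:E)%E.
Proof.
move=> m0; apply: ge_ereal_sup => _ [f [A [f1 cf ->]]]; rewrite lee_fin.
rewrite (@coord_proj_bounded A f m); last by move=> n _; exact: coeff_vanish.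
rewrite -big_filter; set s := [seq n <- _ | _].
have us : uniq s by exact/filter_uniq/iota_uniq.
have sm : (size s <= m)%N.
  by rewrite size_filter; apply: leq_trans (count_size _ _) _; rewrite size_iota subn0.
pose n := (trunc_log 2 m).+1.
have /andP[b1 b2] := trunc_log_bounds (ltnSn 1) m0.
have ln2 : 0 < ln (2 : R) by rewrite ln_gt0 // ltr1n.
have m1 : 0 < 1 + m%:R :> R by rewrite ltr_wpDr.
have nle : n%:R * ln 2 <= 2 * ln (1 + m%:R : R).
  have h1 : ln 2 <= ln (1 + m%:R : R).
    rewrite ler_ln ?posrE //.
    have : (1 : R) <= m%:R by rewrite ler1n.
    lra.
  have h2 : (trunc_log 2 m)%:R * ln 2 <= ln (1 + m%:R : R).
    rewrite mulr_natl -lnXn // -natrX ler_ln ?posrE ?ltr0n ?expn_gt0 //.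
    have : (2 ^ trunc_log 2 m)%:R <= m%:R :> R by rewrite ler_nat.
    lra.
  by rewrite /n -natr1 mulrDl mul1r; lra.
apply: le_trans (projection_log f us (leq_ltn_trans sm b2)) _.
have : n%:R * (CU * CL * rnorm f) <= n%:R * (CU * CL).
  by apply: ler_wpM2l => //; apply: ler_piMr => //; exact: mulr_ge0.
move=> h; apply: le_trans h _.
have -> : 2 / ln 2 * CU * CL * ln (1 + m%:R) = 2 * ln (1 + m%:R) / ln 2 * (CU * CL) :> R.
  by ring.
by apply: ler_wpM2r; [exact: mulr_ge0|rewrite ler_pdivlMr].
Qed.

Lemma ktilde_ge1 m : (0 < m)%N -> (1 <= ktilde squeezed_basis m)%E.
Proof.
move=> m0; apply: ereal_sup_ubound.
have b0 := b_neq0 0; have [K bK] := fb 0%N.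
exists (sc (rnorm (b 0%N))^-1 *: b 0%N), [set 0%N]; split.
- by rewrite rnormZ rabs_sc gtr0_norm ?invr_gt0 // mulVf ?gt_eqF.
- apply: subset_closure; exists 1%N, (fun=> sc (rnorm (b 0%N))^-1), (fun=> b 0%N).
  by split=> [_|]; [exists 0%N|rewrite big_ord1].
rewrite (@coord_proj_bounded _ _ 1); last by move=> n ->.
rewrite big_mkcond big_nat1 mem_set // (bfuncZ _ _ bK) bb eqxx mulr1.
by rewrite rnormZ rabs_sc gtr0_norm ?invr_gt0 // mulVf ?gt_eqF.
Qed.

(** Vectors of bounded norm with large initial projections. As their coefficients
    are smaller beyond the cut than before it, these projections are also
    greedy. The index of the witness is the logarithm of that growth: it appears
    within the first [r ^ 2 ^ q.+3] vectors, so that [2 ^ q] is of the order of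
    the logarithm of their number. *)
Variables (r : nat) (D : R).
Hypotheses (r1 : (1 < r)%N) (D0 : 0 < D).
Hypothesis witness : forall q, exists (f : X) (M : nat),
  [/\ closed_span (b @` `I_(r ^ 2 ^ q.+3)) f, rnorm f <= D,
      (2 ^ q)%:R <= D * rnorm (\sum_(0 <= j < M) bs j f *: b j)
    & forall i j, bs i f != 0 -> (i < M <= j)%N -> rabs (bs j f) <= rabs (bs i f)].

Lemma ktilde_lower q m : (r ^ 2 ^ q.+3 <= m)%N ->
  ((2 ^ q)%:R%:E <= (D ^+ 2)%:E * ktilde squeezed_basis m)%E.
Proof.
move=> qm; have [f [M [cf fD big _]]] := witness q.
apply: (@le_trans _ _ ((D ^+ 2)%:E *
    (rnorm (sc D^-1 *: \sum_(0 <= j < M) bs j f *: b j))%:E)%E).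
  rewrite -EFinM lee_fin rnormZ rabs_sc gtr0_norm ?invr_gt0 // expr2.
  by rewrite -mulrA [X in D * X]mulrA mulfV ?mul1r // gt_eqF.
apply: lee_pmul => //; first by rewrite lee_fin exprn_ge0 // ltW.
  by rewrite lee_fin rnorm_ge0.
apply: ereal_sup_ubound; exists (sc D^-1 *: f), `I_M; split.
- by rewrite rnormZ rabs_sc gtr0_norm ?invr_gt0 // mulrC ler_pdivrMr ?mul1r.
- have cf' : closed_span (b @` `I_m) f.
    apply: closure_subset cf => _ [n [c [u [hu ->]]]]; exists n, c, u; split=> // i.
    by have [j /= jq <-] := hu i; exists j => //=; exact: leq_trans jq qm.
  exact: (submodZ _ (submod_closure (linear_span_submod _))).
congr (rnorm _)%:E; rewrite (@coord_proj_bounded _ _ M); last first.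
  by move=> n /=; rewrite ltnNge => /negbTE ->.
rewrite scaler_sumr big_nat_cond [RHS]big_nat_cond; apply: eq_big => [j|j _].
  by case: ltnP => //= jM; rewrite mem_set.
by have [K bK] := fb j; rewrite (bfuncZ _ _ bK) scalerA.
Qed.

Lemma squeezed_basis_ktilde :
  approx_seq (ktilde squeezed_basis) (fun m => (ln (1 + m%:R))%:E).
Proof.
have ln2 : 0 < ln (2 : R) by rewrite ln_gt0 // ltr1n.
have lnr : 0 < ln (r%:R : R) by rewrite ln_gt0 // ltr1n.
pose C1 := 2 / ln 2 * CU * CL; pose C2 := (8 + 16 * D ^+ 2) * ln (r%:R : R).
have C10 : 0 <= C1 by rewrite /C1 !mulr_ge0 // invr_ge0 ltW.
have D20 : 0 < D ^+ 2 by rewrite exprn_gt0.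
have C20 : 0 < C2 by rewrite mulr_gt0 // ltr_wpDr // mulr_ge0 // ltW.
exists (C1 + C2); split=> [|m m0]; first by rewrite ltr_wpDl.
have lnm : 0 <= ln (1 + m%:R : R) by rewrite ln_ge0 // lerDl.
have k1 := ktilde_ge1 m0; split.
  apply: le_trans (ktilde_upper m0) _; rewrite -EFinM lee_fin -/C1.
  by apply: ler_wpM2r => //; rewrite lerDl ltW.
apply: (@le_trans _ _ (C2%:E * ktilde squeezed_basis m)%E); last first.
  apply: lee_wpmul2r; first exact: le_trans k1.
  by rewrite lee_fin lerDr.
pose p := trunc_log r m; have /andP[b1 b2] := trunc_log_bounds r1 m0.
have m1 : 0 < 1 + m%:R :> R by rewrite ltr_wpDr.
have rR : 0 < r%:R :> R by rewrite ltr0n ltnW.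
have lnp : ln (1 + m%:R : R) <= p.+1%:R * ln r%:R.
  rewrite [leRHS]mulr_natl -lnXn // -natrX ler_ln ?posrE // ?ltr0n ?expn_gt0 ?(ltnW r1) //.
  by rewrite addrC natr1 ler_nat.
have lep x : (0 <= x)%R -> p.+1%:R <= (8 + 16 * D ^+ 2) * x ->
    (x%:E <= ktilde squeezed_basis m)%E ->
    ((ln (1 + m%:R))%:E <= C2%:E * ktilde squeezed_basis m)%E.
  move=> x0 px xk; apply: (@le_trans _ _ (C2%:E * x%:E)%E); last first.
    by apply: lee_wpmul2l => //; rewrite lee_fin ltW.
  rewrite -EFinM lee_fin; apply: le_trans lnp _.
  by rewrite /C2 mulrAC; apply: ler_wpM2r => //; exact: ltW.
(* the witnesses start at m = r ^ 8; below, the bound 1 suffices *)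
have [p8|p8] := ltnP p 8.
  apply: (lep 1) => //; rewrite mulr1; apply: le_trans (_ : 8%:R <= _).
    by rewrite ler_nat.
  by rewrite lerDl mulr_ge0 // ltW.
have p0 : (0 < p)%N by exact: leq_trans p8.
have /andP[c1 c2] := trunc_log_bounds (ltnSn 1) p0.
have l3 : (3 <= trunc_log 2 p)%N by exact: trunc_log_max.
pose q := (trunc_log 2 p - 3)%N.
have eq_q : q.+3 = trunc_log 2 p by rewrite /q -addn3 subnK.
apply: (lep ((2 ^ q)%:R / D ^+ 2)).
- by rewrite divr_ge0 // ltW.
- apply: le_trans (_ : (16 * 2 ^ q)%:R <= _).
    rewrite ler_nat; apply: leq_trans c2 _.
    by rewrite -eq_q !expnS !mulnA.
  have -> : (8 + 16 * D ^+ 2) * ((2 ^ q)%:R / D ^+ 2) =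
      8 * ((2 ^ q)%:R / D ^+ 2) + 16 * (2 ^ q)%:R.
    by field; rewrite gt_eqF.
  by rewrite natrM lerDr mulr_ge0 // divr_ge0 // ltW.
have := @ktilde_lower q m; rewrite eq_q => /(_ (leq_trans (leq_pexp2l (ltnW r1) c1) b1)).
rewrite -lee_pdivrMl //; first by rewrite -EFinM mulrC.
Qed.

(** Vanishing coefficients before the cut have to be removed from the initial
    segment to obtain a greedy set; the projection does not notice. *)
Lemma squeezed_basis_not_quasi_greedy : ~ quasi_greedy squeezed_basis.
Proof.
move=> [C hC].
have [n hn] : exists n : nat, D * (`|C| * D) < n%:R.
  exists (Num.bound (D * (`|C| * D))); apply: archi_boundP.
  by rewrite !mulr_ge0 // ltW.
have [f [M [_ fD big gr]]] := witness n.
pose A := [set i | (i < M)%N /\ bs i f != 0].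
have gA : greedy_set squeezed_basis f A.
  split.
    apply: sub_finite_set (finite_II M) => i [] //.
  move=> i j [iM fi] nAj; rewrite rabs_le.
  have [fj|fj] := eqVneq (bs j f) 0; first by rewrite /= fj rabs0 rabs_ge0.
  have [jM|Mj] := ltnP j M; first by case: nAj.
  by apply: gr => //; rewrite iM.
have := hC f A gA; rewrite (@coord_proj_bounded _ _ M); last first.
  by move=> i [iM _]; rewrite leqNgt iM.
rewrite (_ : \sum_(0 <= i < M | i \in A) _ = \sum_(0 <= j < M) bs j f *: b j); last first.
  rewrite [RHS](bigID (mem A)) /= [X in _ + X]big_nat_cond [X in _ + X]big1 ?addr0 //.
  move=> i /andP[iM]; have [->|fi] := eqVneq (bs i f) 0; first by rewrite scale0r.
  by rewrite mem_set.
move=> h.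
have : rnorm (\sum_(0 <= j < M) bs j f *: b j) <= `|C| * D.
  apply: le_trans h _; apply: le_trans (ler_wpM2r (rnorm_ge0 _) (ler_norm _)) _.
  exact: ler_wpM2l.
move=> /(ler_wpM2l (ltW D0))/(le_trans big)/le_lt_trans/(_ hn).
by rewrite ltr_nat ltnNge ltnW // ltn_expl.
Qed.

End SqueezedBasis.

(** * Distribution of exceptional vectors over rows *)

Lemma countable_bijection (T : countType) :
  infinite_set [set: T] -> exists f : T -> nat, bijective f.
Proof.
move=> /(eq_card_nat (countableP _))/card_set_bijP[f].
by rewrite setTT_bijective => bf; exists f.
Qed.

Section RowDecomposition.
Context {R : realType} {k : scalar_kind}.
Local Notation F := (scalar_field R k).
Variable X : normedModType F.

Lemma bidemocratic_family_comp (P : pred nat) (g : nat -> nat) (w : nat -> X)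
    (ws : nat -> X -> F) (u : nat -> X) (us : nat -> X -> F) Lam C :
  (forall i j, P i -> P j -> g i = g j -> i = j) ->
  (forall i, P i -> u i = w (g i) /\ us i = ws (g i)) ->
  bidemocratic_family predT w ws Lam C -> bidemocratic_family P u us Lam C.
Proof.
move=> ig uE [W1 W3].
have inj (s : seq nat) : all P s -> {in s &, injective g}.
  by move=> /allP Ps i j /Ps Pi /Ps Pj; exact: ig.
split=> [s c us_ Ps hc|s x us_ Ps].
  have [c' hc' sumE] := @reindex_coeffs _ _ X s c g (inj s Ps) (fun i _ => hc i).
  have -> : \sum_(i <- s) c i *: u i = \sum_(i <- s) c i *: w (g i).
    by apply: eq_big_seq => i is_; have [-> _] := uE i (allP Ps i is_).
  rewrite sumE -(size_map g); apply: W1 => //; last exact: all_predT.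
  by rewrite map_inj_in_uniq //; exact: inj.
have -> : \sum_(i <- s) rabs (us i x) = \sum_(j <- map g s) rabs (ws j x).
  rewrite big_map big_seq [RHS]big_seq; apply: eq_bigr => i is_.
  by have [_ ->] := uE i (allP Ps i is_).
rewrite -(size_map g); apply: W3; last exact: all_predT.
by rewrite map_inj_in_uniq //; exact: inj.
Qed.

Variables (w : nat -> X) (ws : nat -> X -> F) (z : nat -> X) (zs : nat -> X -> F).
Variables (alive : nat -> bool) (Lam : nat -> R) (C : R).
Hypotheses (fg : fundamental_growth Lam) (C0 : 0 <= C).
Hypotheses (bw : biorthogonal w ws) (fw : bounded_functionals ws).
Hypothesis dw : bidemocratic_family predT w ws Lam C.
Hypothesis fz : bounded_functionals zs.
Hypothesis bz : forall i j, zs i (z j) = (alive i && (i == j))%:R.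
Hypothesis z_dead : forall i, ~~ alive i -> z i = 0 /\ forall x, zs i x = 0.
Hypotheses (zs_w : forall i j, zs i (w j) = 0) (ws_z : forall i j, ws i (z j) = 0).
Hypothesis wz_dense : forall E : set X, submod E -> (forall j, E (w j)) ->
  (forall i, E (z i)) -> forall f, closure E f.
Hypothesis wz_total : forall f, (forall j, ws j f = 0) -> (forall i, zs i f = 0) -> f = 0.

(** Every exceptional vector [z i] is placed in a row of its own, together with
    infinitely many of the vectors [w j], and [conditional_row] applies to each
    row because its exceptional vector occupies the free position. One more
    infinite family of vectors [w j] is kept apart for the blocks. *)
Lemma row_decomposition :
  exists (w0 : nat -> X) (w0s : nat -> X -> F) (Y : nat * nat -> X) (Ys : nat * nat -> X -> F),
  let B := row_bound (Lam 1%N) C in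
  [/\ [/\ biorthogonal w0 w0s, bounded_functionals w0s &
          bidemocratic_family predT w0 w0s Lam C],
      [/\ biorthogonal Y Ys, forall p j, Ys p (w0 j) = 0, forall p j, w0s j (Y p) = 0 &
          forall p, rnorm (Y p) <= B /\ bfunc B (Ys p)],
      forall E : set X, submod E -> (forall j, E (w0 j)) -> (forall p, E (Y p)) ->
          forall f, closure E f,
      forall f, (forall j, w0s j f = 0) -> (forall p, Ys p f = 0) -> f = 0 &
      forall i, rnorm (\sum_(0 <= t < 2 ^ i) Y (i, t)) <= B /\
          ((2 ^ i)./2)%:R <= B * rnorm (\sum_(0 <= t < (2 ^ i)./2) Y (i, t))].
Proof.
have [th [th' thK th'K]] := countable_bijection infinite_prod_nat.
have ith := can_inj thK.
(* z i takes the position 2 ^ i of its row, and slot renumbers the others; if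
   i is dead the whole row consists of vectors w j *)
pose slot i t := if alive i then (t - (2 ^ i < t))%N else t.
pose code (i t : nat) : nat + nat :=
  if alive i && (t == 2 ^ i)%N then inl i else inr (th (i.+1, slot i t)).
have slot_inj i t s : code i t = inr (th (i.+1, slot i t)) ->
    code i s = inr (th (i.+1, slot i s)) -> slot i t = slot i s -> t = s.
  rewrite /code /slot; case: (alive i) => //=.
  case: eqP => // tn _; case: eqP => // sn _.
  by case: ltnP; case: ltnP; lia.
have code_inj i t j s : code i t = code j s -> i = j /\ t = s.
  move=> e; have [ij|ij] := eqVneq i j.
    subst j; split=> //; move: (slot_inj i t s) e; rewrite /code.
    case: ifP => [/andP[_ /eqP ->]|_]; case: ifP => [/andP[_ /eqP ->]|_] //.
    by move=> h []/ith[] e; exact: h.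
  move: e; rewrite /code; case: ifP => _; case: ifP => _ //.
    by case=> e; rewrite e eqxx in ij.
  by case=> /ith[e _]; rewrite e eqxx in ij.
pose v (c : nat + nat) := match c with inl i => z i | inr j => w j end.
pose vs (c : nat + nat) := match c with inl i => zs i | inr j => ws j end.
pose live (c : nat + nat) := if c is inl i then alive i else true.
have code_onto i t : exists s, code i s = inr (th (i.+1, t)).
  rewrite /code /slot; case: (alive i) => /=; last by exists t.
  exists (t + (2 ^ i <= t))%N; case: (leqP (2 ^ i) t) => h.
    by rewrite addn1 gtn_eqF ?ltnS // h subn1.
  by rewrite addn0 ltn_eqF // (leq_gtF (ltnW h)) subn0.
have bv c c' : live c -> vs c (v c') = (c == c')%:R.
  case: c c' => [i|i] [j|j] /= li.
  - by rewrite bz li.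
  - by rewrite zs_w.
  - by rewrite ws_z.
  - by rewrite bw.
have fv : bounded_functionals vs by case=> i; [exact: fz|exact: fw].
have live_code i t : live (code i t) by rewrite /code; case: ifP => [/andP[]|].
have brow i j t s : vs (code i t) (v (code j s)) = ((i == j) && (t == s))%:R.
  rewrite bv //; congr (nat_of_bool _)%:R; apply/eqP/andP => [/code_inj[-> ->]//|].
  by case=> /eqP -> /eqP ->.
have live_w0 j : vs (inr (th (0%N, j))) = ws (th (0%N, j)) by [].
have code0 i t j : code i t != inr (th (0%N, j)).
  by rewrite /code; case: ifP => // _; apply/eqP => -[/ith].
pose u i t := v (code i t); pose us i t := vs (code i t).
have n0 i : (0 < 2 ^ i)%N by rewrite expn_gt0.
have row i : exists p : (nat -> X) * (nat -> X -> F), let B := row_bound (Lam 1%N) C in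
  [/\ biorthogonal p.1 p.2, same_system (u i) (us i) p.1 p.2,
      forall t, rnorm (p.1 t) <= B /\ bfunc B (p.2 t),
      rnorm (\sum_(0 <= t < 2 ^ i) p.1 t) <= B
    & ((2 ^ i)./2)%:R <= B * rnorm (\sum_(0 <= t < (2 ^ i)./2) p.1 t)].
  have [|||y [ys hy]] := @conditional_row _ _ X (u i) (us i) Lam C (2 ^ i) fg C0 (n0 i).
  - by move=> t s; rewrite /us /u brow eqxx.
  - by move=> t; exact: fv.
  - have nc t : t != (2 ^ i)%N -> code i t = inr (th (i.+1, slot i t)).
      by move=> /negbTE ti; rewrite /code ti andbF.
    apply: (@bidemocratic_family_comp _ (fun t => th (i.+1, slot i t))) dw.
      by move=> t s /nc ht /nc hs /ith[]; exact: slot_inj.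
    by move=> t /nc ti; rewrite /u /us ti.
  by exists (y, ys).
have {row}/choice[y hy] := row.
have yu i t : spn (u i) ((y i).1 t) by have [_ [_ h _] _ _ _] := hy i; exact: h.
have uy i t : spn (y i).1 (u i t) by have [_ [h _ _] _ _ _] := hy i; exact: h.
have ann i x : (forall t, us i t x = 0) <-> (forall t, (y i).2 t x = 0).
  by have [_ [_ _ h] _ _ _] := hy i; exact: h.
exists (fun j => w (th (0%N, j))), (fun j => ws (th (0%N, j))),
  (fun p => (y p.1).1 p.2), (fun p => (y p.1).2 p.2); split.
- split=> [i j|i|]; first 2 [exact: fw] || idtac.
    by rewrite bw (inj_eq ith) xpair_eqE.
  apply: (@bidemocratic_family_comp _ (fun t => th (0%N, t))) dw => //.
  by move=> i j _ _ /ith[].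
- have kill (phi : X -> F) i t : (exists K, bfunc K phi) ->
      (forall s, phi (u i s) = 0) -> phi ((y i).1 t) = 0.
    by move=> [K bK] h; exact: (yu i t _ (submod_ker bK) h).
  split.
  + move=> [i t] [j s] /=; rewrite xpair_eqE; have [->|ij] := eqVneq i j.
      by have [-> _ _ _ _] := hy j.
    move: t; apply/ann => t; apply: kill; first exact: fv.
    by move=> s'; rewrite /us /u brow (negbTE ij).
  + move=> [i t] j /=; move: t; apply/ann => t.
    by rewrite /us -[w _]/(v (inr _)) bv // (negbTE (code0 _ _ _)).
  + move=> [i t] j /=; apply: kill; first exact: fw.
    by move=> s; rewrite -live_w0 /u bv // eq_sym (negbTE (code0 _ _ _)).
  + by move=> [i t] /=; have [_ _ h _ _] := hy i; exact: h.
- move=> E sE Ew EY; apply: wz_dense => // [j|i].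
    have Eu i t : E (u i t) by apply: (uy i t) => // s; exact: (EY (i, s)).
    rewrite -(th'K j); case: (th' j) => -[|i] t; first exact: Ew.
    have [s e] := code_onto i t.
    by have := Eu i s; rewrite /u e.
  have Eu t : E (u i t) by apply: (uy i t) => // s; exact: (EY (i, s)).
  have [ai|/z_dead[-> _]] := boolP (alive i); last by case: sE.
  by have := Eu (2 ^ i)%N; rewrite /u /code ai eqxx.
- move=> f h0 hY; apply: wz_total => [j|i].
    have hu i : forall t, us i t f = 0 by apply/ann => t; exact: (hY (i, t)).
    rewrite -(th'K j); case: (th' j) => -[|i] t; first exact: h0.
    have [s e] := code_onto i t.
    by have := hu i s; rewrite /us e.
  have hu : forall t, us i t f = 0 by apply/ann => t; exact: (hY (i, t)).
  have [ai|/z_dead[_ ->//]] := boolP (alive i).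
  by have := hu (2 ^ i)%N; rewrite /us /code ai eqxx.
- by move=> i; have [_ _ _ h1 h2] := hy i.
Qed.

End RowDecomposition.

(** * The basis of a decomposed space *)

(** The beginnings of the rows fill the even positions without gaps, so that the
    row [i] lies before position [4 * 2 ^ i]. As the blocks are exponentially
    long, the vectors needed for a row of length [2 ^ i] are exponentially many,
    but not more: this is where the logarithm comes from. The odd positions
    accommodate everything else. *)
Lemma interleaving_enumeration : exists Phi : nat -> nat + nat * nat,
  bijective Phi /\
  forall i t, (t < 2 ^ i)%N -> Phi (2 * ((2 ^ i).-1 + t))%N = inr (i, t).
Proof.
have infT : infinite_set [set: nat + nat * nat].
  move=> fin; apply: infinite_nat.
  apply: (@sub_finite_set _ _ (inl @^-1` [set: nat + nat * nat])) => //.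
  by apply: finite_preimage fin => i j _ _ [].
have [psi' [psi psi'K psiK]] := countable_bijection infT.
pose K j := trunc_log 2 j.+1.
have KP j : (2 ^ K j <= j.+1 < 2 ^ (K j).+1)%N by exact: trunc_log_bounds.
have KE i t : (t < 2 ^ i)%N -> K ((2 ^ i).-1 + t)%N = i.
  move=> ti; apply: trunc_log_eq => //; rewrite -addSn prednK ?expn_gt0 //.
  by rewrite leq_addr expnS mul2n -addnn ltn_add2l.
pose Phi j : nat + nat * nat := if odd j then
    match psi j./2 with inl n => inl n | inr p => inr (p.1, 2 ^ p.1 + p.2)%N end
  else inr (K j./2, j./2.+1 - 2 ^ K j./2)%N.
have Phi_odd i : Phi i.*2.+1 =
    match psi i with inl n => inl n | inr p => inr (p.1, 2 ^ p.1 + p.2)%N end.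
  by rewrite /Phi /= odd_double /= uphalf_double.
have Phi_even i : Phi i.*2 = inr (K i, i.+1 - 2 ^ K i)%N.
  by rewrite /Phi odd_double doubleK.
have lt_even i : (i.+1 - 2 ^ K i < 2 ^ K i)%N.
  have /andP[h1 h2] := KP i; rewrite ltn_subLR //.
  by rewrite addnn -mul2n -expnS.
exists Phi; split; last first.
  move=> i t ti; rewrite mul2n Phi_even KE //.
  by rewrite -addSn prednK ?expn_gt0 // addKn.
have inj : injective Phi.
  move=> i j; rewrite -(odd_double_half i) -(odd_double_half j).
  case: (odd i); case: (odd j); rewrite ?add1n ?add0n ?Phi_odd ?Phi_even.
  - move=> e; suff -> : i./2 = j./2 by [].
    apply: (can_inj psiK); move: e; case: (psi _) => [n|[n t]]; case: (psi _) => [m|[m s]] //=.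
    by case=> -> /addnI ->.
  - case: (psi _) => [n|[n t]] //= [nK e].
    by have := lt_even j./2; rewrite -e -nK ltnNge leq_addr.
  - case: (psi _) => [n|[n t]] //= [nK e].
    by have := lt_even i./2; rewrite e nK ltnNge leq_addr.
  - case=> eK e; congr (_.*2); apply: succn_inj.
    have /andP[h1 _] := KP i./2; have /andP[h2 _] := KP j./2.
    by rewrite -(subnK h1) -(subnK h2) e eK.
have /choice[g gK] c : exists j, Phi j = c.
  case: c => [n|[i t]].
    by exists (psi' (inl n)).*2.+1; rewrite Phi_odd psi'K.
  have [ti|it] := ltnP t (2 ^ i).
    exists ((2 ^ i).-1 + t).*2; rewrite Phi_even KE //.
    by rewrite -addSn prednK ?expn_gt0 // addKn.
  by exists (psi' (inr (i, t - 2 ^ i)%N)).*2.+1; rewrite Phi_odd psi'K /= subnKC.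
by exists g => // j; apply: inj; rewrite gK.
Qed.

Lemma row_position_lt m t : (t < m)%N -> (2 * (m.-1 + t) < 4 * m)%N.
Proof. by lia. Qed.

Lemma row_position_inj m : injective (fun t => 2 * (m.-1 + t))%N.
Proof. by move=> t s /eqP; rewrite eqn_mul2l eqn_add2l => /eqP. Qed.

Section Assembly.
Context {R : realType} {k : scalar_kind}.
Local Notation F := (scalar_field R k).
Variable X : completeNormedModType F.
Variables (r : nat) (Lam : nat -> R) (C B : R).
Variables (w : nat -> X) (ws : nat -> X -> F) (Y : nat * nat -> X) (Ys : nat * nat -> X -> F).
Hypotheses (r1 : (1 < r)%N) (fg : fundamental_growth Lam) (C0 : 0 <= C) (B0 : 0 < B).
Hypotheses (bw : biorthogonal w ws) (fw : bounded_functionals ws).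
Hypothesis dw : bidemocratic_family predT w ws Lam C.
Hypothesis bY : biorthogonal Y Ys.
Hypotheses (Ys_w : forall p j, Ys p (w j) = 0) (ws_Y : forall p j, ws j (Y p) = 0).
Hypothesis Y_bound : forall p, rnorm (Y p) <= B /\ bfunc B (Ys p).
Hypothesis wY_dense : forall E : set X, submod E -> (forall j, E (w j)) ->
  (forall p, E (Y p)) -> forall f, closure E f.
Hypothesis wY_total : forall f, (forall j, ws j f = 0) -> (forall p, Ys p f = 0) -> f = 0.
Hypothesis Y_row : forall i, rnorm (\sum_(0 <= t < 2 ^ i) Y (i, t)) <= B /\
  ((2 ^ i)./2)%:R <= B * rnorm (\sum_(0 <= t < (2 ^ i)./2) Y (i, t)).
Hypothesis lower_regular : forall m, (0 < m)%N -> 2 * Lam m <= Lam (r * m)%N.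
Variable Phi : nat -> nat + nat * nat.
Hypothesis Phi_bij : bijective Phi.
Hypothesis Phi_row : forall i t, (t < 2 ^ i)%N ->
  Phi (2 * ((2 ^ i).-1 + t))%N = inr (i, t).

Local Notation N n := (block_length r n).
Local Notation L n := (Lam (block_length r n)).
Local Notation om n := (\sum_(j <- block r n) w j).
Local Notation oms n f := (\sum_(j <- block r n) ws j f).

Let Lpos n : 0 < L n.
Proof. by apply: fundamental_growth_gt0 => //; exact: block_length_gt0. Qed.
Let Npos n : 0 < (N n)%:R :> R.
Proof. by rewrite ltr0n block_length_gt0. Qed.
Let NF0 n : (N n)%:R != 0 :> F.
Proof. by rewrite pnatr_eq0 -lt0n block_length_gt0. Qed.
Let LF0 n : sc (L n) != 0 :> F.
Proof. by rewrite sc_eq0 gt_eqF. Qed.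

(** The normalised block sums of [w] belong to the system [x] too: the
    construction removes the means of the blocks from the span of [w], and in
    this way they return. *)
Let vec (c : nat + nat * nat) : X :=
  match c with inl n => (sc (L n))^-1 *: om n | inr p => Y p end.
Let fun_ (c : nat + nat * nat) : X -> F :=
  match c with inl n => fun f => sc (L n / (N n)%:R) * oms n f | inr p => Ys p end.

Let B' : R := B + C + 1.

Let B_le : B <= B'.
Proof. by rewrite /B' -addrA lerDl addr_ge0. Qed.
Let C_le : C <= B'.
Proof. by rewrite /B' addrAC lerDr addr_ge0 // ltW. Qed.
Let one_le : 1 <= B'.
Proof. by rewrite /B' lerDr addr_ge0 // ltW. Qed.

Let vec_bound c : rnorm (vec c) <= B'.
Proof.
case: c => [n|p] /=; last exact: le_trans (Y_bound p).1 B_le.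
rewrite rnormZ rabsV rabs_sc gtr0_norm // mulrC ler_pdivrMr //.
apply: le_trans (_ : L n <= _); last by apply: ler_peMl => //; exact: ltW.
have := bidemocratic_sum_le dw (block_uniq r n) (all_predT _).
by rewrite size_block.
Qed.

Let fun_bound c : bfunc B' (fun_ c).
Proof.
case: c => [n|p] /=; last first.
  exact: bfunc_le (Y_bound p).2 B_le.
split=> [a f g|f].
  have lin j : ws j (a *: f + g) = a * ws j f + ws j g by have [K [l _]] := fw j.
  under eq_bigr => j _ do rewrite lin.
  by rewrite big_split /= -mulr_sumr mulrDr mulrCA.
rewrite rabsM rabs_sc gtr0_norm ?divr_gt0 //.
have := bidemocratic_sumf_le (s := block r n) dw f; rewrite size_block.
move=> /(_ (ltW (Lpos n)) (block_uniq _ _) (all_predT _)) h.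
rewrite mulrAC ler_pdivrMr // mulrC; apply: le_trans h _.
rewrite mulrAC; apply: ler_wpM2r => //; apply: ler_wpM2r; first exact: rnorm_ge0.
exact: C_le.
Qed.

Let om_block n m : oms n (om m) = (n == m)%:R * (N n)%:R.
Proof.
under eq_bigr => j _ do rewrite (biorth_sum bw fw (block_uniq _ _)) mem_block //.
rewrite big_seq (eq_bigr (fun=> (n == m)%:R)); last first.
  by move=> j; rewrite mem_block // => /eqP ->.
by rewrite -big_seq sumr_const_seq size_block mulr_natr.
Qed.

Let omsZ n c f : oms n (c *: f) = c * oms n f.
Proof.
rewrite mulr_sumr; apply: eq_bigr => j _.
by have [K b] := fw j; rewrite (bfuncZ _ _ b).
Qed.

Let Ys_om p n : Ys p (om n) = 0.
Proof.
by rewrite (bfunc_sum _ _ _ (Y_bound p).2) big1 // => j _; rewrite Ys_w.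
Qed.

Let vec_biorth c c' : fun_ c (vec c') = (c == c')%:R.
Proof.
case: c c' => [n|p] [m|q] /=.
- rewrite omsZ om_block.
  have -> : (inl n == inl m :> nat + nat * nat) = (n == m) by [].
  case: eqP => [->|_]; last by rewrite mul0r !mulr0.
  rewrite mul1r scM scV sc_nat mulrCA !mulrA mulVf // mul1r mulVf //.
- by rewrite big1 ?mulr0 // => j _; rewrite ws_Y.
- by rewrite (bfuncZ _ _ (Y_bound p).2) Ys_om mulr0.
- by rewrite bY.
Qed.

Let x n := vec (Phi n).
Let xs n := fun_ (Phi n).

Let x_bound n : rnorm (x n) <= B'.
Proof. exact: vec_bound. Qed.
Let xs_bound n : bfunc B' (xs n).
Proof. exact: fun_bound. Qed.

Let bx : biorthogonal x xs.
Proof.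
by move=> i j; rewrite /xs /x vec_biorth (inj_eq (bij_inj Phi_bij)).
Qed.

Let xs_w m j : xs m (w j) = (N (block_of r j))%:R^-1 * xs m (om (block_of r j)).
Proof.
rewrite /xs; case: (Phi m) => [n|p] /=; last by rewrite Ys_w Ys_om mulr0.
rewrite om_block (biorth_sumf1 bw (block_uniq _ _)) mem_block // eq_sym.
case: eqP => [->|_]; last by rewrite mul0r !mulr0.
by rewrite mul1r mulr1 mulrCA mulVf // mulr1.
Qed.

Let ws_x m j : ws j (x m) = (N (block_of r j))%:R^-1 * oms (block_of r j) (x m).
Proof.
rewrite /x; case: (Phi m) => [n|p] /=; last first.
  by rewrite ws_Y big1 ?mulr0 // => i _; rewrite ws_Y.
have [K b] := fw j; rewrite omsZ om_block (bfuncZ _ _ b).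
rewrite (biorth_sum bw fw (block_uniq _ _)) mem_block //.
case: eqP => [->|_]; last by rewrite mul0r !mulr0.
by rewrite mul1r mulr1 mulrCA mulVf // mulr1.
Qed.

Let Phi_surj c : exists m, Phi m = c.
Proof. by have [g _ gK] := Phi_bij; exists (g c). Qed.

Let om_x n : spn x (om n).
Proof.
have [m hm] := Phi_surj (inl n).
have -> : om n = sc (L n) *: x m by rewrite /x hm /= scalerA divff // scale1r.
by apply: (submodZ _ (spn_submod x)); exact: spn_in.
Qed.

Let oms_xs f : (forall m, xs m f = 0) -> forall n, oms n f = 0.
Proof.
move=> h n; have [m hm] := Phi_surj (inl n).
have := h m; rewrite /xs hm /= => /eqP.
rewrite mulf_eq0 sc_eq0 gt_eqF ?divr_gt0 //= => /eqP //.
Qed.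

Let wx_dense (E : set X) : submod E -> (forall j, E (w j)) ->
  (forall n, E (x n)) -> forall f, closure E f.
Proof.
move=> sE Ew Ex; apply: wY_dense => // p.
by have [m hm] := Phi_surj (inr p); have := Ex m; rewrite /x hm.
Qed.

Let wx_total f : (forall j, ws j f = 0) -> (forall n, xs n f = 0) -> f = 0.
Proof.
move=> h hx; apply: wY_total => // p.
by have [m hm] := Phi_surj (inr p); have := hx m; rewrite /xs hm.
Qed.

Let B'0 : 0 <= B'. Proof. exact: le_trans one_le. Qed.

Let b := dkk_vec r Lam w x.
Let bs := dkk_fun r Lam ws xs.

Let bb : biorthogonal b bs.
Proof. exact: (dkk_biorth r1 fg bw fw dw bx xs_bound xs_w ws_x). Qed.

Let b_block m : \sum_(j <- block r m) b j = sc (L m) *: x m.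
Proof. exact: dkk_block_sum. Qed.

Let bs_x i m : bs i (x m) = (block_of r i == m)%:R * sc (L m)^-1.
Proof. exact: (dkk_fun_x Lam bx ws_x). Qed.

Let bs_sum_x i (ms : seq nat) : uniq ms ->
  bs i (\sum_(m <- ms) x m) = (block_of r i \in ms)%:R * sc (L (block_of r i))^-1.
Proof.
move=> ums; have [K bK] : exists K, bfunc K (bs i) := dkk_fun_bfunc r1 fg fw dw xs_bound i.
rewrite (bfunc_sum _ _ _ bK); under eq_bigr => m _ do rewrite bs_x.
case: (boolP (_ \in ms)) => hi; last first.
  rewrite mul0r big_seq big1 // => m mms; case: eqP => [e|_]; last by rewrite mul0r.
  by rewrite e mms in hi.
rewrite (bigD1_seq (block_of r i)) //= eqxx big1 ?addr0 // => m /negbTE.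
by rewrite eq_sym => ->; rewrite mul0r.
Qed.

Let proj_sum_x q (ms : seq nat) : uniq ms ->
  \sum_(0 <= j < (r ^ q).-1) bs j (\sum_(m <- ms) x m) *: b j =
  \sum_(m <- ms | (m < q)%N) x m.
Proof.
move=> ums; under eq_bigr => j _ do rewrite bs_sum_x //.
have step n : \sum_((r ^ n).-1 <= j < (r ^ n.+1).-1)
    ((block_of r j \in ms)%:R * sc (L (block_of r j))^-1) *: b j =
    (n \in ms)%:R *: x n.
  rewrite -(block_end r1) /index_iota addKn -/(block r n).
  rewrite big_seq (eq_bigr (fun j => ((n \in ms)%:R * sc (L n)^-1) *: b j)); last first.
    by move=> j; rewrite mem_block // => /eqP ->.
  by rewrite -big_seq -scaler_sumr b_block scalerA -mulrA -scM mulVf ?gt_eqF // sc1 mulr1.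
elim: q => [|q IH].
  by rewrite expn0 big_geq // big_pred0 // => m; rewrite ltn0.
rewrite (@big_cat_nat _ _ _ (r ^ q).-1) //=; last by rewrite -(block_end r1) leq_addr.
rewrite IH step (bigID (fun m => (m < q)%N) (fun m => (m < q.+1)%N)) /=; congr (_ + _).
  by apply: eq_bigl => m; rewrite andbC; case: ltnP => //= /ltnW; rewrite ltnS.
rewrite (eq_bigl (pred1 q)); last first.
  by move=> m /=; rewrite -leqNgt ltnS -eqn_leq.
rewrite -big_filter; case: (boolP (q \in ms)) => hq.
  by rewrite (filter_pred1_uniq ums hq) big_seq1 scale1r.
rewrite scale0r big_filter big_seq_cond big1 // => m /andP[mms /eqP e].
by rewrite e (negbTE hq) in mms.
Qed.

(** The sum of a row in the system [x]; its coefficients on the [m]-th block are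
    [(L m)^-1], which decrease in [m], and cutting the sum after half of its
    blocks makes it large. *)
Lemma assembled_witness q : exists (f : X) (M : nat),
  [/\ closed_span (b @` `I_(r ^ 2 ^ q.+3)) f, rnorm f <= B,
      (2 ^ q)%:R <= B * rnorm (\sum_(0 <= j < M) bs j f *: b j)
    & forall i j, bs i f != 0 -> (i < M <= j)%N -> rabs (bs j f) <= rabs (bs i f)].
Proof.
pose n := (2 ^ q.+1)%N; have n0 : (0 < n)%N by rewrite expn_gt0.
pose pos t := (2 * (n.-1 + t))%N.
have pos_inj : injective pos := @row_position_inj n.
pose ms := map pos (iota 0 n).
have ums : uniq ms by rewrite map_inj_uniq // iota_uniq.
have xpos t : (t < n)%N -> x (pos t) = Y (q.+1, t) by move=> tn; rewrite /x Phi_row.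
have n2 : n./2 = (2 ^ q)%N by rewrite /n expnS mul2n doubleK.
have fE : \sum_(m <- ms) x m = \sum_(0 <= t < n) Y (q.+1, t).
  rewrite big_map /index_iota subn0 big_seq [RHS]big_seq.
  by apply: eq_bigr => t; rewrite mem_iota => /= tn; exact: xpos.
have [row1 row2] := Y_row q.+1; rewrite -/n in row1 row2.
exists (\sum_(m <- ms) x m), (r ^ pos (2 ^ q)%N).-1; split.
- apply: subset_closure; rewrite big_map.
  have sl : spn (fun j : 'I_(r ^ 2 ^ q.+3) => b j) (\sum_(t <- iota 0 n) x (pos t)).
    apply: (submod_sum_seq (spn_submod _)) => t; rewrite mem_iota add0n => /= tn.
    have -> : x (pos t) = (sc (L (pos t)))^-1 *: \sum_(j <- block r (pos t)) b j.
      by rewrite b_block scalerA mulVf // scale1r.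
    apply: (submodZ _ (spn_submod _)); apply: (submod_sum_seq (spn_submod _)) => j.
    rewrite mem_iota block_end // => /andP[_ jr].
    have jlt : (j < r ^ 2 ^ q.+3)%N.
      apply: leq_trans jr _; apply: leq_trans (leq_pred _) _.
      rewrite leq_exp2l //.
      have -> : (2 ^ q.+3 = 4 * n)%N by rewrite /n !expnS !mulnA.
      exact: row_position_lt.
    exact: (spn_in (fun j : 'I_(r ^ 2 ^ q.+3) => b j) (Ordinal jlt)).
  have /spn_linear_span[n' [c [u [hu ->]]]] := sl; exists n', c, u; split=> // i.
  by have [j _ <-] := hu i; exists (j : nat) => /=.
- by rewrite fE.
- rewrite proj_sum_x // big_map.
  have -> : \sum_(t <- iota 0 n | (pos t < pos (2 ^ q))%N) x (pos t) =
      \sum_(0 <= t < n./2) Y (q.+1, t).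
    have nn : (n./2 <= n)%N by rewrite -divn2 leq_div.
    rewrite -[n in iota 0 n](subn0 n) -/(index_iota 0 n) (big_cat_nat (leq0n _) nn) /=.
    rewrite [X in _ + X]big_nat_cond [X in _ + X]big1 ?addr0; last first.
      move=> t /andP[/andP[]]; rewrite n2 /pos => h _; rewrite ltnNge => /negP[].
      by rewrite leq_mul2l leq_add2l.
    rewrite big_nat_cond [RHS]big_nat_cond; apply: eq_big => [t|t].
      case: (ltnP t n./2); rewrite ?andbF //= n2 => h.
      by rewrite /pos ltn_mul2l ltn_add2l h.
    by case/andP=> /andP[_ tn] _; apply: xpos; exact: leq_trans tn nn.
  by rewrite -n2.
move=> i j; rewrite !bs_sum_x // => hi /andP[iM Mj].
have im : block_of r i \in ms by move: hi; case: (_ \in _) => //; rewrite mul0r eqxx.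
rewrite im mul1r; case: (_ \in ms); last by rewrite mul0r rabs0 rabs_ge0.
rewrite mul1r !rabs_sc !gtr0_norm ?invr_gt0 // lef_pV2 ?posrE //.
have [_ mono _] := fg; apply: mono; apply: block_length_homo => //.
by apply: leq_trunc_log; rewrite ltnS (leq_trans (ltnW iM)).
Qed.

Lemma assembled_basis : exists basis : space_basis X,
  [/\ squeeze_symmetric basis, total_basis basis,
      approx_seq (ktilde basis) (fun m => (ln (1 + m%:R))%:E),
      ~ quasi_greedy basis &
      (forall m, (0 < m)%N -> 2 * Lam (r * m)%N <= r%:R * Lam m) -> bidemocratic basis].
Proof.
have fb : bounded_functionals bs.
  by move=> i; exact: (dkk_fun_bfunc r1 fg fw dw xs_bound).
have b_dense f : closure (spn b) f by exact: (dkk_dense r1 fg om_x wx_dense).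
have b_total f : (forall j, bs j f = 0) -> f = 0.
  exact: (dkk_total r1 fg oms_xs wx_total).
pose CU := 7 + 6 * B'; pose CL := 6 * C + 4 * B'.
have CU0 : 0 <= CU by rewrite addr_ge0 // mulr_ge0.
have CL0 : 0 <= CL by rewrite addr_ge0 // mulr_ge0.
have upper (s : seq nat) (c : nat -> F) : uniq s -> (0 < size s)%N ->
    (forall i, rabs (c i) <= 1) -> rnorm (\sum_(j <- s) c j *: b j) <= CU * Lam (size s).
  by move=> us s0 hc; exact: (dkk_upper r1 fg B'0 dw x_bound lower_regular).
have lower (s : seq nat) (f : X) (t : R) : uniq s -> (0 < size s)%N -> 0 <= t ->
    (forall j, j \in s -> t <= rabs (bs j f)) -> t * Lam (size s) <= CL * rnorm f.
  by move=> us s0 t0 ht; exact: (dkk_lower r1 fg C0 B'0 dw xs_bound).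
exists (squeezed_basis bb fb (fun f => @b_dense f)); split.
- exact: (squeezed_basis_squeeze_symmetric fg CU0 CL0 bb fb _ upper lower).
- exact: squeezed_basis_total.
- exact: (squeezed_basis_ktilde fg CU0 CL0 bb fb _ upper lower r1 B0 assembled_witness).
- exact: (squeezed_basis_not_quasi_greedy B0 assembled_witness).
move=> hup; apply: (squeezed_basis_bidemocratic fg CU0 bb fb _ upper (CD := 7 * C + 6 * B')).
  by rewrite addr_ge0 // mulr_ge0.
by move=> s f us s0; exact: (dkk_dual r1 fg C0 B'0 dw xs_bound).
Qed.

End Assembly.

(** * Type, cotype and the growth of the fundamental function *)

Section TypeCotype.
Context {R : realType} {k : scalar_kind}.
Local Notation F := (scalar_field R k).
Variable X : normedModType F.

Let card_signs n : #|{ffun 'I_n -> bool}| = (2 ^ n)%N.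
Proof. by rewrite card_ffun card_bool card_ord. Qed.

Lemma rademacher_mean_le (p M : R) n (f : 'I_n -> X) : 0 < p -> 0 <= M ->
  (forall e : {ffun 'I_n -> bool}, rnorm (\sum_i (-1) ^+ e i *: f i) <= M) ->
  rademacher_mean p f `^ p^-1 <= M.
Proof.
move=> p0 M0 h; rewrite -[leRHS](powRr1 M0) -[X in M `^ X](mulfV (lt0r_neq0 p0)) powRrM.
have n2 : 0 < 2 ^+ n :> R by rewrite exprn_gt0.
apply: ge0_ler_powR; rewrite ?nnegrE ?invr_ge0 ?powR_ge0 ?(ltW p0) //.
  by rewrite mulr_ge0 ?invr_ge0 ?(ltW n2) // sumr_ge0 // => e _; exact: powR_ge0.
rewrite /rademacher_mean mulrC ler_pdivrMr //.
apply: le_trans (_ : \sum_(e : {ffun 'I_n -> bool}) M `^ p <= _).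
  by apply: ler_sum => e _; apply: ge0_ler_powR; rewrite ?nnegrE ?rnorm_ge0 // ltW.
by rewrite sumr_const card_signs -[leLHS]mulr_natr natrX.
Qed.

Lemma rademacher_mean_ge (p M : R) n (f : 'I_n -> X) : 0 < p -> 0 <= M ->
  (forall e : {ffun 'I_n -> bool}, M <= rnorm (\sum_i (-1) ^+ e i *: f i)) ->
  M <= rademacher_mean p f `^ p^-1.
Proof.
move=> p0 M0 h; rewrite -[leLHS](powRr1 M0) -[X in M `^ X](mulfV (lt0r_neq0 p0)) powRrM.
have n2 : 0 < 2 ^+ n :> R by rewrite exprn_gt0.
apply: ge0_ler_powR; rewrite ?nnegrE ?invr_ge0 ?powR_ge0 ?(ltW p0) //.
  by rewrite mulr_ge0 ?invr_ge0 ?(ltW n2) // sumr_ge0 // => e _; exact: powR_ge0.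
rewrite /rademacher_mean [leRHS]mulrC ler_pdivlMr //.
apply: le_trans (_ : \sum_(e : {ffun 'I_n -> bool}) M `^ p <= _); last first.
  by apply: ler_sum => e _; apply: ge0_ler_powR; rewrite ?nnegrE ?rnorm_ge0 // ltW.
by rewrite sumr_const card_signs -[leRHS]mulr_natr natrX.
Qed.

Lemma power_sum_const (p M : R) n : 0 < p -> 0 <= M ->
  (\sum_(i < n) M `^ p) `^ p^-1 = n%:R `^ p^-1 * M.
Proof.
move=> p0 M0; rewrite sumr_const card_ord -[_ *+ n]mulr_natl powRM ?powR_ge0 //.
by rewrite -powRrM mulfV ?powRr1 // gt_eqF.
Qed.

Lemma ler_power_sum (p : R) n (a b : 'I_n -> R) : 0 < p ->
  (forall i, 0 <= a i <= b i) ->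
  (\sum_i a i `^ p) `^ p^-1 <= (\sum_i b i `^ p) `^ p^-1.
Proof.
move=> p0 h; apply: ge0_ler_powR.
- by rewrite invr_ge0 ltW.
- by rewrite nnegrE; apply: sumr_ge0 => i _; exact: powR_ge0.
- by rewrite nnegrE; apply: sumr_ge0 => i _; exact: powR_ge0.
apply: ler_sum => i _; have /andP[a0 ab] := h i.
by rewrite ge0_ler_powR ?nnegrE ?(ltW p0) ?(le_trans a0 ab).
Qed.

Lemma powR_unbounded (a K : R) : 0 < a ->
  exists n : nat, forall m, (n <= m)%N -> K <= m%:R `^ a.
Proof.
move=> a0; pose x := `|K| `^ a^-1.
exists (Num.bound x) => m mn.
have h : x <= m%:R.
  apply: ltW; apply: lt_le_trans (archi_boundP (powR_ge0 _ _)) _.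
  by rewrite ler_nat.
apply: le_trans (ler_norm K) _.
rewrite -[leLHS](powRr1 (normr_ge0 K)) -[X in `|K| `^ X](mulVf (lt0r_neq0 a0)) powRrM.
by apply: ge0_ler_powR; rewrite ?nnegrE ?powR_ge0 // ltW.
Qed.

Variables (Lam : nat -> R) (C : R) (w : nat -> X) (ws : nat -> X -> F).
Hypotheses (fg : fundamental_growth Lam) (C0 : 0 < C).
Hypotheses (bw : biorthogonal w ws) (fw : bounded_functionals ws).
Hypothesis dw : bidemocratic_family predT w ws Lam C.

Let Lam_gt0 n : (0 < n)%N -> 0 < Lam n. Proof. exact: fundamental_growth_gt0. Qed.

Let comb_coeff (s : seq nat) (c : nat -> F) j : uniq s -> j \in s ->
  ws j (\sum_(i <- s) c i *: w i) = c j.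
Proof.
move=> us js; have [K b] := fw j; rewrite (bfunc_sum _ _ _ b).
under eq_bigr => i _ do rewrite (bfuncZ _ _ b) bw.
rewrite (bigD1_seq j) //= eqxx mulr1 big1 ?addr0 // => i /negbTE.
by rewrite eq_sym => ->; rewrite mulr0.
Qed.

Let comb_lower (s s' : seq nat) (c : nat -> F) (t : R) : uniq s -> uniq s' ->
  {subset s' <= s} -> (0 < size s')%N -> (forall j, j \in s' -> t <= rabs (c j)) ->
  t * Lam (size s') <= C * rnorm (\sum_(i <- s) c i *: w i).
Proof.
move=> us us' sub s0 hc; set f := \sum_(i <- s) _.
have := dw.2 s' f us' (all_predT _).
have n0 : 0 < (size s')%:R :> R by rewrite ltr0n.
have Ls := Lam_gt0 s0.
have h : t * (size s')%:R <= \sum_(i <- s') rabs (ws i f).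
  rewrite mulr_natr -(sumr_const_seq s' t) big_seq [leRHS]big_seq.
  by apply: ler_sum => j js; rewrite /f comb_coeff ?hc // sub.
move=> h'; rewrite -(ler_pM2r n0); have := le_trans (ler_wpM2r (ltW Ls) h) h'.
by rewrite mulrAC [C * _ * _]mulrAC.
Qed.

Let comb_upper (s : seq nat) (c : nat -> F) : uniq s ->
  (forall j, rabs (c j) <= 1) -> rnorm (\sum_(i <- s) c i *: w i) <= Lam (size s).
Proof. by move=> us hc; apply: dw.1 => //; exact: all_predT. Qed.

(** Consecutive blocks of [m] vectors: by unconditionality for constant
    coefficients their signed sums have norms comparable to [Lam (n * m)], so
    that the averages in the definitions of type and cotype may be replaced by
    this value. *)
Section Blocks.
Variables (n m : nat).
Hypotheses (n0 : (0 < n)%N) (m0 : (0 < m)%N).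

Let blk i : X := \sum_(j <- iota 0 (n * m)) ((j %/ m)%N == i)%:R *: w j.

Let sum_blk (e : {ffun 'I_n -> bool}) : \sum_(i < n) (-1) ^+ e i *: blk i =
  \sum_(j <- iota 0 (n * m)) (\sum_(i < n) (-1) ^+ e i * ((j %/ m)%N == i)%:R) *: w j.
Proof.
under eq_bigr => i _ do rewrite scaler_sumr.
rewrite exchange_big; apply: eq_bigr => j _; rewrite scaler_suml.
by apply: eq_bigr => i _; rewrite scalerA.
Qed.

Let coeff_sign (e : {ffun 'I_n -> bool}) j : (j < n * m)%N ->
  rabs (\sum_(i < n) (-1) ^+ e i * ((j %/ m)%N == i)%:R : F) = 1.
Proof.
move=> jn; have jm : (j %/ m < n)%N by rewrite ltn_divLR.
rewrite (bigD1 (Ordinal jm)) //= eqxx mulr1 big1 ?addr0; last first.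
  by move=> i; rewrite -val_eqE /= eq_sym => /negbTE ->; rewrite mulr0.
by case: (e _); rewrite ?expr1 ?expr0 ?rabsN rabs1.
Qed.

Let coeff_le (e : {ffun 'I_n -> bool}) j :
  rabs (\sum_(i < n) (-1) ^+ e i * ((j %/ m)%N == i)%:R : F) <= 1.
Proof.
have [jn|nj] := ltnP j (n * m); first by rewrite coeff_sign.
rewrite big1 ?rabs0 // => i _; rewrite gtn_eqF ?mulr0 //.
by apply: leq_trans (ltn_ord i) _; rewrite leq_divRL.
Qed.

Let signed_le (e : {ffun 'I_n -> bool}) :
  rnorm (\sum_(i < n) (-1) ^+ e i *: blk i) <= Lam (n * m)%N.
Proof.
rewrite sum_blk -[X in Lam X](size_iota 0); apply: comb_upper; first exact: iota_uniq.
exact: coeff_le.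
Qed.

Let signed_ge (e : {ffun 'I_n -> bool}) :
  Lam (n * m)%N / C <= rnorm (\sum_(i < n) (-1) ^+ e i *: blk i).
Proof.
rewrite ler_pdivrMr // mulrC -[Lam _]mul1r -{1}(size_iota 0 (n * m)) sum_blk.
apply: comb_lower; rewrite ?iota_uniq ?size_iota ?muln_gt0 ?n0 //.
by move=> j; rewrite mem_iota => /= jn; rewrite coeff_sign.
Qed.

Let mem_blk i j : (i < n)%N ->
  (j \in [seq j <- iota 0 (n * m) | (j %/ m)%N == i]) = (j \in iota (i * m) m).
Proof.
move=> i_n; rewrite mem_filter !mem_iota /= add0n; apply/andP/andP.
  move=> [/eqP <- _]; rewrite leq_divM; split=> //.
  by rewrite -mulSnr ltn_ceil.
move=> [h1 h2]; split.
  by rewrite eqn_leq leq_divRL // h1 andbT -ltnS ltn_divLR // mulSnr.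
by apply: leq_trans h2 _; rewrite -mulSnr leq_mul2r i_n orbT.
Qed.

Let blkE i : (i < n)%N -> blk i = \sum_(j <- iota (i * m) m) 1 *: w j.
Proof.
move=> i_n; have p : perm_eq (iota (i * m) m) [seq j <- iota 0 (n * m) | (j %/ m)%N == i].
  apply: uniq_perm; rewrite ?filter_uniq ?iota_uniq // => j.
  by rewrite mem_blk.
rewrite (perm_big _ p) /= big_filter big_mkcond; apply: eq_bigr => j _.
by case: ifP => _; rewrite ?scale1r ?scale0r.
Qed.

Let blk_le (i : 'I_n) : 0 <= rnorm (blk i) <= Lam m.
Proof.
rewrite rnorm_ge0 blkE // -[in leRHS](size_iota (i * m) m).
by apply: comb_upper => [|j]; rewrite ?iota_uniq ?rabs1.
Qed.

Let blk_ge (i : 'I_n) : 0 <= Lam m / C <= rnorm (blk i).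
Proof.
rewrite divr_ge0 ?(ltW C0) ?(ltW (Lam_gt0 m0)) //= ler_pdivrMr // mulrC blkE //.
rewrite -[Lam m]mul1r -{1}(size_iota (i * m) m).
by apply: comb_lower; rewrite ?iota_uniq ?size_iota // => j _; rewrite rabs1.
Qed.

Lemma type_block_growth p Cp : 0 < p ->
  (forall (n : nat) (f : 'I_n -> X),
    rademacher_mean p f `^ p^-1 <= Cp * (\sum_i rnorm (f i) `^ p) `^ p^-1) ->
  Lam (n * m)%N <= C * (`|Cp| * (n%:R `^ p^-1 * Lam m)).
Proof.
move=> p0 type; have Lnm : 0 < Lam (n * m)%N by rewrite Lam_gt0 // muln_gt0 n0.
rewrite -ler_pdivrMl // mulrC.
have M0 : 0 <= Lam (n * m)%N / C by rewrite divr_ge0 // ltW.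
apply: le_trans (rademacher_mean_ge p0 M0 signed_ge) _.
apply: le_trans (type n (fun i => blk i)) _.
apply: le_trans (ler_wpM2r (powR_ge0 _ _) (ler_norm _)) _.
apply: ler_wpM2l => //; rewrite -(power_sum_const _ p0 (ltW (Lam_gt0 m0))).
exact: (ler_power_sum (a := fun i => rnorm (blk i)) (b := fun=> Lam m) p0 blk_le).
Qed.

Lemma cotype_block_growth q Cq : 0 < q ->
  (forall (n : nat) (f : 'I_n -> X),
    (\sum_i rnorm (f i) `^ q) `^ q^-1 <= Cq * rademacher_mean q f `^ q^-1) ->
  n%:R `^ q^-1 * Lam m <= C * (`|Cq| * Lam (n * m)%N).
Proof.
move=> q0 cotype; have Lnm : 0 < Lam (n * m)%N by rewrite Lam_gt0 // muln_gt0 n0.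
rewrite -ler_pdivrMl // mulrC -mulrA.
have M0 : 0 <= Lam m / C by rewrite divr_ge0 // ltW // Lam_gt0.
rewrite -(power_sum_const _ q0 M0).
apply: le_trans (ler_power_sum (a := fun=> Lam m / C) (b := fun i => rnorm (blk i)) q0 blk_ge) _.
apply: le_trans (cotype n (fun i => blk i)) _.
apply: le_trans (ler_wpM2r (powR_ge0 _ _) (ler_norm _)) _.
by apply: ler_wpM2l => //; apply: rademacher_mean_le signed_le => //; exact: ltW.
Qed.

End Blocks.

(** Rademacher-like vectors: [2 ^ n] blocks of [m] vectors carry all the
    patterns of [n] signs, so that whatever the choice of signs some block
    receives the coefficient [n]. *)
Lemma type_rademacher_growth n m p Cp : (0 < n)%N -> (0 < m)%N -> 0 < p ->
  (forall (n : nat) (f : 'I_n -> X),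
    rademacher_mean p f `^ p^-1 <= Cp * (\sum_i rnorm (f i) `^ p) `^ p^-1) ->
  n%:R * Lam m <= C * (`|Cp| * (n%:R `^ p^-1 * Lam (2 ^ n * m)%N)).
Proof.
move=> n0 m0 p0 type; pose S := {ffun 'I_n -> bool}.
have N0 : (0 < 2 ^ n * m)%N by rewrite muln_gt0 expn_gt0.
pose pat (j : nat) : S := nth [ffun=> false] (enum S) (j %/ m).
pose f (i : 'I_n) : X := \sum_(j <- iota 0 (2 ^ n * m)) (-1) ^+ pat j i *: w j.
have f_le i : 0 <= rnorm (f i) <= Lam (2 ^ n * m)%N.
  rewrite rnorm_ge0 -[X in Lam X](size_iota 0); apply: comb_upper; first exact: iota_uniq.
  by move=> j; case: (pat j i); rewrite ?expr1 ?expr0 ?rabsN rabs1.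
have sumE (e : S) : \sum_i (-1) ^+ e i *: f i = \sum_(j <- iota 0 (2 ^ n * m))
    (\sum_i (-1) ^+ e i * (-1) ^+ pat j i) *: w j.
  under eq_bigr => i _ do rewrite scaler_sumr.
  rewrite exchange_big; apply: eq_bigr => j _; rewrite scaler_suml.
  by apply: eq_bigr => i _; rewrite scalerA.
have ge (e : S) : n%:R * Lam m / C <= rnorm (\sum_i (-1) ^+ e i *: f i).
  rewrite ler_pdivrMr // [leRHS]mulrC sumE.
  pose b := index e (enum S).
  have bn : (b < 2 ^ n)%N by rewrite -(card_signs n) cardE index_mem mem_enum.
  have -> : Lam m = Lam (size (iota (b * m) m)) by rewrite size_iota.
  apply: comb_lower; rewrite ?iota_uniq ?size_iota //.
    move=> j; rewrite !mem_iota add0n => /andP[_ jb] /=.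
    by apply: leq_trans jb _; rewrite -mulSnr leq_mul2r bn orbT.
  move=> j; rewrite mem_iota => /andP[jb1 jb2].
  have jb : (j %/ m)%N = b.
    by apply/eqP; rewrite eqn_leq leq_divRL // jb1 andbT -ltnS ltn_divLR // mulSnr.
  have -> : pat j = e by rewrite /pat jb nth_index // mem_enum.
  rewrite (eq_bigr (fun=> 1)) => [|i _]; last first.
    by case: (e i); rewrite ?expr1 ?expr0 ?mulrNN mulr1.
  by rewrite sumr_const card_ord rabs_nat.
rewrite -ler_pdivrMl // mulrC.
have M0 : 0 <= n%:R * Lam m / C.
  by rewrite divr_ge0 ?(ltW C0) // mulr_ge0 // (ltW (Lam_gt0 m0)).
apply: le_trans (rademacher_mean_ge p0 M0 ge) _.
apply: le_trans (type n f) _.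
apply: le_trans (ler_wpM2r (powR_ge0 _ _) (ler_norm _)) _.
apply: ler_wpM2l => //; rewrite -(power_sum_const _ p0 (ltW (Lam_gt0 N0))).
exact: (ler_power_sum (a := fun i => rnorm (f i)) (b := fun=> Lam (2 ^ n * m)%N)).
Qed.

(** Cotype [q] makes [Lam (n * m)] at least of order [n `^ q^-1 * Lam m]. *)
Lemma cotype_lower_regular : nontrivial_cotype X ->
  exists2 r, (1 < r)%N & forall m, (0 < m)%N -> 2 * Lam m <= Lam (r * m)%N.
Proof.
move=> [q [q2 [Cq cotype]]]; have q0 : 0 < q by lra.
have q'0 : 0 < q^-1 by rewrite invr_gt0.
pose K := C * (`|Cq| + 1).
have K0 : 0 < K by rewrite mulr_gt0 // ltr_wpDl.
have [n hn] := powR_unbounded (2 * K) q'0.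
exists n.+2 => // m m0; have := cotype_block_growth (n := n.+2) isT m0 q0 cotype.
have := hn n.+2 (leqW (leqnSn n)) => h1 h2.
have Lm := Lam_gt0 m0; have Lr : 0 < Lam (n.+2 * m)%N by rewrite Lam_gt0 // muln_gt0.
rewrite -(ler_pM2l K0).
apply: le_trans (_ : n.+2%:R `^ q^-1 * Lam m <= _).
  by rewrite mulrCA mulrA; apply: ler_wpM2r => //; exact: ltW.
apply: le_trans h2 _; rewrite /K -mulrA; apply: ler_wpM2l; first exact: ltW.
by apply: ler_wpM2r; [exact: ltW|rewrite lerDl].
Qed.

(** Type [p] bounds [Lam (n * m)] by a multiple of [n `^ p^-1 * Lam m], where
    [n `^ p^-1] is small compared with [n]; the growth from below comes from
    the Rademacher-like vectors, which spares the passage from type to cotype. *)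
Lemma type_regular : nontrivial_type X ->
  exists2 r, (1 < r)%N & (forall m, (0 < m)%N -> 2 * Lam m <= Lam (r * m)%N) /\
    (forall m, (0 < m)%N -> 2 * Lam (r * m)%N <= r%:R * Lam m).
Proof.
move=> [p [/andP[p1 p2] [Cp type]]]; have p0 : 0 < p by lra.
pose a := 1 - p^-1; have a0 : 0 < a by rewrite /a subr_gt0 invf_lt1.
pose K := C * (`|Cp| + 1).
have K0 : 0 < K by rewrite mulr_gt0 // ltr_wpDl.
have split n : (0 < n)%N -> n%:R = n%:R `^ a * n%:R `^ p^-1 :> R.
  move=> n0; rewrite -powRD; last by rewrite pnatr_eq0 -lt0n n0 implybT.
  by rewrite /a subrK powRr1.
have [n hn] := powR_unbounded (2 * K) a0.
pose q := n.+1; pose r := (2 ^ q)%N.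
have r1 : (1 < r)%N by rewrite /r -{1}(expn0 2) ltn_exp2l.
have qr : (n <= r)%N by apply: leq_trans (leqnSn n) _; rewrite ltnW // ltn_expl.
exists r => //; split=> m m0; have Lm := Lam_gt0 m0;
  have Lr : 0 < Lam (r * m)%N by [rewrite Lam_gt0 // muln_gt0 m0 expn_gt0].
- have h := type_rademacher_growth (n := q) isT m0 p0 type; rewrite -/r in h.
  have qp : 0 < q%:R `^ p^-1 :> R by rewrite powR_gt0 // ltr0n.
  have : 2 * K * (q%:R `^ p^-1 * Lam m) <= K * (q%:R `^ p^-1 * Lam (r * m)%N).
    apply: le_trans (_ : q%:R * Lam m <= _).
      rewrite mulrA; apply: ler_wpM2r; first exact: ltW.
      by rewrite [leRHS](split q) //; apply: ler_wpM2r; [exact: ltW|apply: hn].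
    apply: le_trans h _; rewrite /K -mulrA; apply: ler_wpM2l; first exact: ltW.
    by apply: ler_wpM2r; [rewrite mulr_ge0 // ltW|rewrite lerDl].
  by rewrite -mulrA mulrCA ler_pM2l // mulrCA ler_pM2l.
have h := type_block_growth (n := r) (ltnW r1) m0 p0 type.
have rp : 0 < r%:R `^ p^-1 :> R by rewrite powR_gt0 // ltr0n expn_gt0.
apply: le_trans (_ : 2 * K * r%:R `^ p^-1 * Lam m <= _).
  rewrite -!mulrA ler_pM2l //; apply: le_trans h _.
  rewrite /K -?mulrA; apply: ler_wpM2l; first exact: ltW.
  by apply: ler_wpM2r; [rewrite mulr_ge0 // ltW|rewrite lerDl].
apply: ler_wpM2r; first exact: ltW.
by rewrite [leRHS](split r) ?expn_gt0 //; apply: ler_wpM2r; [exact: ltW|apply: hn].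
Qed.

End TypeCotype.

(** * Spreading sequences *)

Section Spreading.
Context {R : realType} {k : scalar_kind}.
Local Notation F := (scalar_field R k).
Variable X : normedModType F.

(** The norm is convex, so that on the polydisc it is maximal at unimodular
    coefficients. *)
Lemma convex_unimodular (I : eqType) (s : seq I) (y : I -> X) (c : I -> F) (v : X) :
  uniq s -> (forall i, rabs (c i) <= 1) ->
  exists2 e : I -> F, forall i, rabs (e i) = 1 &
    rnorm (v + \sum_(i <- s) c i *: y i) <= rnorm (v + \sum_(i <- s) e i *: y i).
Proof.
elim: s v => [|i s IH] v /=; first by exists (fun=> 1) => [_|]; rewrite ?rabs1 // !big_nil.
move=> /andP[is_ us] hc; rewrite big_cons addrA.
have [e e1 he] := IH (v + c i *: y i) us hc.
have [th th1 thE] : exists2 th : F, rabs th = 1 & c i = sc (rabs (c i)) * th.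
  have [c0|c0] := eqVneq (c i) 0; first by exists 1; rewrite ?rabs1 // c0 rabs0 sc0 mul0r.
  exists ((sc (rabs (c i)))^-1 * c i).
    by rewrite rabsM rabsV rabs_sc ger0_norm ?rabs_ge0 // mulVf // rabs_eq0.
  by rewrite mulrA mulfV ?mul1r // sc_eq0 rabs_eq0.
set z := v + \sum_(j <- s) e j *: y j.
pose t := rabs (c i); have t0 : 0 <= t by exact: rabs_ge0.
have t1 : t <= 1 by exact: hc.
have split_z (x : X) : x + c i *: y i =
    sc ((1 + t) / 2) *: (x + th *: y i) + sc ((1 - t) / 2) *: (x - th *: y i).
  rewrite !scalerDr addrACA -scalerDl -scD scalerN -scalerBl -scB.
  have -> : (1 + t) / 2 + (1 - t) / 2 = 1 by field.
  have -> : (1 + t) / 2 - (1 - t) / 2 = t by field.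
  by rewrite sc1 scale1r scalerA -thE.
have cz : rnorm (z + c i *: y i) <=
    (1 + t) / 2 * rnorm (z + th *: y i) + (1 - t) / 2 * rnorm (z - th *: y i).
  rewrite split_z; apply: le_trans (rnormD _ _) _.
  have p1 : 0 <= (1 + t) / 2 by rewrite divr_ge0 // addr_ge0.
  have p2 : 0 <= (1 - t) / 2 by rewrite divr_ge0 // subr_ge0.
  by rewrite !rnormZ !rabs_sc !ger0_norm.
have pick (d : F) : rabs d = 1 -> rnorm (z + c i *: y i) <= rnorm (z + d *: y i) ->
    exists2 e : I -> F, forall j, rabs (e j) = 1 &
    rnorm (v + c i *: y i + \sum_(j <- s) c j *: y j) <=
    rnorm (v + \sum_(j <- i :: s) e j *: y j).
  move=> d1 hd; exists (fun j => if j == i then d else e j).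
    by move=> j; case: ifP.
  apply: le_trans he _; rewrite addrAC -/z; apply: le_trans hd _.
  rewrite big_cons eqxx /z -!addrA [d *: _ + _]addrC.
  rewrite le_eqVlt; apply/orP; left; apply/eqP; congr (rnorm (_ + (_ + _))).
  apply: eq_big_seq => j js; case: eqP => // ji.
  by rewrite ji (negbTE is_) in js.
have [le|lt] := leP (rnorm (z - th *: y i)) (rnorm (z + th *: y i)).
  apply: (pick th th1); apply: le_trans cz _.
  have : (1 - t) / 2 * rnorm (z - th *: y i) <= (1 - t) / 2 * rnorm (z + th *: y i).
    by apply: ler_wpM2l => //; lra.
  lra.
apply: (pick (- th)); first by rewrite rabsN.
rewrite scaleNr; apply: le_trans cz _.
have : (1 + t) / 2 * rnorm (z + th *: y i) <= (1 + t) / 2 * rnorm (z - th *: y i).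
  by apply: ler_wpM2l; [lra|exact: ltW].
lra.
Qed.

Variables (w : nat -> X) (ws : nat -> X -> F) (Q KP : R) (P : X -> X).
Hypotheses (Q1 : 1 <= Q) (KP0 : 0 < KP).
Hypotheses (bw : biorthogonal w ws) (fw : bounded_functionals ws).
Hypothesis spread_le : forall m (a eps : nat -> F) (pi : nat -> nat),
  (forall n, rabs (eps n) = 1) -> {homo pi : i j / (i < j)%N} ->
  rnorm (\sum_(0 <= i < m) (eps i * a i) *: w (pi i)) <=
    Q * rnorm (\sum_(0 <= i < m) a i *: w i).
Hypothesis spread_ge : forall m (a eps : nat -> F) (pi : nat -> nat),
  (forall n, rabs (eps n) = 1) -> {homo pi : i j / (i < j)%N} ->
  rnorm (\sum_(0 <= i < m) a i *: w i) <=
    Q * rnorm (\sum_(0 <= i < m) (eps i * a i) *: w (pi i)).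
Hypothesis P_bound : forall x, rnorm (P x) <= KP * rnorm x.
Hypothesis ws_P : forall j x, ws j (P x) = ws j x.
Hypothesis P_span : forall x, closure (spn w) (P x).

Let Q0 : 0 <= Q. Proof. by apply: le_trans Q1. Qed.

(** The increasing enumeration of [s], continued beyond its last element so that
    it is a strictly increasing map on all natural numbers. *)
Let ext (s : seq nat) i := if (i < size s)%N then nth 0%N s i else ((last 0%N s).+1 + i)%N.

Let ext_homo s : sorted ltn s -> {homo ext s : i j / (i < j)%N}.
Proof.
move=> ss i j ij; rewrite /ext; case: (ltnP j (size s)) => js.
  rewrite (ltn_trans ij js); apply: (sorted_ltn_nth ltn_trans 0%N ss) => //.
  by rewrite inE (ltn_trans ij js).
case: (ltnP i (size s)) => is_; last by rewrite ltn_add2l.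
rewrite addSn ltnS; apply: leq_trans (leq_addr _ _).
rewrite -nth_last; have s0 : (0 < size s)%N by exact: leq_ltn_trans is_.
have [->//|ne] := eqVneq i (size s).-1.
apply: ltnW; apply: (sorted_ltn_nth ltn_trans 0%N ss); rewrite ?inE ?prednK //.
by rewrite ltn_neqAle ne -ltnS prednK.
Qed.

Let sum_ext (s : seq nat) (f : nat -> X) : sorted ltn s ->
  \sum_(i <- s) f i = \sum_(0 <= i < size s) f (ext s i).
Proof.
move=> ss; rewrite (big_nth 0%N) big_nat [RHS]big_nat.
by apply: eq_bigr => i /andP[_ is_]; rewrite /ext is_.
Qed.

Let sort_ltn (s : seq nat) : uniq s -> sorted ltn (sort leq s) /\ perm_eq s (sort leq s).
Proof.
move=> us; split; last by rewrite perm_sym; exact: permEl (perm_sort _ _).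
by rewrite ltn_sorted_uniq_leq sort_uniq us /= sort_sorted //; exact: leq_total.
Qed.

Let ones m := rnorm (\sum_(0 <= i < m) w i).

(** The indicator of a set is the mean of the constant 1 and a sign. *)
Let trunc m (a : nat -> F) (A : pred nat) :
  rnorm (\sum_(0 <= i < m | A i) a i *: w i) <= Q * rnorm (\sum_(0 <= i < m) a i *: w i).
Proof.
pose eps i : F := if A i then 1 else -1.
have := @spread_le m a eps id.
set v := \sum_(0 <= i < m) a i *: w i; set v' := \sum_(0 <= i < m) _.
move=> /(_ _ _)h; have {}h : rnorm v' <= Q * rnorm v.
  by apply: h => // n; rewrite /eps; case: ifP => _; rewrite ?rabsN rabs1.
have -> : \sum_(0 <= i < m | A i) a i *: w i = sc (2^-1) *: (v + v').
  rewrite -big_split scaler_sumr big_mkcond; apply: eq_bigr => i _ /=.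
  rewrite /eps; case: ifP => _; last by rewrite mulN1r scaleNr subrr scaler0.
  rewrite mul1r -scalerDl scalerA -mulr2n -[a i *+ 2]mulr_natl mulrA.
  by rewrite -(@sc_nat R k) -scM mulVf ?sc1 ?mul1r // pnatr_eq0.
rewrite rnormZ rabs_sc gtr0_norm ?invr_gt0 //.
have := rnormD v v'; have := ler_wpM2r (rnorm_ge0 v) Q1; lra.
Qed.

Let admissible n : set (seq nat * (nat -> F)) :=
  [set sc | [/\ uniq sc.1, (size sc.1 <= n)%N & forall i, rabs (sc.2 i) <= 1]].

Let combo (p : seq nat * (nat -> F)) : R := rnorm (\sum_(i <- p.1) p.2 i *: w i).

(** Taking the supremum over all sets and coefficients makes this function
    subadditive and nondecreasing exactly, whereas the norms of sums of initial
    segments have these properties up to constants only. *)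
Definition spreading_fundamental n : R := sup [set combo p | p in admissible n].
Local Notation Lam := spreading_fundamental.

Let combo_le n p : admissible n p -> combo p <= Q ^+ 2 * ones n.
Proof.
case: p => s c [/= us sn hc]; rewrite /combo /=.
have [e e1] := convex_unimodular w 0 us hc; rewrite !add0r => h; apply: le_trans h _.
have [ss ps] := sort_ltn us; rewrite (perm_big _ ps) /= sum_ext //.
have sz : size (sort leq s) = size s by rewrite size_sort.
have := @spread_le (size (sort leq s)) (fun=> 1) (fun i => e (ext (sort leq s) i))
  (ext (sort leq s)) (fun=> e1 _) (ext_homo ss).
under eq_bigr => i _ do rewrite mulr1.
move=> h; apply: le_trans h _; rewrite expr2 -mulrA; apply: ler_wpM2l => //.
have := trunc n (fun=> 1) (fun i => (i < size s)%N).
have -> : \sum_(0 <= i < n | (i < size s)%N) 1 *: w i =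
    \sum_(0 <= i < size (sort leq s)) 1 *: w i.
  rewrite sz [RHS](big_nat_widen _ _ n) //.
move=> h; apply: le_trans h _; rewrite /ones le_eqVlt; apply/orP; left; apply/eqP.
by congr (_ * rnorm _); apply: eq_bigr => i _; rewrite scale1r.
Qed.

Let combo_ub n : has_ubound [set combo p | p in admissible n].
Proof. by exists (Q ^+ 2 * ones n) => _ [p hp <-]; exact: combo_le. Qed.

Let combo_ne n : [set combo p | p in admissible n] !=set0.
Proof.
by exists (combo ([::], fun=> 0)), ([::], fun=> 0) => //; split=> //= i; rewrite rabs0.
Qed.

Let combo_Lam n p : admissible n p -> combo p <= Lam n.
Proof. by move=> hp; apply: ub_le_sup; [exact: combo_ub|exists p]. Qed.

Let Lam_le n M : (forall p, admissible n p -> combo p <= M) -> Lam n <= M.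
Proof. by move=> h; apply: ge_sup; [exact: combo_ne|move=> _ [p hp <-]; exact: h]. Qed.

Lemma spreading_fundamental_growth : fundamental_growth Lam.
Proof.
split.
- move=> m n; apply: Lam_le => -[s c] [/= us smn hc].
  rewrite /combo /= -(cat_take_drop m s) big_cat /=; apply: le_trans (rnormD _ _) _.
  apply: lerD.
    apply: (@combo_Lam m (take m s, c)); split=> //=; first exact: take_uniq.
    by rewrite size_take; case: ltnP.
  apply: (@combo_Lam n (drop m s, c)); split=> //=; first exact: drop_uniq.
  by rewrite size_drop leq_subLR.
- move=> m n mn; apply: Lam_le => p [h1 h2 h3]; apply: combo_Lam; split=> //.
  exact: leq_trans mn.
apply: lt_le_trans (_ : rnorm (w 0%N) <= _).
  rewrite rnorm_gt0; apply/eqP => w0; have [K b] := fw 0%N.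
  have := bw 0%N 0%N; rewrite w0 (bfunc0v b) eqxx => /eqP.
  by rewrite eq_sym oner_eq0.
have := @combo_Lam 1%N ([:: 0%N], fun=> 1); rewrite /combo /= big_seq1 scale1r.
by apply; split=> //= i; rewrite rabs1.
Qed.

(** For symmetric bases this results from averaging over permutations; shifts
    replace them here. A vector [\sum_(i < m) a i *: w i] and its [m] first
    translates add up to coefficients [d p] with [d p + d (p + m)] equal to the
    sum of the [a i]. *)
Let shift_average m (a : nat -> F) :
  rabs (\sum_(0 <= i < m) a i) * ones m <=
    (Q + Q ^+ 2) * Q * m%:R * rnorm (\sum_(0 <= i < m) a i *: w i).
Proof.
pose d p := \sum_(0 <= t < m) \sum_(0 <= i < m) a i * ((i + t)%N == p)%:R.
set v := \sum_(0 <= i < m) a i *: w i.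
have dE p : (p < m)%N -> d p + d (p + m)%N = \sum_(0 <= i < m) a i.
  move=> pm; rewrite /d exchange_big [X in _ + X]exchange_big -big_split /=.
  apply: eq_big_nat => i /andP[_ im]; rewrite -!mulr_sumr -mulrDr -big_split /=.
  rewrite -[RHS]mulr1; congr (_ * _).
  pose t0 := if (i <= p)%N then (p - i)%N else (p + m - i)%N.
  have t0m : (t0 < m)%N by rewrite /t0; case: ifP; lia.
  rewrite (bigD1_seq t0) ?mem_index_iota ?iota_uniq //= big1_seq ?addr0.
    rewrite /t0; case: (leqP i p) => ip.
      have -> : ((i + (p - i))%N == p) by rewrite subnKC.
      have -> : ((i + (p - i))%N == (p + m)%N) = false.
        by apply/negbTE; rewrite subnKC // -{1}(addn0 p) eqn_add2l eq_sym -lt0n; lia.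
      by rewrite addr0.
    have -> : ((i + (p + m - i))%N == (p + m)%N) by rewrite subnKC //; lia.
    have -> : ((i + (p + m - i))%N == p) = false.
      by apply/negbTE; rewrite subnKC; lia.
    by rewrite add0r.
  move=> t /andP[tt0]; rewrite mem_index_iota => /andP[_ tm].
  have -> : ((i + t)%N == p) = false.
    by apply/negbTE; move: tt0; rewrite /t0; case: ifP; lia.
  have -> : ((i + t)%N == (p + m)%N) = false.
    by apply/negbTE; move: tt0; rewrite /t0; case: ifP; lia.
  by rewrite addr0.
pose D := \sum_(0 <= t < m) \sum_(0 <= i < m) a i *: w (i + t)%N.
have D_le : rnorm D <= m%:R * (Q * rnorm v).
  apply: le_trans (rnorm_sum _ _ _) _.
  apply: le_trans (_ : \sum_(0 <= t < m) Q * rnorm v <= _); last first.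
    by rewrite sumr_const_nat subn0 -[leLHS]mulr_natl.
  apply: ler_sum => t _.
  have := @spread_le m a (fun=> 1) (addn^~ t).
  under eq_bigr => i _ do rewrite mul1r.
  by apply=> [_|i j]; rewrite ?rabs1 // ltn_add2r.
have DE : D = \sum_(0 <= p < m + m) d p *: w p.
  rewrite /d; under [RHS]eq_bigr => p _ do rewrite scaler_suml.
  rewrite [RHS]exchange_big /=; apply: eq_big_nat => t /andP[_ tm].
  under [RHS]eq_bigr => p _ do rewrite scaler_suml.
  rewrite [RHS]exchange_big /=; apply: eq_big_nat => i /andP[_ im].
  rewrite (bigD1_seq (i + t)%N) ?mem_index_iota ?iota_uniq //=; last by lia.
  rewrite eqxx mulr1 big1 ?addr0 // => p /negbTE; rewrite eq_sym => ->.
  by rewrite mulr0 scale0r.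
pose y1 := \sum_(0 <= p < m) d p *: w p.
pose y2 := \sum_(0 <= p < m) d (p + m)%N *: w p.
have y1_le : rnorm y1 <= Q * rnorm D.
  rewrite DE; have := trunc (m + m) d (fun p => (p < m)%N).
  by rewrite /y1 [X in _ -> rnorm X <= _](big_nat_widen _ _ (m + m)) ?leq_addr.
have y2_le : rnorm y2 <= Q * (Q * rnorm D).
  have := @spread_ge m (fun p => d (p + m)%N) (fun=> 1) (addn^~ m).
  move=> /(_ (fun=> rabs1) _)h; apply: le_trans (h _) _.
    by move=> i j; rewrite ltn_add2r.
  apply: ler_wpM2l => //; rewrite DE.
  have := trunc (m + m) d (fun p => (m <= p)%N).
  have -> // : \sum_(0 <= p < m + m | (m <= p)%N) d p *: w p =
      \sum_(0 <= i < m) (1 * d (i + m)%N) *: w (i + m)%N.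
  rewrite (@big_cat_nat _ _ _ m) //=; last by rewrite leq_addr.
  rewrite big_nat_cond big1 ?add0r; last by move=> p /andP[/andP[_ pm]]; rewrite leqNgt pm.
  rewrite -{1}[m]add0n big_addn addnK; apply: eq_big => [p|p _]; first by rewrite leq_addl.
  by rewrite mul1r.
have sumE : (\sum_(0 <= i < m) a i) *: \sum_(0 <= p < m) w p = y1 + y2.
  rewrite scaler_sumr /y1 /y2 -big_split /=; apply: eq_big_nat => p /andP[_ pm].
  by rewrite -scalerDl dE.
rewrite -rnormZ sumE; apply: le_trans (rnormD _ _) _.
have h1 := ler_wpM2l Q0 D_le; have h2 := ler_wpM2l Q0 h1.
have e : (Q + Q ^+ 2) * Q * m%:R * rnorm v =
    Q * (m%:R * (Q * rnorm v)) + Q * (Q * (m%:R * (Q * rnorm v))).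
  by ring.
rewrite e; apply: lerD; first exact: le_trans h1.
exact: le_trans h2.
Qed.

Let Q' : R := (Q + Q ^+ 2) * Q * Q ^+ 2.

Let span_expansion v : spn w v -> exists N0, forall N, (N0 <= N)%N ->
  v = \sum_(0 <= i < N) ws i v *: w i.
Proof.
move=> sv; apply: (sv [set v | exists N0, forall N, (N0 <= N)%N ->
  v = \sum_(0 <= i < N) ws i v *: w i]) => [|j].
  split.
    exists 0%N => N _; rewrite big1 // => i _.
    by have [K b] := fw i; rewrite (bfunc0v b) scale0r.
  move=> c x y [N hN] [M hM]; exists (maxn N M) => q; rewrite geq_max => /andP[Nq Mq].
  rewrite {1}(hN q Nq) {1}(hM q Mq) scaler_sumr -big_split; apply: eq_bigr => i _ /=.
  by have [K [l _]] := fw i; rewrite l scalerDl scalerA.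
exists j.+1 => N jN; rewrite (bigD1_seq j) ?mem_index_iota ?iota_uniq //=.
rewrite bw eqxx scale1r big1 ?addr0 // => i /negbTE ij.
by rewrite bw ij scale0r.
Qed.

(** Signs make all coefficients over [s] nonnegative, spreading moves [s] to an
    initial segment, and [shift_average] applies. *)
Let coeff_sum_span (s : seq nat) v : uniq s -> spn w v ->
  (\sum_(j <- s) rabs (ws j v)) * ones (size s) <= Q' * (size s)%:R * rnorm v.
Proof.
move=> us /span_expansion[N0 hN0].
pose N := maxn N0 (\max_(j <- s) j).+1.
have vE : v = \sum_(0 <= i < N) ws i v *: w i by apply: hN0; exact: leq_maxl.
have sN j : j \in s -> (j < N)%N.
  move=> js; rewrite /N leq_max; apply/orP; right.
  by rewrite ltnS (big_rem _ js) /= leq_maxl.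
have [ss ps] := sort_ltn us; set s' := sort leq s in ss ps.
have sz : size s = size s' by rewrite size_sort.
pose a i : F := sc (rabs (ws (ext s' i) v)).
pose eps i : F := let c := ws (ext s' i) v in
  if c == 0 then 1 else c / sc (rabs c).
have eps1 i : rabs (eps i) = 1.
  rewrite /eps; case: eqP => [_|/eqP c0]; first exact: rabs1.
  by rewrite rabsM rabsV rabs_sc ger0_norm ?rabs_ge0 // mulfV // rabs_eq0.
have epsE i : eps i * a i = ws (ext s' i) v.
  rewrite /eps /a; case: eqP => [->|/eqP c0]; first by rewrite rabs0 sc0 mulr0.
  by rewrite divfK // sc_eq0 rabs_eq0.
have sumE : \sum_(j <- s) rabs (ws j v) = rabs (\sum_(0 <= i < size s') a i).
  have -> : \sum_(0 <= i < size s') a i = sc (\sum_(j <- s) rabs (ws j v)).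
    rewrite (perm_big _ ps) /= -/s' (big_morph sc (@scD R k) (@sc0 R k)).
    rewrite [RHS](big_nth 0%N) big_nat [RHS]big_nat.
    by apply: eq_bigr => i /andP[_ is_]; rewrite /a /ext is_.
  rewrite rabs_sc ger0_norm // sumr_ge0 // => j _; exact: rabs_ge0.
rewrite sumE sz; apply: le_trans (shift_average _ _) _.
have h1 := spread_ge (size s') a eps1 (ext_homo ss).
have h2 : rnorm (\sum_(0 <= i < size s') (eps i * a i) *: w (ext s' i)) <= Q * rnorm v.
  under eq_bigr => i _ do rewrite epsE.
  rewrite -(sum_ext (fun j => ws j v *: w j) ss) -(perm_big _ ps) /=.
  have := trunc N (fun j => ws j v) (fun j => j \in s); rewrite -vE.
  have -> // : \sum_(0 <= i < N | i \in s) ws i v *: w i = \sum_(j <- s) ws j v *: w j.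
  rewrite -big_filter; apply: perm_big; apply: uniq_perm => //.
    exact/filter_uniq/iota_uniq.
  by move=> j; rewrite mem_filter mem_index_iota /=; case: (boolP (j \in s)) => // /sN.
have h3 : rnorm (\sum_(0 <= i < size s') a i *: w i) <= Q ^+ 2 * rnorm v.
  by apply: le_trans h1 _; rewrite expr2 -mulrA; apply: ler_wpM2l.
have c0 : 0 <= (Q + Q ^+ 2) * Q * (size s')%:R.
  by rewrite !mulr_ge0 // addr_ge0 // exprn_ge0.
apply: le_trans (ler_wpM2l c0 h3) _.
by rewrite le_eqVlt; apply/orP; left; apply/eqP; rewrite /Q'; ring.
Qed.

Let le_small (A B D : R) : 0 <= D -> (forall e, 0 < e -> A <= B + e * D) -> A <= B.
Proof.
move=> D0 h; apply/ler_addgt0Pl => e e0.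
have D1 : 0 < D + 1 by rewrite ltr_wpDl.
have := h (e / (D + 1)) ltac:(by rewrite divr_gt0).
have : e / (D + 1) * D <= e.
  rewrite -mulrA ler_piMr ?(ltW e0) // mulrC ler_pdivrMr // mul1r lerDl //.
lra.
Qed.

(** The elements of the range of [P] are only limits of finite combinations, so
    that the estimate is extended by density. *)
Let coeff_sum (s : seq nat) x : uniq s ->
  (\sum_(j <- s) rabs (ws j x)) * ones (size s) <= Q' * KP * (size s)%:R * rnorm x.
Proof.
move=> us; have /choice[K hK] := fw.
have Q'0 : 0 <= Q' by rewrite !mulr_ge0 // ?addr_ge0 // exprn_ge0.
have o0 : 0 <= ones (size s) by exact: rnorm_ge0.
have n0 : 0 <= (size s)%:R :> R by [].
pose D := Q' * (size s)%:R + (\sum_(j <- s) `|K j|) * ones (size s).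
have D0 : 0 <= D by rewrite addr_ge0 // mulr_ge0 // sumr_ge0.
apply: (le_small D0) => e e0.
have [v sv xv] := (closure_rnorm (spn w) (P x)).1 (@P_span x) e e0.
have hv := coeff_sum_span us sv.
have near : \sum_(j <- s) rabs (ws j x) <=
    \sum_(j <- s) rabs (ws j v) + e * \sum_(j <- s) `|K j|.
  rewrite mulr_sumr -big_split; apply: ler_sum => j _ /=.
  have -> : ws j x = ws j v + ws j (P x - v).
    by rewrite (bfuncB _ _ (hK j)) ws_P addrC subrK.
  apply: le_trans (rabsD _ _) _; rewrite lerD2l.
  apply: le_trans ((hK j).2 _) _.
  apply: le_trans (ler_wpM2r (rnorm_ge0 _) (ler_norm _)) _.
  by rewrite mulrC; apply: ler_wpM2r => //; exact: ltW.
have v_le : rnorm v <= KP * rnorm x + e.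
  have := rnormB (P x) (P x - v); rewrite opprB addrC subrK => h.
  by apply: le_trans h _; apply: lerD; [exact: P_bound|exact: ltW].
have h1 := ler_wpM2r o0 near.
have h2 := ler_wpM2l (mulr_ge0 Q'0 n0) v_le.
rewrite mulrDl in h1; rewrite /D; lra.
Qed.

Definition spreading_constant : R := Q ^+ 2 * (Q' * KP).

Lemma spreading_constant_gt0 : 0 < spreading_constant.
Proof.
have Qp : 0 < Q by exact: lt_le_trans Q1.
by rewrite /spreading_constant /Q' !mulr_gt0 ?exprn_gt0 ?addr_gt0 // exprn_gt0.
Qed.

Lemma spreading_bidemocratic_family :
  bidemocratic_family predT w ws Lam spreading_constant.
Proof.
split=> [s c us _ hc|s x us _].
  by apply: (@combo_Lam _ (s, c)); split.
have L : Lam (size s) <= Q ^+ 2 * ones (size s) by apply: Lam_le => p; exact: combo_le.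
have S0 : 0 <= \sum_(j <- s) rabs (ws j x) by apply: sumr_ge0 => j _; exact: rabs_ge0.
apply: le_trans (ler_wpM2l S0 L) _.
rewrite mulrCA /spreading_constant -[Q ^+ 2 * _ * _]mulrA -[leRHS]mulrA.
apply: ler_wpM2l; first exact: exprn_ge0.
exact: coeff_sum.
Qed.

End Spreading.

(** * Complemented subsymmetric subspaces *)

(** Composed with the projection, the coordinate functionals of the copy of [S]
    extend to the whole space and vanish on the kernel of [P], which is where
    the exceptional vectors will be found. *)
Section ComplementedCopy.
Context {R : realType} {k : scalar_kind}.
Local Notation F := (scalar_field R k).
Variables (X : normedModType F) (S : @seq_space R k).
Variables (P : {linear X -> X}) (T : (nat -> F^o) -> X) (KP CT CI : R).
Hypotheses (KP0 : 0 < KP) (P_bound : forall x, rnorm (P x) <= KP * rnorm x).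
Hypothesis P_idem : forall x, P (P x) = P x.
Hypotheses (CT0 : 0 <= CT) (CI0 : 0 <= CI).
Hypothesis T_lin : linear_on S T.
Hypothesis T_bound : forall u, sq_car S u -> rnorm (T u) <= CT * sq_norm S u.
Hypothesis T_inv : forall u, sq_car S u -> sq_norm S u <= CI * rnorm (T u).
Hypothesis T_image : T @` sq_car S = range P.
Hypothesis sub : subsymmetric_space S.

Let car0 : sq_car S 0.
Proof. by apply: sq_c00; apply/c00P; exists 0%N. Qed.
Let carD u v : sq_car S u -> sq_car S v -> sq_car S (u + v).
Proof. by move=> hu hv; rewrite -[u]scale1r; exact: sq_lin. Qed.
Let carZ a u : sq_car S u -> sq_car S (a *: u).
Proof. by move=> hu; rewrite -[_ *: _]addr0; exact: sq_lin. Qed.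
Let carB u v : sq_car S u -> sq_car S v -> sq_car S (u - v).
Proof. by move=> hu hv; rewrite -scaleN1r addrC; exact: sq_lin. Qed.
Let T0 : T 0 = 0.
Proof.
by have := T_lin (-1) car0 car0; rewrite scaler0 addr0 scaleN1r addNr.
Qed.
Let TZ a u : sq_car S u -> T (a *: u) = a *: T u.
Proof. by move=> hu; have := T_lin a hu car0; rewrite T0 !addr0. Qed.
Let TD u v : sq_car S u -> sq_car S v -> T (u + v) = T u + T v.
Proof. by move=> hu hv; have := T_lin 1 hu hv; rewrite !scale1r. Qed.
Let TB u v : sq_car S u -> sq_car S v -> T (u - v) = T u - T v.
Proof. by move=> hu hv; rewrite -scaleN1r addrC T_lin // scaleN1r addrC. Qed.

Let T_inj u v : sq_car S u -> sq_car S v -> T u = T v -> u = v.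
Proof.
move=> hu hv e; apply/eqP; rewrite -subr_eq0; apply/eqP.
have h := carB hu hv; apply: (sq_eq0 h); apply/le_anti.
rewrite sq_ge0 // andbT; apply: le_trans (T_inv h) _.
by rewrite TB // e subrr rnorm0 mulr0.
Qed.

Let car_unit n : sq_car S (unit_seq n).
Proof.
apply: sq_c00; apply/c00P; exists n.+1 => i ni.
by rewrite /unit_seq gtn_eqF.
Qed.

Let car_sum m (a : nat -> F) (pi : nat -> nat) :
  sq_car S (\sum_(0 <= i < m) a i *: unit_seq (pi i)) /\
  T (\sum_(0 <= i < m) a i *: unit_seq (pi i)) = \sum_(0 <= i < m) a i *: T (unit_seq (pi i)).
Proof.
elim: m => [|m [IH1 IH2]]; first by rewrite !big_geq.
rewrite !big_nat_recr //=; have hu := carZ (a m) (car_unit (pi m)).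
by split; [exact: carD|rewrite TD // IH2 TZ].
Qed.

Definition copy_vec n : X := T (unit_seq n).

Let pre x : exists u, sq_car S u /\ T u = P x.
Proof.
have : range P (P x) by exists x.
by rewrite -T_image => -[u hu e]; exists u.
Qed.

Definition copy_seq (x : X) : nat -> F^o := projT1 (cid (pre x)).
Let copy_car x : sq_car S (copy_seq x).
Proof. by rewrite /copy_seq; case: cid => u []. Qed.
Let T_copy x : T (copy_seq x) = P x.
Proof. by rewrite /copy_seq; case: cid => u []. Qed.

Definition copy_fun n (x : X) : F := copy_seq x n.

Let copy_uniq x u : sq_car S u -> T u = P x -> copy_seq x = u.
Proof. by move=> hu e; apply: T_inj => //; rewrite T_copy. Qed.

Lemma copy_fun_bounded : bounded_functionals copy_fun.
Proof.
move=> n; have [C hC] := sq_coord S n.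
exists (`|C| * (CI * KP)); split=> [a x y|x].
  rewrite /copy_fun (copy_uniq (u := a *: copy_seq x + copy_seq y)) //.
    exact: sq_lin.
  by rewrite T_lin // !T_copy linearP.
apply: le_trans (hC _ (copy_car x)) _.
apply: le_trans (ler_wpM2r (sq_ge0 (copy_car x)) (ler_norm _)) _.
rewrite -!mulrA; apply: ler_wpM2l => //.
apply: le_trans (T_inv (copy_car x)) _; apply: ler_wpM2l => //.
by rewrite T_copy.
Qed.

Let P_T u : sq_car S u -> P (T u) = T u.
Proof.
move=> hu; have : (T @` sq_car S) (T u) by exists u.
by rewrite T_image => -[x _ <-].
Qed.

Lemma copy_biorth : biorthogonal copy_vec copy_fun.
Proof.
move=> i j; rewrite /copy_fun /copy_vec (copy_uniq (u := unit_seq j)) //.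
by rewrite P_T.
Qed.

Lemma copy_fun_P n x : copy_fun n (P x) = copy_fun n x.
Proof. by rewrite /copy_fun (copy_uniq (u := copy_seq x)) // T_copy P_idem. Qed.

Lemma copy_fun_ker n x : P x = 0 -> copy_fun n x = 0.
Proof. by move=> Px; rewrite /copy_fun (copy_uniq (u := 0)) // T0 Px. Qed.

Lemma copy_fun_total x : (forall n, copy_fun n x = 0) -> P x = 0.
Proof.
move=> h; rewrite -T_copy (_ : copy_seq x = 0) //; apply/funext => n; exact: h.
Qed.

Lemma P_copy_vec n : P (copy_vec n) = copy_vec n.
Proof. exact: P_T. Qed.

Lemma P_copy_span x : closure (spn copy_vec) (P x).
Proof.
apply/closure_rnorm => e e0; rewrite -T_copy.
have d0 : 0 < e / (CT + 1) by rewrite divr_gt0 // ltr_wpDl.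
have [v [cv hv]] := sq_dense (copy_car x) d0; have carv : sq_car S v by exact: sq_c00.
exists (T v); last first.
  rewrite -TB //; apply: le_lt_trans (T_bound (carB (copy_car x) carv)) _.
  apply: le_lt_trans (ler_wpM2l CT0 (ltW hv)) _.
  rewrite mulrA ltr_pdivrMr; last by rewrite ltr_wpDl.
  by rewrite mulrC mulrDr mulr1 ltrDl.
have [N hN] := (c00P v).1 cv.
rewrite (sum_unit_seq hN) -(big_mkord xpredT (fun i => v i *: unit_seq i)).
rewrite (car_sum N v id).2; apply: (submod_sum (spn_submod _)) => i _.
by apply: (submodZ _ (spn_submod _)); exact: (spn_in copy_vec).
Qed.

Let sq_spread m (a eps : nat -> F) (pi : nat -> nat) :
  (forall n, rabs (eps n) = 1) -> {homo pi : i j / (i < j)%N} ->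
  sq_norm S (\sum_(0 <= i < m) (eps i * a i) *: unit_seq (pi i)) =
  sq_norm S (\sum_(0 <= i < m) a i *: unit_seq i).
Proof.
move=> eps1 hpi; pose a' i : F^o := if (i < m)%N then a i else 0.
have ca : c00 a' by apply/c00P; exists m => n; rewrite /a' ltnNge => ->.
have := sub ca (fun n => (rabs_unit (eps n)).2 (eps1 n)) hpi.
rewrite !(fsbigT_bounded (N := m)).
- rewrite -!(big_mkord xpredT (fun n => (eps n * a' n) *: unit_seq (pi n))).
  rewrite -!(big_mkord xpredT (fun n => a' n *: unit_seq n)).
  have e1 : \sum_(0 <= i < m) (eps i * a' i) *: unit_seq (pi i) =
      \sum_(0 <= i < m) (eps i * a i) *: @unit_seq R k (pi i).
    by apply: eq_big_nat => i /andP[_ im]; rewrite /a' im.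
  have e2 : \sum_(0 <= i < m) a' i *: unit_seq i =
      \sum_(0 <= i < m) a i *: @unit_seq R k i.
    by apply: eq_big_nat => i /andP[_ im]; rewrite /a' im.
  by rewrite e1 e2.
- by move=> n mn; rewrite /a' ltnNge mn scale0r.
- by move=> n mn; rewrite /a' ltnNge mn mulr0 scale0r.
Qed.

Definition copy_constant : R := 1 + CT * CI.

Lemma copy_constant_ge1 : 1 <= copy_constant.
Proof. by rewrite lerDl mulr_ge0. Qed.

Let le_copy (x y : R) : 0 <= y -> x <= CT * (CI * y) -> x <= copy_constant * y.
Proof. by move=> y0 h; rewrite /copy_constant mulrDl mul1r -mulrA; lra. Qed.

Lemma copy_spread_le m (a eps : nat -> F) (pi : nat -> nat) :
  (forall n, rabs (eps n) = 1) -> {homo pi : i j / (i < j)%N} ->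
  rnorm (\sum_(0 <= i < m) (eps i * a i) *: copy_vec (pi i)) <=
    copy_constant * rnorm (\sum_(0 <= i < m) a i *: copy_vec i).
Proof.
move=> eps1 hpi; have [c1 e1] := car_sum m (fun i => eps i * a i) pi.
have [c2 e2] := car_sum m a id; apply: le_copy; first exact: rnorm_ge0.
rewrite -e1 -e2; apply: le_trans (T_bound c1) _; apply: ler_wpM2l => //.
by rewrite sq_spread //; exact: T_inv.
Qed.

Lemma copy_spread_ge m (a eps : nat -> F) (pi : nat -> nat) :
  (forall n, rabs (eps n) = 1) -> {homo pi : i j / (i < j)%N} ->
  rnorm (\sum_(0 <= i < m) a i *: copy_vec i) <=
    copy_constant * rnorm (\sum_(0 <= i < m) (eps i * a i) *: copy_vec (pi i)).
Proof.
move=> eps1 hpi; have [c1 e1] := car_sum m (fun i => eps i * a i) pi.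
have [c2 e2] := car_sum m a id; apply: le_copy; first exact: rnorm_ge0.
rewrite -e1 -e2; apply: le_trans (T_bound c2) _; apply: ler_wpM2l => //.
by rewrite -(sq_spread m a eps1 hpi); exact: T_inv.
Qed.

End ComplementedCopy.

(** The complement of the copy of [S] may be any separable space, of finite or
    infinite dimension; a Markushevich basis of it provides the exceptional
    vectors that [row_decomposition] distributes over the rows. *)
Lemma conditional_bases {R : realType} {k : scalar_kind}
    (X : completeNormedModType (scalar_field R k)) (S : @seq_space R k) :
  separable_space X -> subsymmetric_space S -> has_complemented_subspace X S ->
  exists (Lam : nat -> R) (C : R) (w : nat -> X) (ws : nat -> X -> scalar_field R k),
  [/\ fundamental_growth Lam, 0 < C,
      [/\ biorthogonal w ws, bounded_functionals ws & bidemocratic_family predT w ws Lam C] &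
  forall r, (1 < r)%N -> (forall m, (0 < m)%N -> 2 * Lam m <= Lam (r * m)%N) ->
  exists basis : space_basis X,
  [/\ squeeze_symmetric basis, total_basis basis,
      approx_seq (ktilde basis) (fun m => (ln (1 + m%:R))%:E),
      ~ quasi_greedy basis &
      (forall m, (0 < m)%N -> 2 * Lam (r * m)%N <= r%:R * Lam m) -> bidemocratic basis]].
Proof.
move=> sep sub [P [T [Pc [Pi [[Tl [CT hCT]] [Tim [CI hCI]]]]]]].
have [KP KP0 hKP] := rnorm_continuous_bounded Pc.
have T_bound u : sq_car S u -> rnorm (T u) <= `|CT| * sq_norm S u.
  move=> hu; apply: le_trans (hCT u hu) _; apply: ler_wpM2r; first exact: sq_ge0.
  exact: ler_norm.
have T_inv u : sq_car S u -> sq_norm S u <= `|CI| * rnorm (T u).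
  move=> hu; apply: le_trans (hCI u hu) _; apply: ler_wpM2r; first exact: rnorm_ge0.
  exact: ler_norm.
have CT0 := normr_ge0 CT; have CI0 := normr_ge0 CI.
pose w := copy_vec T; pose ws := copy_fun Tim.
have bw : biorthogonal w ws := copy_biorth Pi Tl T_inv Tim.
have fw : bounded_functionals ws := copy_fun_bounded hKP CI0 Tl T_inv Tim.
pose Q := copy_constant `|CT| `|CI|.
have Q1 : 1 <= Q := copy_constant_ge1 CT0 CI0.
have sp_le := copy_spread_le CT0 Tl T_bound T_inv sub.
have sp_ge := copy_spread_ge CT0 Tl T_bound T_inv sub.
have ws_P j x : ws j (P x) = ws j x := copy_fun_P Pi Tl T_inv Tim j x.
have P_sp x : closure (spn w) (P x).
  exact: (@P_copy_span _ _ _ _ _ _ _ CT0 Tl T_bound Tim x).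
pose Lam := spreading_fundamental w; pose C := spreading_constant Q KP.
have fg : fundamental_growth Lam := spreading_fundamental_growth Q1 bw fw sp_le.
have C0 : 0 < C := spreading_constant_gt0 Q1 KP0.
have dw : bidemocratic_family predT w ws Lam C.
  exact: (spreading_bidemocratic_family Q1 KP0 bw fw sp_le sp_ge hKP ws_P P_sp).
exists Lam, C, w, ws; split=> // r r1 lrp.
have [d [h [dd hb ht]]] := separable_dense_total sep.
pose pi x := x - P x.
have pi_lin a x y : pi (a *: x + y) = a *: pi x + pi y.
  by rewrite /pi linearP scalerBr opprD addrACA.
have pi_idem x : pi (pi x) = pi x by rewrite /pi linearB Pi subrr subr0.
have pi_bound x : rnorm (pi x) <= (1 + KP) * rnorm x.
  by apply: le_trans (rnormB _ _) _; rewrite mulrDl mul1r lerD2l.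
have [z [zeta [alive [fz bz dead z_d z_tot]]]] :=
  markushevich pi_lin pi_idem pi_bound dd hb ht.
have Pz i : P (z i) = 0.
  by have [/= <- _ _] := fz i; rewrite /pi linearB Pi subrr.
have pw j : pi (w j) = 0 by rewrite /pi (P_copy_vec Pi Tim) subrr.
have fzeta : bounded_functionals zeta by move=> i; have [_ h1 _] := fz i.
have zeta_w i j : zeta i (w j) = 0.
  by have [_ /= [K bK] <-] := fz i; rewrite pw; exact: bfunc0v bK.
have ws_z i j : ws i (z j) = 0 :=
  copy_fun_ker Tl T_inv Tim i (Pz j).
have wz_dense (E : set X) : submod E -> (forall j, E (w j)) -> (forall i, E (z i)) ->
    forall f, closure E f.
  move=> sE Ew Ez f; have scE := submod_closure sE.
  have -> : f = P f + pi f by rewrite /pi addrC subrK.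
  apply: (submodD scE).
    by apply: closure_subset (P_sp f) => v sv; exact: sv.
  apply/closure_rnorm => e e0.
  have K1 : 0 < 1 + KP by rewrite addr_gt0.
  have [n hn] := dd f (e / (1 + KP)) ltac:(by rewrite divr_gt0).
  exists (pi (d n)); first exact: (z_d n E sE Ez).
  have -> : pi f - pi (d n) = pi (f - d n).
    by have := pi_lin (-1) (d n) f; rewrite !scaleN1r addrC => ->; rewrite addrC.
  by apply: le_lt_trans (pi_bound _) _; rewrite mulrC -ltr_pdivlMr.
have wz_total f : (forall j, ws j f = 0) -> (forall i, zeta i f = 0) -> f = 0.
  move=> h1 h2; have -> : f = P f + pi f by rewrite /pi addrC subrK.
  by rewrite (copy_fun_total Tl h1) (z_tot f h2) addr0.
have [w0 [w0s [Y [Ys [[bw0 fw0 dw0] [bY Ysw wsY Yb] wYd wYt Yrow]]]]] :=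
  row_decomposition fg (ltW C0) bw fw dw fzeta bz dead zeta_w ws_z wz_dense wz_total.
have [Phi [Phi_bij Phi_row]] := interleaving_enumeration.
have B0 : 0 < row_bound (Lam 1%N) C.
  have L1 : 0 < Lam 1%N by case: fg.
  have := divr_gt0 C0 L1; rewrite /row_bound; lra.
exact: (assembled_basis r1 fg (ltW C0) B0 bw0 fw0 dw0 bY Ysw wsY Yb wYd wYt Yrow
  lrp Phi_bij Phi_row).
Qed.

Theorem corollary5p5 (R : realType) (k : scalar_kind)
    (X : completeNormedModType (scalar_field R k)) (S : @seq_space R k) :
  separable_space X ->
  subsymmetric_space S ->
  has_complemented_subspace X S ->
  (nontrivial_type X ->
     exists B : space_basis X,
       bidemocratic B /\ total_basis B /\
       approx_seq (ktilde B) (fun m => (ln (1 + m%:R))%:E)%R /\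
       ~ quasi_greedy B) /\
  (nontrivial_cotype X ->
     exists B : space_basis X,
       squeeze_symmetric B /\ total_basis B /\
       approx_seq (ktilde B) (fun m => (ln (1 + m%:R))%:E)%R /\
       ~ quasi_greedy B).
Proof.
move=> sep sub comp.
have [Lam [C [w [ws [fg C0 [bw fw dw] bases]]]]] := conditional_bases sep sub comp.
split=> [type|cotype].
  have [r r1 [lower upper]] := type_regular fg C0 bw fw dw type.
  have [B [_ tot kt nqg bi]] := bases r r1 lower.
  by exists B; split; [exact: bi|].
have [r r1 lower] := cotype_lower_regular fg C0 bw fw dw cotype.
have [B [sq tot kt nqg _]] := bases r r1 lower.
by exists B.
Qed.
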